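(* When $|\arg(-x)|<\pi$ and $|x|\to\infty$, we have $$\Psi_1[a,b;c,c';x,y]\sim\mathfrak{f}_c(b,a)(-x)^{-a}+\mathfrak{f}_c(a,b)(-x)^{-b}\,{}_1F_1\left[\begin{matrix}a-b\\ c'\end{matrix};y\right],\qquad \mathfrak{f}_{\gamma}(a,b):=\frac{\Gamma(\gamma)\Gamma(a-b)}{\Gamma(a)\Gamma(\gamma-b)}.$$ The complete expansion is $$\Psi_1[a,b;c,c';x,y]=\mathfrak{f}_c(b,a)(-x)^{-a}\mathbf{U}_1(x,y)+\mathfrak{f}_c(a,b)(-x)^{-b}\mathbf{U}_2(x,y),$$ where, for $|x|>1$ and $|y|<\infty$, $$\mathbf{U}_1(x,y)=\sum_{k=0}^{\infty}{}_1F_1\left[\begin{matrix}-k\\ c'\end{matrix};y\right]\frac{(a)_k(1-c+a)_k}{(1-b+a)_k\,k!}\frac{1}{x^k},\qquad \mathbf{U}_2(x,y)=\sum_{\ell=0}^{\infty}{}_1F_1\left[\begin{matrix}a-b-\ell\\ c'\end{matrix};y\right]\frac{(1-c+b)_\ell(b)_\ell}{(1-a+b)_\ell\,\ell!}\frac{1}{x^\ell}.$$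
   Context: All arguments and complex powers take principal values; $(\cdot)_n$ is the Pochhammer symbol; ${}_1F_1$ is Kummer's confluent hypergeometric function; ${}_2F_1$ is the principal branch of the Gauss hypergeometric function. The complex parameters $a,b,c,c'$ are such that the expressions involved are defined. The Humbert function $\Psi_1$ is $$\Psi_1[a,b;c,c';x,y]=\sum_{m,n=0}^{\infty}\frac{(a)_{m+n}(b)_m}{(c)_m(c')_n}\frac{x^m}{m!}\frac{y^n}{n!}\quad(|x|<1,\ |y|<\infty),$$ continued analytically to $\{(x,y)\in\mathbb{C}^2: x\ne1,\ |\arg(1-x)|<\pi,\ |y|<\infty\}$ by the absolutely convergent series $\Psi_1[a,b;c,c';x,y]=\sum_{n=0}^{\infty}\frac{(a)_n}{(c')_n}\,{}_2F_1[a+n,b;c;x]\frac{y^n}{n!}$.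
   Formalization: The ''~'' fails if the leading sum cancels (Re a = Re b) or the 1F1 factor vanishes; it is stated as an error o(|f_c(b,a)(-x)^{-a}|+|f_c(a,b)(-x)^{-b}|), and as true ''~'' on regions where the leading sum is at least a constant times that scale. *)

(* Defs.v *)
From Stdlib Require Import Reals Factorial ClassicalEpsilon.
From Coquelicot Require Import Coquelicot.
Open Scope R_scope.

(** ** Limits and series of complex numbers

    Coquelicot's [Lim_seq] and [Series] are real-valued; these are their
    componentwise versions.  They are total, so convergence is asserted
    separately, with [ex_series] or [is_series] over [C_NormedModule]. *)

Definition CLim_seq (u : nat -> C) : C :=
  (real (Lim_seq (fun n => Re (u n))), real (Lim_seq (fun n => Im (u n)))).

Definition CSeries (u : nat -> C) : C := CLim_seq (sum_n u).

(** ** Principal values *)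

(** [Carg z] lies in (-PI, PI] for [z <> 0]; the value at 0 is irrelevant. *)
Definition Carg (z : C) : R :=
  if Rle_dec 0 (Im z) then acos (Re z / Cmod z) else - acos (Re z / Cmod z).

Definition Clog (z : C) : C := (ln (Cmod z), Carg z).

Definition Cexp (z : C) : C :=
  (exp (Re z) * cos (Im z), exp (Re z) * sin (Im z)).

Definition Cpower (z w : C) : C := Cexp (Cmult w (Clog z)).

(** ** Pochhammer symbol and Gamma function *)

Fixpoint poch (a : C) (n : nat) : C :=
  match n with
  | O => RtoC 1
  | S m => Cmult (poch a m) (Cplus a (RtoC (INR m)))
  end.

Definition nonpos_int (z : C) : Prop := exists n : nat, z = RtoC (- INR n).

Definition is_int (z : C) : Prop := exists k : Z, z = RtoC (IZR k).

Definition Cfact (n : nat) : C := RtoC (INR (fact n)).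

(** The entire function 1/Gamma, by Gauss's formula
    1/Gamma(z) = lim z (z+1) ... (z+n) / (n! n^z);
    it vanishes at the nonpositive integers. *)
Definition rGamma (z : C) : C :=
  CLim_seq (fun n =>
    Cdiv (poch z (S n)) (Cmult (Cfact n) (Cpower (RtoC (INR n)) z))).

(** Meaningful away from the nonpositive integers. *)
Definition Gamma (z : C) : C := Cinv (rGamma z).

(** Gamma(c) Gamma(a-b) / (Gamma(a) Gamma(c-b)).  The denominator is written
    with 1/Gamma, so that the quotient is 0, as usual, when [a] or [c - b] is a
    pole of Gamma. *)
Definition ff (c a b : C) : C :=
  Cmult (Cmult (Gamma c) (Gamma (Cminus a b)))
        (Cmult (rGamma a) (rGamma (Cminus c b))).

(** ** Hypergeometric functions of one variable *)

Definition hyp1F1 (a c z : C) : C :=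
  CSeries (fun n =>
    Cmult (Cdiv (poch a n) (poch c n)) (Cdiv (Cpow z n) (Cfact n))).

Definition gauss_term (a b c z : C) (n : nat) : C :=
  Cmult (Cdiv (Cmult (poch a n) (poch b n)) (poch c n))
        (Cdiv (Cpow z n) (Cfact n)).

Definition analytic_at (f : C -> C) (z0 : C) : Prop :=
  exists (u : nat -> C) (r : posreal), forall z : C,
    Cmod (Cminus z z0) < r ->
    is_pseries (K := C_AbsRing) (V := C_NormedModule) u (Cminus z z0) (f z).

(** The plane cut along [1, +oo). *)
Definition cut_plane (z : C) : Prop :=
  z <> RtoC 1 /\ Rabs (Carg (Cminus (RtoC 1) z)) < PI.

Definition principal_2F1 (a b c : C) (F : C -> C) : Prop :=
  (forall z, cut_plane z -> analytic_at F z) /\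
  (forall z, Cmod z < 1 ->
     is_series (K := C_AbsRing) (V := C_NormedModule)
       (gauss_term a b c z) (F z)).

(** For [c] not a nonpositive integer, [principal_2F1 a b c] determines its
    argument on [cut_plane]; the values elsewhere are arbitrary. *)
Definition hyp2F1 (a b c : C) : C -> C :=
  epsilon (inhabits (fun _ : C => RtoC 0)) (principal_2F1 a b c).

(** ** The Humbert function Psi_1 *)

Definition Psi1_double_term (a b c c' x y : C) (m n : nat) : C :=
  Cmult
    (Cdiv (Cmult (poch a (m + n)) (poch b m)) (Cmult (poch c m) (poch c' n)))
    (Cmult (Cdiv (Cpow x m) (Cfact m)) (Cdiv (Cpow y n) (Cfact n))).

Definition Psi1_term (a b c c' x y : C) (n : nat) : C :=
  Cmult
    (Cmult (Cdiv (poch a n) (poch c' n))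
           (hyp2F1 (Cplus a (RtoC (INR n))) b c x))
    (Cdiv (Cpow y n) (Cfact n)).

(** On |x| < 1 the double series converges absolutely, so the order of
    summation is immaterial; elsewhere [Psi1] is its continuation to
    [cut_plane] in [x]. *)
Definition Psi1 (a b c c' x y : C) : C :=
  if Rlt_dec (Cmod x) 1
  then CSeries (fun m => CSeries (fun n => Psi1_double_term a b c c' x y m n))
  else CSeries (Psi1_term a b c c' x y).

(** ** The expansion at infinity *)

Definition U1_term (a b c c' x y : C) (k : nat) : C :=
  Cmult
    (Cmult (hyp1F1 (RtoC (- INR k)) c' y)
       (Cdiv (Cmult (poch a k) (poch (Cplus (Cminus (RtoC 1) c) a) k))
             (Cmult (poch (Cplus (Cminus (RtoC 1) b) a) k) (Cfact k))))
    (Cinv (Cpow x k)).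

Definition U2_term (a b c c' x y : C) (l : nat) : C :=
  Cmult
    (Cmult (hyp1F1 (Cminus (Cminus a b) (RtoC (INR l))) c' y)
       (Cdiv (Cmult (poch (Cplus (Cminus (RtoC 1) c) b) l) (poch b l))
             (Cmult (poch (Cplus (Cminus (RtoC 1) a) b) l) (Cfact l))))
    (Cinv (Cpow x l)).

Definition U1 (a b c c' x y : C) : C := CSeries (U1_term a b c c' x y).
Definition U2 (a b c c' x y : C) : C := CSeries (U2_term a b c c' x y).

(** |arg(-x)| < PI, i.e. the plane cut along [0, +oo). *)
Definition sector (x : C) : Prop :=
  x <> RtoC 0 /\ Rabs (Carg (Copp x)) < PI.

Definition lead1 (a b c x : C) : C :=
  Cmult (ff c b a) (Cpower (Copp x) (Copp a)).
Definition lead2 (a b c x : C) : C :=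
  Cmult (ff c a b) (Cpower (Copp x) (Copp b)).

Definition Psi1_leading (a b c c' x y : C) : C :=
  Cplus (lead1 a b c x)
        (Cmult (lead2 a b c x) (hyp1F1 (Cminus a b) c' y)).

(** f = g + o(h) as |x| -> oo inside [D], with a bound uniform on [D]. *)
Definition asymp_o (D : C -> Prop) (f g : C -> C) (h : C -> R) : Prop :=
  forall eps : R, 0 < eps -> exists M : R, forall x : C,
    D x -> M < Cmod x -> Cmod (Cminus (f x) (g x)) <= eps * h x.

(** f ~ g as |x| -> oo inside [D]. *)
Definition asymp_equiv (D : C -> Prop) (f g : C -> C) : Prop :=
  asymp_o D f g (fun x => Cmod (g x)).

(** The size of the two leading powers of -x, with their coefficients.  The sum [Psi1_leading] can be
    much smaller, since its terms may cancel when Re a = Re b (it then may even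
    vanish for arbitrarily large x), and since the 1F1 factor may be 0. *)
Definition lead_scale (a b c x : C) : R :=
  Cmod (lead1 a b c x) + Cmod (lead2 a b c x).

Definition nondegenerate_on (D : C -> Prop) (a b c c' y : C) : Prop :=
  exists delta M : R, 0 < delta /\ forall x : C, D x -> M < Cmod x ->
    delta * lead_scale a b c x <= Cmod (Psi1_leading a b c c' x y).

(* Main.v *)
Require Import Defs.
From Stdlib Require Import Reals Factorial Classical ClassicalEpsilon Wf_nat Lra Lia.
From Coquelicot Require Import Coquelicot.
Open Scope R_scope.

(** The expansion comes from the connection formula at infinity for
    [2F1[a+n, b; c; x]]: inserted in the series defining [Psi1] for |x| > 1, it gives two
    double series, which converge absolutely and, summed in the other order, are [U1] and
    [U2].

    The connection formula.  On -1 < z < 0 the Gauss series and the two solutions with exponents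
    [a] and [b] at infinity, expanded in powers of 1/(1-z), solve one second order equation.
    Their weighted Wronskians are constants.  The one of the two solutions at infinity is
    found at z = -oo; the ones involving the Gauss series are found at z = 0-, where for
    Re c > 0 an Abelian theorem and Gauss's product for 1/Gamma apply.  The operator
    z d/dz + c then carries the formula from c+1 to c.

    The continuation.  Expanded in powers of 1/(1/2-z), the solutions at infinity converge outside
    the disk with diameter [0,1].  Together with the unit disk this covers the plane cut along
    [1,oo), and the overlap is a crescent on which the identity theorem, applied along arcs
    around 0, transports the formula from the negative axis.  This yields the existence of the
    continued 2F1 as well as its value for |x| > 1. *)

(* The type of [sum_n u n] is only convertible to [C], and [ring] does not see through it. *)
Ltac cabs := repeat match goal with |- context [@sum_n ?G ?u ?n] =>
  let x := fresh "x" in set (x := @sum_n G u n : C); clearbody x end.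
Ltac cring := cabs; match goal with |- @eq _ ?a ?b => refine (_ : @eq C a b) end; ring.

(** The same two solutions at infinity are expanded three times because the domains differ. Powers
    of 1/(-z) give the wanted terms but converge only for |z| > 1, away from the Gauss series.
    Powers of 1/(1-z) converge on the whole negative axis, so all solutions can be compared on
    (-1,0); by the Pfaff transformation their coefficients keep the product form (a)_n (c-b)_n /
    ((1-b+a)_n n!). Powers of 1/(1/2-z) lose that form, but the singularities 0 and 1 are equally
    far from 1/2, which makes the excluded disk as small as possible. That a-b is not an integer
    keeps (1-b+a)_n and the Wronskian b-a of the two solutions nonzero, and this survives the shift
    of a to a+n. Re c > 0 makes (1-s)^(-c) blow up as s = 1/(1-z) tends to 1, so that the limit of
    the coefficient ratios decides the limit of the series. The interchange of sums rests on the
    growth of 1F1[al_k; c'; y] for |al_k| <= X + k: it is O(r^k) for every r > 1, hence harmless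
    against |x|^(-k) when |x| > 1. *)

Notation is_csum := (@is_series C_AbsRing C_NormedModule).
Notation csummable u := (ex_series (fun n => Cmod (u n))).

(** * Series of complex numbers *)

Lemma csum_eps (u : nat -> C) (s : C) :
  is_csum u s <->
  forall eps, 0 < eps -> exists N0, forall N, (N0 <= N)%nat ->
    Cmod (sum_n u N - s) < eps.
Proof.
  etransitivity; [apply (filterlim_locally_ball_norm (K := C_AbsRing) (U := C_NormedModule))|].
  split.
  - intros H eps Heps; destruct (H (mkposreal eps Heps)) as [N0 HN0].
    exists N0; intros N HN; exact (HN0 N HN).
  - intros H eps; destruct (H eps (cond_pos eps)) as [N0 HN0].
    exists N0; intros N HN; exact (HN0 N HN).
Qed.

Lemma Re_sum_n (u : nat -> C) N : Re (sum_n u N) = sum_n (fun n => Re (u n)) N.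
Proof.
  induction N as [|N IH]; [now rewrite !sum_O|].
  rewrite !sum_Sn, <- IH; reflexivity.
Qed.

Lemma Im_sum_n (u : nat -> C) N : Im (sum_n u N) = sum_n (fun n => Im (u n)) N.
Proof.
  induction N as [|N IH]; [now rewrite !sum_O|].
  rewrite !sum_Sn, <- IH; reflexivity.
Qed.

Lemma Im_le_Cmod (z : C) : Rabs (Im z) <= Cmod z.
Proof. apply Rle_trans with (2 := Rmax_Cmod z), Rmax_r. Qed.

Lemma Cmod_le_Re_Im (z : C) : Cmod z <= Rabs (Re z) + Rabs (Im z).
Proof.
  destruct z as [x y]; unfold Re, Im; simpl.
  replace (x, y) with (RtoC x + Ci * RtoC y)%C.
  - apply Rle_trans with (1 := Cmod_triangle _ _).
    rewrite Cmod_mult, Cmod_Ci, !Cmod_R; lra.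
  - unfold Cplus, Cmult, Ci, RtoC; simpl; f_equal; ring.
Qed.

Lemma csum_components (u : nat -> C) (s : C) :
  is_csum u s <->
  is_series (fun n => Re (u n)) (Re s) /\ is_series (fun n => Im (u n)) (Im s).
Proof.
  rewrite csum_eps; split.
  - intros H; split; apply (filterlim_locally_ball_norm (K := R_AbsRing) (U := R_NormedModule));
      intros eps; destruct (H eps (cond_pos eps)) as [N0 HN0];
      exists N0; intros N HN; specialize (HN0 N HN);
      apply Rle_lt_trans with (2 := HN0).
    + rewrite <- Re_sum_n.
      replace (norm (minus _ _)) with (Rabs (Re (sum_n u N - s))).
      apply re_le_Cmod. reflexivity.
    + rewrite <- Im_sum_n.
      replace (norm (minus _ _)) with (Rabs (Im (sum_n u N - s))).
      apply Im_le_Cmod. reflexivity.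
  - intros [H1 H2] eps Heps.
    unfold is_series in H1, H2.
    rewrite (filterlim_locally_ball_norm (K := R_AbsRing) (U := R_NormedModule)) in H1, H2.
    assert (He : 0 < eps / 2) by lra.
    destruct (H1 (mkposreal _ He)) as [N1 HN1].
    destruct (H2 (mkposreal _ He)) as [N2 HN2].
    exists (Nat.max N1 N2); intros N HN.
    apply Rle_lt_trans with (1 := Cmod_le_Re_Im _).
    assert (h1 := HN1 N ltac:(lia)). assert (h2 := HN2 N ltac:(lia)).
    rewrite <- Re_sum_n in h1; rewrite <- Im_sum_n in h2.
    change (Rabs (Re (sum_n u N - s)) < eps / 2) in h1.
    change (Rabs (Im (sum_n u N - s)) < eps / 2) in h2.
    lra.
Qed.

Lemma CSeries_unique (u : nat -> C) (s : C) : is_csum u s -> CSeries u = s.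
Proof.
  rewrite csum_components; intros [H1 H2].
  unfold CSeries, CLim_seq.
  rewrite (Lim_seq_ext _ (sum_n (fun n => Re (u n))) (Re_sum_n u)).
  rewrite (Lim_seq_ext _ (sum_n (fun n => Im (u n))) (Im_sum_n u)).
  fold (Series (fun n => Re (u n))); fold (Series (fun n => Im (u n))).
  rewrite (is_series_unique _ _ H1), (is_series_unique _ _ H2).
  now destruct s.
Qed.

(** Completeness of [C] enters here: the total [CSeries] has a value for any sequence, and absolute
    convergence makes that value the sum. *)
Lemma csum_correct (u : nat -> C) : csummable u -> is_csum u (CSeries u).
Proof.
  intros H.
  destruct (ex_series_le (K := C_AbsRing) (V := C_CompleteNormedModule)
    u (fun n => Cmod (u n)) (fun n => Rle_refl _) H) as [s Hs].
  now rewrite (CSeries_unique u s Hs).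
Qed.

Lemma CSeries_ext (u v : nat -> C) : (forall n, u n = v n) -> CSeries u = CSeries v.
Proof.
  intros H; unfold CSeries, CLim_seq; f_equal; f_equal;
    apply Lim_seq_ext; intros n; f_equal; now apply sum_n_ext.
Qed.

Lemma csum_ext (u v : nat -> C) (s : C) : (forall n, u n = v n) -> is_csum u s -> is_csum v s.
Proof. exact (is_series_ext u v s). Qed.

Lemma csum_scal (c : C) (u : nat -> C) (s : C) :
  is_csum u s -> is_csum (fun n => (c * u n)%C) (c * s)%C.
Proof. exact (is_series_scal (K := C_AbsRing) (V := C_NormedModule) c u s). Qed.

Lemma csum_plus (u v : nat -> C) (s t : C) :
  is_csum u s -> is_csum v t -> is_csum (fun n => (u n + v n)%C) (s + t)%C.
Proof. exact (is_series_plus (K := C_AbsRing) (V := C_NormedModule) u v s t). Qed.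

Lemma csummable_scal (c : C) (u : nat -> C) :
  csummable u -> csummable (fun n => (c * u n)%C).
Proof.
  intros H; apply ex_series_ext with (fun n => Rmult (Cmod c) (Cmod (u n))).
  - intros n; now rewrite Cmod_mult.
  - now apply (ex_series_scal (V := R_NormedModule)).
Qed.

Lemma csummable_le (u : nat -> C) (b : nat -> R) :
  (forall n, Cmod (u n) <= b n) -> ex_series b -> csummable u.
Proof.
  intros H Hb; apply (ex_series_le (K := R_AbsRing) (V := R_CompleteNormedModule)) with b; auto.
  intros n; change (Rabs (Cmod (u n)) <= b n).
  rewrite Rabs_pos_eq; [apply H | apply Cmod_ge_0].
Qed.

Lemma csummable_plus (u v : nat -> C) :
  csummable u -> csummable v -> csummable (fun n => (u n + v n)%C).
Proof.
  intros Hu Hv; apply csummable_le with (fun n => Cmod (u n) + Cmod (v n)).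
  - intros n; apply Cmod_triangle.
  - now apply (ex_series_plus (V := R_NormedModule)).
Qed.

Lemma CSeries_scal (c : C) (u : nat -> C) :
  csummable u -> CSeries (fun n => (c * u n)%C) = (c * CSeries u)%C.
Proof. intros H; now apply CSeries_unique, csum_scal, csum_correct. Qed.

Lemma CSeries_plus (u v : nat -> C) : csummable u -> csummable v ->
  CSeries (fun n => (u n + v n)%C) = (CSeries u + CSeries v)%C.
Proof. intros; now apply CSeries_unique, csum_plus; apply csum_correct. Qed.

Lemma CSeries_incr_1 (u : nat -> C) : csummable u ->
  CSeries u = (u O + CSeries (fun n => u (S n)))%C.
Proof.
  intros H; apply CSeries_unique.
  apply (is_series_decr_1 (K := C_AbsRing) (V := C_NormedModule)).
  assert (Hs : csummable (fun n => u (S n))) by now apply (ex_series_incr_1 (fun n => Cmod (u n))).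
  match goal with |- is_series _ ?x => replace x with (CSeries (fun n => u (S n))) end.
  - now apply csum_correct.
  - change (CSeries (fun n => u (S n)) = (u O + CSeries (fun n => u (S n)) + - u O)%C).
    ring.
Qed.

Lemma sum_n_Cmod_le (u : nat -> C) N :
  Cmod (sum_n u N) <= sum_n (fun n => Cmod (u n)) N.
Proof. exact (norm_sum_n_m (K := C_AbsRing) (V := C_NormedModule) u 0 N). Qed.

Lemma sum_n_le_Series (a : nat -> R) N : (forall n, 0 <= a n) -> ex_series a ->
  sum_n a N <= Series a.
Proof.
  intros Ha [s Hs]; rewrite (is_series_unique _ _ Hs).
  apply (is_lim_seq_incr_compare (sum_n a)); [exact Hs|].
  intros n; rewrite sum_Sn; change (sum_n a n <= sum_n a n + a (S n)).
  specialize (Ha (S n)); lra.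
Qed.

(** Closed balls are closed. The bound is asked only from the index [K] on, which is what the block
    estimates for double series provide. *)
Lemma Cmod_limit_le (u : nat -> C) (s t : C) (B : R) (K : nat) : is_csum u s ->
  (forall N, (K <= N)%nat -> Cmod (sum_n u N - t) <= B) -> Cmod (s - t) <= B.
Proof.
  rewrite csum_eps; intros H HB.
  apply Rle_plus_epsilon; intros eps Heps.
  destruct (H eps Heps) as [N0 HN0].
  specialize (HN0 (Nat.max N0 K) ltac:(lia)); specialize (HB (Nat.max N0 K) ltac:(lia)).
  set (x := sum_n u _) in *.
  replace (s - t)%C with (x - t + - (x - s))%C by cring.
  apply Rle_trans with (1 := Cmod_triangle _ _).
  rewrite Cmod_opp; lra.
Qed.

Lemma CSeries_bound (u : nat -> C) :
  csummable u -> Cmod (CSeries u) <= Series (fun n => Cmod (u n)).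
Proof.
  intros H.
  replace (CSeries u) with (CSeries u - 0)%C by (ring).
  apply Cmod_limit_le with u O; [now apply csum_correct|].
  intros N _; replace (sum_n u N - 0)%C with (sum_n u N) by cring.
  apply Rle_trans with (1 := sum_n_Cmod_le u N).
  apply sum_n_le_Series; auto; intros; apply Cmod_ge_0.
Qed.

Lemma ex_series_pos_bounded (a : nat -> R) (B : R) : (forall n, 0 <= a n) ->
  (forall N, sum_n a N <= B) -> ex_series a.
Proof.
  intros Ha HB.
  destruct (ex_finite_lim_seq_incr (sum_n a) B) as [l Hl]; auto.
  - intros n; rewrite sum_Sn; change (sum_n a n <= sum_n a n + a (S n)).
    specialize (Ha (S n)); lra.
  - now exists l.
Qed.

Lemma sum_n_R_S (a : nat -> R) n : sum_n a (S n) = sum_n a n + a (S n).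
Proof. exact (sum_Sn a n). Qed.

Lemma sum_n_C_S (a : nat -> C) n : sum_n a (S n) = (sum_n a n + a (S n))%C.
Proof. exact (sum_Sn a n). Qed.

Lemma sum_n_le (a b : nat -> R) N : (forall n, (n <= N)%nat -> a n <= b n) ->
  sum_n a N <= sum_n b N.
Proof.
  intros H; induction N as [|N IH]; [rewrite !sum_O; auto|].
  rewrite !sum_n_R_S; apply Rplus_le_compat; auto.
Qed.

Lemma sum_n_nonneg (a : nat -> R) N : (forall n, 0 <= a n) -> 0 <= sum_n a N.
Proof.
  intros H; induction N as [|N IH]; [rewrite sum_O; auto|].
  rewrite sum_n_R_S; specialize (H (S N)); lra.
Qed.

Lemma sum_n_block_le (x : nat -> C) (y : nat -> R) K N : (K <= N)%nat ->
  (forall n, Cmod (x n) <= y n) ->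
  Cmod (sum_n x N - sum_n x K) <= sum_n y N - sum_n y K.
Proof.
  intros HK H; induction HK as [|N HK IH].
  - replace (_ - _)%C with (RtoC 0) by (ring); rewrite Cmod_0; lra.
  - rewrite sum_n_C_S, sum_n_R_S.
    replace (sum_n x N + x (S N) - sum_n x K)%C
      with (sum_n x N - sum_n x K + x (S N))%C by cring.
    apply Rle_trans with (1 := Cmod_triangle _ _); specialize (H (S N)); lra.
Qed.

(** * Absolutely convergent double series *)

Section Fubini.

Variables (u : nat -> nat -> C) (B : R).
Let a N M : R := sum_n (fun n => sum_n (fun m => Cmod (u n m)) M) N.
Hypothesis HB : forall N M, a N M <= B.

Lemma double_row_summable n : csummable (u n).
Proof.
  apply ex_series_pos_bounded with B; [intros; apply Cmod_ge_0|].
  intros M; apply Rle_trans with (2 := HB n M); unfold a.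
  destruct n as [|n]; [rewrite sum_O; lra|].
  rewrite sum_n_R_S.
  assert (0 <= sum_n (fun n => sum_n (fun m => Cmod (u n m)) M) n); [|lra].
  apply sum_n_nonneg; intros; apply sum_n_nonneg; intros; apply Cmod_ge_0.
Qed.

Lemma double_rows_summable : csummable (fun n => CSeries (u n)).
Proof.
  apply csummable_le with (fun n => Series (fun m => Cmod (u n m))).
  { intros n; apply CSeries_bound, double_row_summable. }
  apply ex_series_pos_bounded with B.
  - intros n; apply Rle_trans with (2 := CSeries_bound _ (double_row_summable n)), Cmod_ge_0.
  - intros N.
    assert (H : is_lim_seq (a N) (sum_n (fun n => Series (fun m => Cmod (u n m))) N)).
    { unfold a; induction N as [|N IH].
      - apply is_lim_seq_ext with (sum_n (fun m => Cmod (u 0%nat m))).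
        intros M; now rewrite sum_O.
        rewrite sum_O; exact (Series_correct _ (double_row_summable 0)).
      - rewrite sum_n_R_S.
        apply is_lim_seq_ext with (fun M =>
          sum_n (fun n => sum_n (fun m => Cmod (u n m)) M) N + sum_n (fun m => Cmod (u (S N) m)) M).
        intros M; now rewrite sum_n_R_S.
        apply is_lim_seq_plus'; [exact IH|exact (Series_correct _ (double_row_summable (S N)))]. }
    apply (is_lim_seq_le _ (fun _ => B) _ B (HB N) H), is_lim_seq_const.
Qed.

(** The rectangle minus the square splits into the rows beyond [K], at full width, and the columns
    beyond [K] within the rows up to [K]. Each piece is dominated by the same piece of the array of
    moduli. *)
Lemma double_block_le K N M : (K <= N)%nat -> (K <= M)%nat ->
  Cmod (sum_n (fun n => sum_n (u n) M) N - sum_n (fun n => sum_n (u n) K) K)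
    <= a N M - a K K.
Proof.
  intros HN HM.
  replace (_ - _)%C with
    (sum_n (fun n => sum_n (u n) M) N - sum_n (fun n => sum_n (u n) M) K +
       (sum_n (fun m => sum_n (fun n => u n m) K) M -
               sum_n (fun m => sum_n (fun n => u n m) K) K))%C.
  2:{ assert (E1 : sum_n (fun m => sum_n (fun n => u n m) K) M =
        sum_n (fun n => sum_n (u n) M) K) by (symmetry; apply sum_n_switch).
      assert (E2 : sum_n (fun m => sum_n (fun n => u n m) K) K =
        sum_n (fun n => sum_n (u n) K) K) by (symmetry; apply sum_n_switch).
      rewrite E1, E2; cring. }
  apply Rle_trans with (1 := Cmod_triangle _ _).
  replace (a N M - a K K) with ((a N M - a K M) + (a K M - a K K)) by ring.
  apply Rplus_le_compat.
  - apply sum_n_block_le; auto; intros; apply sum_n_Cmod_le.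
  - unfold a; rewrite !(sum_n_switch (fun n m => Cmod (u n m)) K).
    apply sum_n_block_le; auto; intros; apply (sum_n_Cmod_le (fun n0 => u n0 n)).
Qed.

Lemma double_rows_block_le K N A : (K <= N)%nat -> (forall N M, a N M <= A) ->
  Cmod (sum_n (fun n => CSeries (u n)) N - sum_n (fun n => sum_n (u n) K) K)
    <= A - a K K.
Proof.
  intros HN HA.
  apply Cmod_limit_le with (fun m => sum_n (fun n => u n m) N) K.
  - clear HN; induction N as [|N IH].
    + rewrite sum_O; apply (is_series_ext (u 0%nat)); [intros; now rewrite sum_O|].
      apply csum_correct, double_row_summable.
    + rewrite sum_n_C_S.
      apply is_series_ext with (fun m => (sum_n (fun n => u n m) N + u (S N) m)%C).
      intros; symmetry; apply (sum_n_C_S (fun n0 => u n0 n)).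
      apply csum_plus; [exact IH| apply csum_correct, double_row_summable].
  - intros M HM; rewrite <- (sum_n_switch u).
    apply Rle_trans with (1 := double_block_le K N M HN HM).
    specialize (HA N M); lra.
Qed.

End Fubini.

(** Both iterated sums lie within [A - a K K] of the same square partial sum [T], where [A] is the
    limit of the increasing square sums of moduli; that difference tends to 0. *)
Lemma CSeries_fubini (u : nat -> nat -> C) (B : R) :
  (forall N M, sum_n (fun n => sum_n (fun m => Cmod (u n m)) M) N <= B) ->
  CSeries (fun n => CSeries (u n)) = CSeries (fun m => CSeries (fun n => u n m)).
Proof.
  intros HB.
  set (a := fun N M => (sum_n (fun n => sum_n (fun m => Cmod (u n m)) M) N : R)) in *.
  assert (HB' : forall M N, sum_n (fun m => sum_n (fun n => Cmod (u n m)) N) M <= B).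
  { intros M N; rewrite <- (sum_n_switch (fun n m => Cmod (u n m))); apply HB. }
  assert (Hr := csum_correct _ (double_rows_summable u B HB)).
  assert (Hc := csum_correct _ (double_rows_summable (fun m n => u n m) B HB')).
  cbv beta in Hc.
  destruct (ex_finite_lim_seq_incr (fun K => a K K) B) as [A HA].
  { intros n; unfold a; rewrite sum_n_R_S.
    apply Rle_trans with (sum_n (fun n0 => sum_n (fun m => Cmod (u n0 m)) (S n)) n).
    - apply sum_n_le; intros k _; rewrite sum_n_R_S; assert (H := Cmod_ge_0 (u k (S n))); lra.
    - assert (0 <= sum_n (fun m => Cmod (u (S n) m)) (S n)); [|lra].
      apply sum_n_nonneg; intros; apply Cmod_ge_0. }
  { intros; apply HB. }
  assert (Hmono : forall N N' M M', (N <= N')%nat -> (M <= M')%nat -> a N M <= a N' M').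
  { intros N N' M M' H1 H2; unfold a.
    apply Rle_trans with (sum_n (fun n => sum_n (fun m => Cmod (u n m)) M') N).
    - apply sum_n_le; intros k _.
      induction H2; [lra|]; rewrite sum_n_R_S; assert (H := Cmod_ge_0 (u k (S m))); lra.
    - induction H1; [lra|]; rewrite sum_n_R_S.
      assert (0 <= sum_n (fun k => Cmod (u (S m) k)) M'); [|lra].
      apply sum_n_nonneg; intros; apply Cmod_ge_0. }
  assert (HA' : forall N M, a N M <= A).
  { intros N M; apply Rle_trans with (a (Nat.max N M) (Nat.max N M)); [apply Hmono; lia|].
    apply (is_lim_seq_incr_compare (fun K => a K K)); auto. }
  apply Ceq_minus, Cmod_eq_0, Rle_antisym; [|apply Cmod_ge_0].
  apply Rle_plus_epsilon; intros eps Heps; rewrite Rplus_0_l.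
  apply is_lim_seq_spec in HA.
  destruct (HA (mkposreal (eps / 2) ltac:(lra))) as [K HK]; simpl in HK.
  specialize (HK K (le_n _)); apply Rabs_def2 in HK; destruct HK as [HK1 HK2].
  set (T := sum_n (fun n => sum_n (u n) K) K).
  assert (E1 : Cmod (CSeries (fun n => CSeries (u n)) - T) <= A - a K K).
  { apply Cmod_limit_le with (1 := Hr) (K := K); intros N HN.
    now apply (double_rows_block_le u B HB). }
  assert (E2 : Cmod (CSeries (fun m => CSeries (fun n => u n m)) - T) <= A - a K K).
  { apply Cmod_limit_le with (1 := Hc) (K := K); intros N HN; unfold T.
    rewrite (sum_n_switch u).
    replace (a K K) with (sum_n (fun m => sum_n (fun n => Cmod (u n m)) K) K)
      by (symmetry; apply (sum_n_switch (fun n m => Cmod (u n m)))).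
    apply (double_rows_block_le (fun m n => u n m) B HB'); auto.
    intros N' M'; rewrite <- (sum_n_switch (fun n m => Cmod (u n m))); apply HA'. }
  revert E1 E2; generalize (CSeries (fun n => CSeries (u n)))
    (CSeries (fun m => CSeries (fun n => u n m))); intros X Y E1 E2.
  replace (X - Y)%C with (X - T + - (Y - T))%C by ring.
  apply Rle_trans with (1 := Cmod_triangle _ _); rewrite Cmod_opp; lra.
Qed.

(** * Pochhammer symbols and geometric growth rates *)

Lemma RtoC_neq_0 (x : R) : x <> 0 -> RtoC x <> RtoC 0.
Proof. intros H E; apply H, (RtoC_inj _ _ E). Qed.

Lemma INR_S_neq_0 n : RtoC (INR (S n)) <> RtoC 0.
Proof. apply RtoC_neq_0, not_0_INR; lia. Qed.

Lemma Cfact_neq_0 n : Cfact n <> RtoC 0.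
Proof. apply RtoC_neq_0, INR_fact_neq_0. Qed.

Lemma Cfact_S n : Cfact (S n) = (Cfact n * INR (S n))%C.
Proof.
  unfold Cfact; rewrite <- RtoC_mult; f_equal.
  replace (fact (S n)) with (fact n * S n)%nat by (simpl; lia); apply mult_INR.
Qed.

Lemma RtoC_INR_S n : RtoC (INR (S n)) = (INR n + 1)%C.
Proof. now rewrite S_INR, RtoC_plus. Qed.

Lemma Cplus_INR_neq_0 (y : C) n : ~ nonpos_int y -> (y + INR n)%C <> RtoC 0.
Proof.
  intros H E; apply H; exists n; rewrite RtoC_opp.
  replace y with (y + INR n - INR n)%C by ring.
  rewrite E; ring.
Qed.

Lemma poch_neq_0 (y : C) n : ~ nonpos_int y -> poch y n <> RtoC 0.
Proof.
  intros H; induction n as [|n IH]; simpl; [exact C1_nz|].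
  now apply Cmult_neq_0; [|apply Cplus_INR_neq_0].
Qed.

Lemma poch_S_l (x : C) n : poch x (S n) = (x * poch (x + 1) n)%C.
Proof.
  induction n as [|n IH]; [simpl; ring|].
  change (poch x (S (S n))) with (poch x (S n) * (x + INR (S n)))%C.
  rewrite IH, RtoC_INR_S; simpl; ring.
Qed.

Lemma poch_add (x : C) n m :
  poch x (n + m) = (poch x n * poch (x + INR n) m)%C.
Proof.
  induction m as [|m IH]; [rewrite Nat.add_0_r; simpl; ring|].
  rewrite Nat.add_succ_r; simpl; rewrite IH, plus_INR, RtoC_plus; ring.
Qed.

Lemma poch_1 n : poch (RtoC 1) n = Cfact n.
Proof.
  induction n as [|n IH]; [reflexivity|].
  rewrite Cfact_S, <- IH, RtoC_INR_S; simpl; ring.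
Qed.

(** The Taylor coefficients of (1-w)^(-x), so that convolution identities and majorants can be read
    off from products of powers of 1-w. *)
Definition rf (x : C) (n : nat) : C := (poch x n / Cfact n)%C.

Lemma rf_0 x : rf x 0 = RtoC 1.
Proof. unfold rf, Cfact; simpl; field; exact C1_nz. Qed.

Lemma rf_S x n : (INR (S n) * rf x (S n))%C = ((x + INR n) * rf x n)%C.
Proof.
  unfold rf; rewrite Cfact_S; simpl poch; field; split; auto using INR_S_neq_0, Cfact_neq_0.
Qed.

Lemma one_not_nonpos_int : ~ nonpos_int (RtoC 1).
Proof. intros [n Hn]; apply RtoC_inj in Hn; assert (H := pos_INR n); lra. Qed.

(** For nonnegative [rho] this is limsup |u n|^(1/n) <= rho, with [rho] the reciprocal of a radius
    of convergence. Since every r > rho is allowed, polynomial factors, shifts and Pochhammer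
    quotients leave [rho] unchanged and no exact growth has to be tracked. *)
Definition rate (u : nat -> C) (rho : R) : Prop :=
  forall r, rho < r -> exists K, forall n, Cmod (u n) <= K * r ^ n.

Lemma rate_nonneg_const (u : nat -> C) K r : (forall n, Cmod (u n) <= K * r ^ n) -> 0 <= K.
Proof. intros H; specialize (H O); assert (h := Cmod_ge_0 (u O)); simpl in H; lra. Qed.

Lemma rate_ext (u v : nat -> C) rho : (forall n, u n = v n) -> rate u rho -> rate v rho.
Proof. intros E H r Hr; destruct (H r Hr) as [K HK]; exists K; intros; rewrite <- E; auto. Qed.

(** The ratio test; the finitely many terms before the ratio settles are absorbed into the
    constant. *)
Lemma rate_ratio (u q : nat -> C) rho : 0 <= rho ->
  (forall n, u (S n) = (q n * u n)%C) ->
  (forall r, rho < r -> exists N, forall n, (N <= n)%nat -> Cmod (q n) <= r) ->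
  rate u rho.
Proof.
  intros Hrho Hu Hq r Hr; destruct (Hq r Hr) as [N HN].
  assert (Hr0 : 0 < r) by lra.
  assert (Hfin : forall M, exists K, 0 <= K /\ forall n, (n <= M)%nat -> Cmod (u n) <= K * r ^ n).
  { induction M as [|M [K [HK0 HK]]].
    - exists (Cmod (u O)); split; [apply Cmod_ge_0|].
      intros n Hn; replace n with O by lia; simpl; lra.
    - exists (K + Cmod (u (S M)) / r ^ S M); split.
      + apply Rplus_le_le_0_compat; auto.
        apply Rmult_le_pos; [apply Cmod_ge_0|apply Rlt_le, Rinv_0_lt_compat, pow_lt; auto].
      + intros n Hn; assert (Hp := pow_lt r n Hr0).
        assert (Hp' := pow_lt r (S M) Hr0).
        assert (0 <= Cmod (u (S M)) / r ^ S M).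
        { apply Rmult_le_pos; [apply Cmod_ge_0|apply Rlt_le, Rinv_0_lt_compat, Hp']. }
        destruct (Nat.eq_dec n (S M)) as [->|Hne].
        * rewrite Rmult_plus_distr_r; unfold Rdiv; rewrite Rmult_assoc, Rinv_l by lra.
          assert (0 <= K * r ^ S M) by (apply Rmult_le_pos; lra); lra.
        * assert (h := HK n ltac:(lia)); nra. }
  destruct (Hfin N) as [K [HK0 HK]]; exists K; intros n.
  destruct (Nat.le_gt_cases n N) as [Hn|Hn]; [auto|].
  assert (Hn' : (N <= n)%nat) by lia; clear Hn.
  induction Hn' as [|n Hn IH]; [auto|].
  rewrite Hu, Cmod_mult; simpl.
  assert (h := HN n Hn); assert (h1 := Cmod_ge_0 (q n)); assert (h2 := Cmod_ge_0 (u n)).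
  apply Rle_trans with (r * (K * r ^ n)); [|lra].
  now apply Rmult_le_compat.
Qed.

Lemma rate_mult (u v : nat -> C) rho sig : 0 <= rho -> 0 <= sig ->
  rate u rho -> rate v sig -> rate (fun n => (u n * v n)%C) (rho * sig).
Proof.
  intros Hr Hs Hu Hv r Hrs.
  (* As e <= 1, (rho+e)(sig+e) <= rho sig + e (rho+sig+1) <= r. *)
  set (e := Rmin 1 ((r - rho * sig) / (rho + sig + 1))).
  assert (He1 : 0 < (r - rho * sig) / (rho + sig + 1)) by (apply Rdiv_lt_0_compat; lra).
  assert (He : 0 < e) by (apply Rmin_glb_lt; lra).
  assert (He' : e <= 1) by apply Rmin_l.
  assert (He2 : e * (rho + sig + 1) <= r - rho * sig).
  { apply Rle_trans with ((r - rho * sig) / (rho + sig + 1) * (rho + sig + 1)).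
    - apply Rmult_le_compat_r; [lra|apply Rmin_r].
    - right; field; lra. }
  destruct (Hu (rho + e) ltac:(lra)) as [K HK]; destruct (Hv (sig + e) ltac:(lra)) as [L HL].
  assert (HK0 := rate_nonneg_const _ _ _ HK); assert (HL0 := rate_nonneg_const _ _ _ HL).
  exists (K * L); intros n; rewrite Cmod_mult.
  apply Rle_trans with (K * (rho + e) ^ n * (L * (sig + e) ^ n)).
  - apply Rmult_le_compat; auto; apply Cmod_ge_0.
  - replace (K * (rho + e) ^ n * (L * (sig + e) ^ n)) with (K * L * ((rho + e) * (sig + e)) ^ n)
      by (rewrite Rpow_mult_distr; ring).
    apply Rmult_le_compat_l; [now apply Rmult_le_pos|].
    apply pow_incr; split; [apply Rmult_le_pos; lra|nra].
Qed.

Lemma rate_Cpow (c : C) : rate (fun n => (c ^ n)%C) (Cmod c).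
Proof.
  intros r Hr; exists 1; intros n; rewrite Cmod_pow, Rmult_1_l.
  apply pow_incr; split; [apply Cmod_ge_0|lra].
Qed.

Lemma rate_const (c : C) : rate (fun _ => c) 1.
Proof.
  intros r Hr; exists (Cmod c); intros n; rewrite <- (Rmult_1_r (Cmod c)) at 1.
  apply Rmult_le_compat_l; [apply Cmod_ge_0|apply pow_R1_Rle; lra].
Qed.

Lemma rate_weaken (u : nat -> C) rho sig : rho <= sig -> rate u rho -> rate u sig.
Proof. intros H Hu r Hr; apply Hu; lra. Qed.

Lemma rate_mult1 (u v : nat -> C) rho : 0 <= rho ->
  rate u rho -> rate v 1 -> rate (fun n => (u n * v n)%C) rho.
Proof. intros Hr Hu Hv; rewrite <- (Rmult_1_r rho); apply rate_mult; auto; lra. Qed.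

Lemma rate_shift (u : nat -> C) rho : 0 <= rho -> rate u rho -> rate (fun n => u (S n)) rho.
Proof.
  intros H0 Hu r Hr; destruct (Hu r Hr) as [K HK]; exists (K * r); intros n.
  apply Rle_trans with (1 := HK (S n)); simpl; lra.
Qed.

Lemma Cmod_plus_INR_ge (y : C) n : INR n - Cmod y <= Cmod (y + INR n).
Proof.
  assert (H := Cmod_triangle (y + INR n)%C (- y)%C).
  replace (y + INR n + - y)%C with (RtoC (INR n)) in H by ring.
  rewrite Cmod_R, Cmod_opp, (Rabs_pos_eq _ (pos_INR n)) in H; lra.
Qed.

Lemma rate_poch_ratio (x y : C) : ~ nonpos_int y ->
  rate (fun n => (poch x n / poch y n)%C) 1.
Proof.
  intros Hy.
  apply rate_ratio with (fun n => ((x + INR n) / (y + INR n))%C); [lra| |].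
  - intros n; simpl; field; split; auto using Cplus_INR_neq_0, poch_neq_0.
  - intros r Hr.
    (* The ratio is 1 + (x-y)/(y+n). Beyond this index |y+n| exceeds |x-y|/(r-1), so the ratio has
       modulus at most r. *)
    destruct (nfloor_ex (Cmod y + Cmod (x - y) / (r - 1))) as [N [_ HN]].
    { apply Rplus_le_le_0_compat; [apply Cmod_ge_0|].
      apply Rmult_le_pos; [apply Cmod_ge_0|apply Rlt_le, Rinv_0_lt_compat; lra]. }
    exists (S N); intros n Hn.
    assert (Hn' := le_INR _ _ Hn); rewrite S_INR in Hn'.
    assert (h := Cmod_plus_INR_ge y n).
    set (Y := (y + INR n)%C) in *.
    assert (HY : Y <> 0) by now apply Cplus_INR_neq_0.
    replace ((x + INR n) / Y)%C with (1 + (x - y) / Y)%C.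
    2:{ unfold Y; field; exact HY. }
    apply Rle_trans with (1 := Cmod_triangle _ _).
    rewrite Cmod_1, Cmod_div by exact HY.
    set (d := Cmod (x - y)) in *.
    assert (Hd : 0 <= d) by apply Cmod_ge_0.
    assert (Hq : d / (r - 1) < Cmod Y) by lra.
    assert (HY0 : 0 < Cmod Y) by now apply Cmod_gt_0.
    assert (d < Cmod Y * (r - 1)) by (apply (Rmult_lt_compat_r (r - 1)) in Hq; [|lra];
      replace (d / (r - 1) * (r - 1)) with d in Hq by (field; lra); lra).
    assert (d / Cmod Y <= r - 1); [|lra].
    apply (Rmult_le_reg_r (Cmod Y)); auto; unfold Rdiv; rewrite Rmult_assoc, Rinv_l by lra; lra.
Qed.

Lemma rate_poch_inv (y : C) : ~ nonpos_int y -> rate (fun n => (/ poch y n)%C) 0.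
Proof.
  intros Hy.
  apply rate_ratio with (fun n => (/ (y + INR n))%C); [lra| |].
  - intros n; simpl; field; split; auto using Cplus_INR_neq_0, poch_neq_0.
  - intros r Hr.
    destruct (nfloor_ex (Cmod y + / r)) as [N [_ HN]].
    { apply Rplus_le_le_0_compat; [apply Cmod_ge_0|apply Rlt_le, Rinv_0_lt_compat; lra]. }
    exists (S N); intros n Hn.
    assert (Hn' := le_INR _ _ Hn); rewrite S_INR in Hn'.
    assert (h := Cmod_plus_INR_ge y n).
    rewrite Cmod_inv by now apply Cplus_INR_neq_0.
    rewrite <- (Rinv_inv r); apply Rinv_le_contravar; [apply Rinv_0_lt_compat; lra|lra].
Qed.

Lemma rate_rf (x : C) : rate (rf x) 1.
Proof.
  apply rate_ext with (fun n => (poch x n / poch (RtoC 1) n)%C).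
  - intros n; now rewrite poch_1.
  - apply rate_poch_ratio, one_not_nonpos_int.
Qed.

Lemma rate_INR_plus (x : C) : rate (fun n => (x + INR n)%C) 1.
Proof.
  intros r Hr.
  assert (Hr1 : 0 < r - 1) by lra.
  exists (Cmod x + / (r - 1)); intros n.
  apply Rle_trans with (1 := Cmod_triangle _ _).
  rewrite Cmod_R, (Rabs_pos_eq _ (pos_INR n)), Rmult_plus_distr_r.
  apply Rplus_le_compat.
  - rewrite <- (Rmult_1_r (Cmod x)) at 1.
    apply Rmult_le_compat_l; [apply Cmod_ge_0|apply pow_R1_Rle; lra].
  - apply (Rmult_le_reg_l (r - 1)); auto.
    rewrite <- Rmult_assoc, Rinv_r, Rmult_1_l by lra.
    (* Bernoulli's inequality 1 + n (r-1) <= r^n. *)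
    assert (h := poly n (r - 1) Hr1); replace (1 + (r - 1)) with r in h by ring; lra.
Qed.

(** Each of the n+1 terms is at most K L r1^n with rho < r1 < r, and the factor n+1 is absorbed in
    passing from r1 to r. *)
Lemma rate_conv (u v : nat -> C) rho : 0 <= rho -> rate u rho -> rate v rho ->
  rate (fun n => sum_n (fun i => (u i * v (n - i)%nat)%C) n) rho.
Proof.
  intros H0 Hu Hv r Hr.
  set (r1 := (rho + r) / 2).
  assert (Hr1 : rho < r1 < r) by (unfold r1; lra).
  destruct (Hu r1 ltac:(lra)) as [K HK]; destruct (Hv r1 ltac:(lra)) as [L HL].
  assert (HK0 := rate_nonneg_const _ _ _ HK); assert (HL0 := rate_nonneg_const _ _ _ HL).
  destruct (rate_INR_plus (RtoC 1) (r / r1)) as [J HJ].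
  { apply (Rmult_lt_reg_r r1); [lra|]; unfold Rdiv; rewrite Rmult_assoc, Rinv_l by lra; lra. }
  exists (K * L * J); intros n.
  apply Rle_trans with (1 := sum_n_Cmod_le _ n).
  apply Rle_trans with (sum_n (fun _ => K * L * r1 ^ n) n).
  - apply sum_n_le; intros i Hi; rewrite Cmod_mult.
    replace (K * L * r1 ^ n) with (K * r1 ^ i * (L * r1 ^ (n - i))).
    + apply Rmult_le_compat; auto; apply Cmod_ge_0.
    + replace n with (i + (n - i))%nat at 2 by lia; rewrite pow_add; ring.
  - rewrite sum_n_const.
    specialize (HJ n); rewrite <- RtoC_plus, Cmod_R, Rabs_pos_eq in HJ
      by (assert (h := pos_INR n); lra).
    replace (INR (S n)) with (1 + INR n) by (rewrite S_INR; ring).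
    replace (K * L * J * r ^ n) with (J * (r / r1) ^ n * (K * L * r1 ^ n)).
    + apply Rmult_le_compat_r; auto.
      apply Rmult_le_pos; [now apply Rmult_le_pos|apply pow_le; lra].
    + unfold Rdiv; rewrite Rpow_mult_distr, pow_inv; field; apply pow_nonzero; lra.
Qed.

(** * Power series *)

Definition hC (d : nat -> C) (z : C) : C := CSeries (fun k => (d k * z ^ k)%C).

Lemma geom_bound_summable (u : nat -> C) K r : 0 <= r < 1 ->
  (forall n, Cmod (u n) <= K * r ^ n) -> csummable u.
Proof.
  intros Hr H; apply csummable_le with (1 := H).
  apply (ex_series_scal (V := R_NormedModule) K), ex_series_geom.
  rewrite Rabs_pos_eq; lra.
Qed.

Lemma rate_summable1 (u : nat -> C) rho : rho < 1 -> rate u rho -> csummable u.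
Proof.
  intros H Hu.
  destruct (Hu (Rmax (1/2) ((1 + rho) / 2))) as [K HK].
  { apply Rlt_le_trans with (2 := Rmax_r _ _); lra. }
  apply geom_bound_summable with (2 := HK); split.
  - apply Rle_trans with (2 := Rmax_l _ _); lra.
  - apply Rmax_lub_lt; lra.
Qed.

Lemma rate_summable (d : nat -> C) rho z : 0 <= rho -> rate d rho -> rho * Cmod z < 1 ->
  csummable (fun k => (d k * z ^ k)%C).
Proof.
  intros H0 Hd Hz; apply rate_summable1 with (1 := Hz).
  apply rate_mult; auto; [apply Cmod_ge_0|apply rate_Cpow].
Qed.

Lemma hC_step d rho z : 0 <= rho -> rate d rho -> rho * Cmod z < 1 ->
  hC d z = (d O + z * hC (fun k => d (S k)) z)%C.
Proof.
  intros H0 Hd Hz; unfold hC.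
  rewrite CSeries_incr_1 by now apply rate_summable with rho.
  rewrite <- CSeries_scal by (apply rate_summable with rho; auto; now apply rate_shift).
  simpl Cpow; f_equal; [ring|].
  apply CSeries_ext; intros n; ring.
Qed.

(** The series of moduli at the real point [r] dominates the whole closed disk. *)
Lemma hC_bound d rho r : 0 <= rho -> rate d rho -> 0 <= r -> rho * r < 1 ->
  exists K, 0 <= K /\ forall z, Cmod z <= r -> Cmod (hC d z) <= K.
Proof.
  intros H0 Hd Hr Hrr.
  assert (Hs : csummable (fun k => (d k * RtoC r ^ k)%C)).
  { apply rate_summable with rho; auto; rewrite Cmod_R, Rabs_pos_eq; auto. }
  assert (Hb : forall z, Cmod z <= r -> Cmod (hC d z) <=
    Series (fun k => Cmod (d k * RtoC r ^ k))).
  { intros z Hz; unfold hC.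
    assert (Hsz : csummable (fun k => (d k * z ^ k)%C)).
    { apply rate_summable with rho; auto.
      apply Rle_lt_trans with (2 := Hrr), Rmult_le_compat_l; auto. }
    apply Rle_trans with (1 := CSeries_bound _ Hsz).
    apply Series_le; auto; intros n; split; [apply Cmod_ge_0|].
    rewrite !Cmod_mult, !Cmod_pow, Cmod_R, (Rabs_pos_eq r Hr).
    apply Rmult_le_compat_l; [apply Cmod_ge_0|].
    apply pow_incr; split; [apply Cmod_ge_0|auto]. }
  eexists; split; [|exact Hb].
  apply Rle_trans with (2 := Hb (RtoC 0) ltac:(rewrite Cmod_0; auto)), Cmod_ge_0.
Qed.

Lemma hC_plus d e rho z : 0 <= rho -> rate d rho -> rate e rho -> rho * Cmod z < 1 ->
  hC (fun k => (d k + e k)%C) z = (hC d z + hC e z)%C.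
Proof.
  intros; unfold hC; rewrite <- CSeries_plus by now apply rate_summable with rho.
  apply CSeries_ext; intros; ring.
Qed.

Lemma hC_scal c d rho z : 0 <= rho -> rate d rho -> rho * Cmod z < 1 ->
  hC (fun k => (c * d k)%C) z = (c * hC d z)%C.
Proof.
  intros; unfold hC; rewrite <- CSeries_scal by now apply rate_summable with rho.
  apply CSeries_ext; intros; ring.
Qed.

Lemma hC_ext d e z : (forall k, d k = e k) -> hC d z = hC e z.
Proof. intros H; apply CSeries_ext; intros; now rewrite H. Qed.

(** * Complex-valued functions of a real variable *)

(** Differential equations are used only along real lines, so a derivative in a real variable, taken
    in each component, is enough and makes real calculus applicable. *)
Definition dRC (f : R -> C) (t : R) (l : C) : Prop :=
  is_derive (fun s => Re (f s)) t (Re l) /\ is_derive (fun s => Im (f s)) t (Im l).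

Lemma dRC_ext_loc (f g : R -> C) t l :
  locally t (fun s => f s = g s) -> dRC f t l -> dRC g t l.
Proof.
  intros H [H1 H2]; split.
  - apply is_derive_ext_loc with (2 := H1); apply filter_imp with (2 := H); intros s Hs; now
    rewrite Hs.
  - apply is_derive_ext_loc with (2 := H2); apply filter_imp with (2 := H); intros s Hs; now
    rewrite Hs.
Qed.

Lemma dRC_ext (f g : R -> C) t l : (forall s, f s = g s) -> dRC f t l -> dRC g t l.
Proof. intros H; apply dRC_ext_loc; apply filter_forall; auto. Qed.

Lemma dRC_eq (f : R -> C) t l l' : dRC f t l -> l = l' -> dRC f t l'.
Proof. now intros H <-. Qed.

Lemma dRC_const (c : C) t : dRC (fun _ => c) t (RtoC 0).
Proof. split; apply (is_derive_const (V := R_NormedModule)). Qed.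

Lemma dRC_id t : dRC RtoC t (RtoC 1).
Proof.
  split; [apply (is_derive_id (K := R_AbsRing))|apply (is_derive_const (V := R_NormedModule) 0)].
Qed.

Lemma dRC_plus f g t l m : dRC f t l -> dRC g t m ->
  dRC (fun s => (f s + g s)%C) t (l + m)%C.
Proof.
  intros [H1 H2] [H3 H4]; split.
  - exact (is_derive_plus (V := R_NormedModule) _ _ _ _ _ H1 H3).
  - exact (is_derive_plus (V := R_NormedModule) _ _ _ _ _ H2 H4).
Qed.

Lemma dRC_mult f g t l m : dRC f t l -> dRC g t m ->
  dRC (fun s => (f s * g s)%C) t (l * g t + f t * m)%C.
Proof.
  intros [H1 H2] [H3 H4]; split.
  - evar_last.
    exact (is_derive_minus (V := R_NormedModule) _ _ _ _ _
      (is_derive_mult _ _ _ _ _ H1 H3 Rmult_comm) (is_derive_mult _ _ _ _ _ H2 H4 Rmult_comm)).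
    unfold Re, Im, minus, plus, mult, opp, Cplus, Cmult; simpl; ring.
  - evar_last.
    exact (is_derive_plus (V := R_NormedModule) _ _ _ _ _
      (is_derive_mult _ _ _ _ _ H1 H4 Rmult_comm) (is_derive_mult _ _ _ _ _ H2 H3 Rmult_comm)).
    unfold Re, Im, minus, plus, mult, opp, Cplus, Cmult; simpl; ring.
Qed.

Lemma dRC_scal c f t l : dRC f t l -> dRC (fun s => (c * f s)%C) t (c * l)%C.
Proof.
  intros H; eapply dRC_eq; [exact (dRC_mult _ _ _ _ _ (dRC_const c t) H)|simpl; ring].
Qed.

Lemma dRC_minus f g t l m : dRC f t l -> dRC g t m ->
  dRC (fun s => (f s - g s)%C) t (l - m)%C.
Proof.
  intros Hf Hg; apply dRC_eq with (l + - RtoC 1 * m)%C.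
  2:{ ring. }
  apply dRC_ext with (fun s => (f s + - RtoC 1 * g s)%C).
  { intros s; ring. }
  now apply dRC_plus, dRC_scal.
Qed.

Lemma dRC_comp f g t l m : dRC f (g t) l -> is_derive g t m ->
  dRC (fun s => f (g s)) t (RtoC m * l)%C.
Proof.
  intros [H1 H2] Hg; split; rewrite ?re_scal_l, ?im_scal_l.
  - exact (is_derive_comp (V := R_NormedModule) _ g t _ m H1 Hg).
  - exact (is_derive_comp (V := R_NormedModule) _ g t _ m H2 Hg).
Qed.

Lemma dRC_zero_const f a b : a < b -> (forall t, a <= t <= b -> dRC f t (RtoC 0)) -> f a = f b.
Proof.
  intros Hab H.
  assert (H1 : Re (f a) = Re (f b)).
  { apply (eq_is_derive (V := R_NormedModule) (fun s => Re (f s))); auto; intros t Ht; apply (H t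
    Ht). }
  assert (H2 : Im (f a) = Im (f b)).
  { apply (eq_is_derive (V := R_NormedModule) (fun s => Im (f s))); auto; intros t Ht; apply (H t
    Ht). }
  destruct (f a), (f b); unfold Re, Im in *; simpl in *; now subst.
Qed.

Definition dS (d : nat -> C) (k : nat) : C := (INR (S k) * d (S k))%C.

Lemma rate_dS d rho : 0 <= rho -> rate d rho -> rate (dS d) rho.
Proof.
  intros H0 H; unfold dS.
  apply rate_ext with (fun n => (d (S n) * (1 + INR n))%C).
  { intros n; rewrite RtoC_INR_S; ring. }
  apply rate_mult1; auto; [now apply rate_shift|apply rate_INR_plus].
Qed.

Lemma rate_INR_mult d rho : 0 <= rho -> rate d rho ->
  rate (fun k => (INR k * d k)%C) rho.
Proof.
  intros H0 H.
  apply rate_ext with (fun n => (d n * (0 + INR n))%C).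
  { intros n; ring. }
  apply rate_mult1; auto; apply rate_INR_plus.
Qed.

Lemma hC_theta d rho z : 0 <= rho -> rate d rho -> rho * Cmod z < 1 ->
  hC (fun k => (INR k * d k)%C) z = (z * hC (dS d) z)%C.
Proof.
  intros H0 Hd Hz.
  rewrite (hC_step _ rho) by (auto using rate_INR_mult); change (INR 0) with 0.
  unfold dS; ring.
Qed.

Lemma Re_CSeries u : Re (CSeries u) = Series (fun n => Re (u n)).
Proof. unfold CSeries, CLim_seq, Series; simpl; f_equal; apply Lim_seq_ext, Re_sum_n. Qed.

Lemma Im_CSeries u : Im (CSeries u) = Series (fun n => Im (u n)).
Proof. unfold CSeries, CLim_seq, Series; simpl; f_equal; apply Lim_seq_ext, Im_sum_n. Qed.

Lemma Re_hC d t : Re (hC d (RtoC t)) = PSeries (fun k => Re (d k)) t.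
Proof.
  unfold hC; rewrite Re_CSeries; apply Series_ext; intros n.
  rewrite <- RtoC_pow, re_scal_r; reflexivity.
Qed.

Lemma Im_hC d t : Im (hC d (RtoC t)) = PSeries (fun k => Im (d k)) t.
Proof.
  unfold hC; rewrite Im_CSeries; apply Series_ext; intros n.
  rewrite <- RtoC_pow, im_scal_r; reflexivity.
Qed.

Lemma rate_CV_radius (a : nat -> R) d rho t : 0 <= rho -> rate d rho -> rho * Rabs t < 1 ->
  (forall n, Rabs (a n) <= Cmod (d n)) -> Rbar_lt (Rabs t) (CV_radius a).
Proof.
  intros H0 Hd Ht Ha.
  set (T := Rabs t) in *; assert (HT : 0 <= T) by apply Rabs_pos.
  assert (Hex : exists r, T < r /\ rho * r < 1).
  (* A radius strictly between |t| and 1/rho; for rho = 0 the inverse carries no information, hence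
     the case distinction. *)
  { exists (if Req_EM_T rho 0 then T + 1 else (T + / rho) / 2); destruct (Req_EM_T rho 0) as [E|E].
    - split; [lra|rewrite E; lra].
    - assert (Hp : 0 < / rho) by (apply Rinv_0_lt_compat; lra).
      assert (T < / rho).
      { apply (Rmult_lt_reg_l rho); [lra|]; rewrite Rinv_r; lra. }
      split; [lra|]. apply (Rmult_lt_compat_l rho) in H; [|lra].
      rewrite Rinv_r in H by lra.
      replace (rho * ((T + / rho) / 2)) with ((rho * T + 1) / 2) by (field; lra); lra. }
  destruct Hex as [r [Hr1 Hr2]].
  apply Rbar_lt_le_trans with r; [exact Hr1|].
  apply (CV_radius_bounded a).
  destruct (Hd (/ r)) as [K HK].
  { apply (Rmult_lt_reg_r r); [lra|]; rewrite Rinv_l; lra. }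
  exists K; intros n; rewrite Rabs_mult, <- RPow_abs, (Rabs_pos_eq r) by lra.
  specialize (Ha n); specialize (HK n).
  apply (Rmult_le_reg_r ((/ r) ^ n)); [apply pow_lt, Rinv_0_lt_compat; lra|].
  rewrite Rmult_assoc, <- Rpow_mult_distr, Rinv_r, pow1 by lra; lra.
Qed.

Lemma dRC_hC d rho t : 0 <= rho -> rate d rho -> rho * Rabs t < 1 ->
  dRC (fun s => hC d (RtoC s)) t (hC (dS d) (RtoC t)).
Proof.
  intros H0 Hd Ht; split.
  - rewrite Re_hC; apply is_derive_ext with (PSeries (fun k => Re (d k))); [intros; now rewrite
    Re_hC|].
    evar_last; [apply is_derive_PSeries, rate_CV_radius with d rho; auto; intros; apply
      re_le_Cmod|].
    apply PSeries_ext; intros n; unfold PS_derive, dS; now rewrite re_scal_l.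
  - rewrite Im_hC; apply is_derive_ext with (PSeries (fun k => Im (d k))); [intros; now rewrite
    Im_hC|].
    evar_last; [apply is_derive_PSeries, rate_CV_radius with d rho; auto; intros; apply
      Im_le_Cmod|].
    apply PSeries_ext; intros n; unfold PS_derive, dS; now rewrite im_scal_l.
Qed.

(** * Exponential, logarithm and powers *)

Lemma Cexp_plus z w : Cexp (z + w) = (Cexp z * Cexp w)%C.
Proof.
  unfold Cexp; rewrite re_plus, im_plus, exp_plus, cos_plus, sin_plus.
  unfold Cmult; simpl; f_equal; ring.
Qed.

Lemma Cexp_0 : Cexp (RtoC 0) = RtoC 1.
Proof. unfold Cexp, RtoC; simpl; rewrite exp_0, cos_0, sin_0; f_equal; ring. Qed.

Lemma Cmod_Cexp z : Cmod (Cexp z) = exp (Re z).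
Proof.
  unfold Cmod, Cexp; simpl.
  replace (_ + _) with (Rsqr (exp (Re z))).
  - apply sqrt_Rsqr, Rlt_le, exp_pos.
  - assert (H := sin2_cos2 (Im z)); unfold Rsqr in *.
    transitivity (exp (Re z) * exp (Re z) * (sin (Im z) * sin (Im z) + cos (Im z) * cos (Im z)));
      [rewrite H; ring|ring].
Qed.

Lemma Cexp_neq_0 z : Cexp z <> RtoC 0.
Proof. apply Cmod_gt_0; rewrite Cmod_Cexp; apply exp_pos. Qed.

Lemma dRC_Cexp g t l : dRC g t l -> dRC (fun s => Cexp (g s)) t (l * Cexp (g t))%C.
Proof.
  intros [H1 H2].
  assert (He : is_derive (fun s => exp (Re (g s))) t (Re l * exp (Re (g t)))).
  { exact (is_derive_comp (V := R_NormedModule) exp _ t _ _ (is_derive_exp _) H1). }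
  assert (Hc : is_derive (fun s => cos (Im (g s))) t (Im l * - sin (Im (g t)))).
  { exact (is_derive_comp (V := R_NormedModule) cos _ t _ _ (is_derive_cos _) H2). }
  assert (Hs : is_derive (fun s => sin (Im (g s))) t (Im l * cos (Im (g t)))).
  { exact (is_derive_comp (V := R_NormedModule) sin _ t _ _ (is_derive_sin _) H2). }
  split.
  - evar_last; [exact (is_derive_mult _ _ _ _ _ He Hc Rmult_comm)|].
    rewrite re_mult; unfold Cexp, plus, mult; simpl; ring.
  - evar_last; [exact (is_derive_mult _ _ _ _ _ He Hs Rmult_comm)|].
    rewrite im_mult; unfold Cexp, plus, mult; simpl; ring.
Qed.

(** The plane cut along (-oo, 0], stated without the argument: a visibly open condition that is easy
    to check. [Carg_bound] and [offcut_Carg] relate it to |arg v| < PI. *)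
Definition offcut (v : C) : Prop := 0 < Re v \/ Im v <> 0.

Lemma offcut_neq_0 v : offcut v -> v <> RtoC 0.
Proof. intros [H|H] ->; simpl in H; [lra|now apply H]. Qed.

Lemma Cmod_sqr v : Cmod v * Cmod v = Re v * Re v + Im v * Im v.
Proof. assert (H := Cmod2_alt v); simpl in H; lra. Qed.

Lemma offcut_denominator v : offcut v -> 0 < Cmod v + Re v.
Proof.
  intros H; assert (Hs := Cmod_sqr v).
  assert (H0 := Cmod_gt_0 v); assert (Hn := offcut_neq_0 v H).
  apply H0 in Hn; destruct H as [H|H]; [lra|].
  assert (0 < Im v * Im v) by nra; nra.
Qed.

Lemma cos_double_atan q : cos (2 * atan q) = (1 - q * q) / (1 + q * q).
Proof.
  assert (Hq : 0 < 1 + q * q) by nra.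
  rewrite cos_2a_cos, cos_atan.
  unfold Rsqr; set (s := sqrt _).
  assert (Hs : s * s = 1 + q * q).
  { unfold s; rewrite sqrt_sqrt; unfold Rsqr; lra. }
  assert (s <> 0) by (intros E; rewrite E in Hs; lra).
  replace (2 * (1 / s) * (1 / s)) with (2 / (s * s)) by (field; auto).
  rewrite Hs; field; lra.
Qed.

(** The half-angle formula tan(arg/2) = y/(r+x). It is one smooth expression on the whole cut plane,
    whereas the definition by [acos] switches formula on the real axis, where [acos] is not
    differentiable. *)
Lemma Carg_offcut v : offcut v -> Carg v = 2 * atan (Im v / (Cmod v + Re v)).
Proof.
  intros H; assert (Hd := offcut_denominator v H).
  assert (Hr : 0 < Cmod v) by now apply Cmod_gt_0, offcut_neq_0.
  assert (Hs := Cmod_sqr v).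
  set (x := Re v) in *; set (y := Im v) in *; set (r := Cmod v) in *.
  set (q := y / (r + x)).
  assert (Hcos : cos (2 * atan q) = x / r).
  { rewrite cos_double_atan.
    assert (E1 : 1 - q * q = 2 * x * (r + x) / ((r + x) * (r + x))).
    { unfold q; apply (Rmult_eq_reg_r ((r + x) * (r + x))); [|nra].
      field_simplify; [|lra|lra]; nra. }
    assert (E2 : 1 + q * q = 2 * r * (r + x) / ((r + x) * (r + x))).
    { unfold q; apply (Rmult_eq_reg_r ((r + x) * (r + x))); [|nra].
      field_simplify; [|lra|lra]; nra. }
    rewrite E1, E2; field; lra. }
  assert (Hb := atan_bound q).
  unfold Carg; fold x y r.
  destruct (Rle_dec 0 y) as [Hy|Hy].
  - assert (0 <= q) by (apply Rmult_le_pos; [auto|apply Rlt_le, Rinv_0_lt_compat; auto]).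
    assert (0 <= atan q).
    { destruct H0 as [H0|<-]; [left; rewrite <- atan_0; now apply atan_increasing|rewrite atan_0;
      lra]. }
    rewrite <- Hcos; apply acos_cos; lra.
  - assert (q < 0).
    { unfold q, Rdiv; apply Rlt_le_trans with (0 * / (r + x)); [|lra].
      apply Rmult_lt_compat_r; [apply Rinv_0_lt_compat; auto|lra]. }
    assert (atan q < 0) by (rewrite <- atan_0; now apply atan_increasing).
    rewrite <- Hcos, <- cos_neg, acos_cos; lra.
Qed.

Lemma Carg_bound v : offcut v -> Rabs (Carg v) < PI.
Proof.
  intros H; rewrite (Carg_offcut v H).
  assert (Hb := atan_bound (Im v / (Cmod v + Re v))); apply Rabs_def1; lra.
Qed.

Lemma offcut_Carg v : v <> RtoC 0 -> Rabs (Carg v) < PI -> offcut v.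
Proof.
  intros H0 H; destruct (Req_dec (Im v) 0) as [E|E]; [left|now right].
  destruct (Rlt_or_le 0 (Re v)) as [Hx|Hx]; auto; exfalso.
  assert (Hr : 0 < Cmod v) by now apply Cmod_gt_0.
  assert (Hs := Cmod_sqr v); rewrite E in Hs.
  assert (Ex : Re v / Cmod v = Ropp 1).
  { assert (Re v = - Cmod v) by nra; rewrite H1; field; lra. }
  unfold Carg in H; rewrite Ex, E in H; destruct (Rle_dec 0 0) as [_|n]; [|lra].
  rewrite acos_opp, acos_1 in H.
  rewrite Rabs_pos_eq in H; assert (Hp := PI_RGT_0); lra.
Qed.

Lemma Cexp_Clog v : v <> RtoC 0 -> Cexp (Clog v) = v.
Proof.
  intros H; assert (Hr : 0 < Cmod v) by now apply Cmod_gt_0.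
  assert (Hs := Cmod_sqr v).
  assert (Hx : -1 <= Re v / Cmod v <= 1).
  { assert (h := re_le_Cmod v); apply Rabs_le_between in h.
    split; apply (Rmult_le_reg_r (Cmod v)); auto; unfold Rdiv; rewrite Rmult_assoc, Rinv_l; lra. }
  assert (Hsin : sin (acos (Re v / Cmod v)) = Rabs (Im v) / Cmod v).
  { rewrite sin_acos by auto.
    replace (1 - (Re v / Cmod v)²) with ((Rabs (Im v) / Cmod v)²).
    - apply sqrt_Rsqr, Rmult_le_pos; [apply Rabs_pos|apply Rlt_le, Rinv_0_lt_compat; auto].
    - unfold Rsqr.
      replace (Rabs (Im v) / Cmod v * (Rabs (Im v) / Cmod v))
        with (Rabs (Im v) * Rabs (Im v) / (Cmod v * Cmod v)) by (field; lra).
      rewrite <- Rabs_mult, Rabs_pos_eq by nra.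
      replace (Im v * Im v) with (Cmod v * Cmod v - Re v * Re v) by lra.
      field; lra. }
  unfold Cexp, Clog, Carg; simpl; rewrite exp_ln by auto.
  destruct v as [x y]; unfold Re, Im in *; simpl in *.
  destruct (Rle_dec 0 y) as [Hy|Hy].
  - rewrite cos_acos, Hsin, Rabs_pos_eq by auto; f_equal; field; lra.
  - rewrite cos_neg, sin_neg, cos_acos, Hsin, Rabs_left by (auto; lra); f_equal; field; lra.
Qed.

Lemma is_derive_sqrt_norm (x y : R -> R) (t x' y' : R) :
  is_derive x t x' -> is_derive y t y' -> 0 < x t * x t + y t * y t ->
  is_derive (fun s => sqrt (x s * x s + y s * y s)) t
    ((x t * x' + y t * y') / sqrt (x t * x t + y t * y t)).
Proof.
  intros Hx Hy Hp.
  assert (Hf : is_derive (fun s => x s * x s + y s * y s) t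
    ((x' * x t + x t * x') + (y' * y t + y t * y'))).
  { exact (is_derive_plus (V := R_NormedModule) _ _ _ _ _
      (is_derive_mult _ _ _ _ _ Hx Hx Rmult_comm) (is_derive_mult _ _ _ _ _ Hy Hy Rmult_comm)). }
  evar_last; [exact (is_derive_sqrt _ _ _ Hf Hp)|].
  assert (0 < sqrt (x t * x t + y t * y t)) by now apply sqrt_lt_R0.
  cbv beta; field; lra.
Qed.

Lemma Cmod_sqrt v : Cmod v = sqrt (Re v * Re v + Im v * Im v).
Proof. unfold Cmod, Re, Im; f_equal; ring. Qed.

Lemma Re_Cdiv l v : v <> RtoC 0 ->
  Re (l / v) = (Re l * Re v + Im l * Im v) / (Cmod v * Cmod v).
Proof.
  intros H; assert (Hr : 0 < Cmod v) by now apply Cmod_gt_0.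
  rewrite Cmod_sqr; assert (Hs := Cmod_sqr v).
  destruct l as [a b], v as [x y]; unfold Cdiv, Cinv, Cmult, Re, Im in *; simpl in *.
  field; nra.
Qed.

Lemma Im_Cdiv l v : v <> RtoC 0 ->
  Im (l / v) = (Im l * Re v - Re l * Im v) / (Cmod v * Cmod v).
Proof.
  intros H; assert (Hr : 0 < Cmod v) by now apply Cmod_gt_0.
  rewrite Cmod_sqr; assert (Hs := Cmod_sqr v).
  destruct l as [a b], v as [x y]; unfold Cdiv, Cinv, Cmult, Re, Im in *; simpl in *.
  field; nra.
Qed.

Lemma dRC_Clog v t l : dRC v t l -> offcut (v t) ->
  dRC (fun s => Clog (v s)) t (l / v t)%C.
Proof.
  intros [H1 H2] Hoff.
  (* The cut plane is open, so the half-angle formula holds near t and may be differentiated in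
     place of [Carg]. *)
  assert (Hloc : locally t (fun s => offcut (v s))).
  { destruct Hoff as [Hx|Hy].
    - assert (Hc := ex_derive_continuous _ _ (ex_intro _ _ H1)).
      apply filter_imp with (fun s => 0 < Re (v s)); [now left|].
      apply (Hc (fun z => 0 < z)), (open_gt 0), Hx.
    - assert (Hc := ex_derive_continuous _ _ (ex_intro _ _ H2)).
      apply filter_imp with (fun s => Im (v s) <> 0); [now right|].
      apply (Hc (fun z => z <> 0)), (open_neq 0), Hy. }
  assert (Hd := offcut_denominator _ Hoff).
  assert (Hn := offcut_neq_0 _ Hoff).
  assert (Hr : 0 < Cmod (v t)) by now apply Cmod_gt_0.
  assert (Hs := Cmod_sqr (v t)).
  assert (Hm : is_derive (fun s => Cmod (v s)) t
    ((Re (v t) * Re l + Im (v t) * Im l) / Cmod (v t))).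
  { apply is_derive_ext with (fun s => sqrt (Re (v s) * Re (v s) + Im (v s) * Im (v s))).
    { intros; symmetry; apply Cmod_sqrt. }
    rewrite Cmod_sqrt; apply is_derive_sqrt_norm; auto; rewrite <- Hs; nra. }
  split.
  - evar_last.
    exact (is_derive_comp (V := R_NormedModule) ln _ t _ _ (is_derive_ln _ Hr) Hm).
    rewrite Re_Cdiv by auto; unfold scal; simpl; unfold mult; simpl; field; lra.
  - apply is_derive_ext_loc with (fun s => 2 * atan (Im (v s) / (Cmod (v s) + Re (v s)))).
    { apply filter_imp with (2 := Hloc); intros s Hs'; simpl; symmetry; now apply Carg_offcut. }
    set (x := fun s => Re (v s)) in *; set (y := fun s => Im (v s)) in *.
    set (r := fun s => Cmod (v s)) in *.
    assert (Hq : is_derive (fun s => y s / (r s + x s)) t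
      ((Im l * (r t + x t) - y t * ((x t * Re l + y t * Im l) / r t + Re l)) / (r t + x t) ^ 2)).
    { apply (is_derive_div y (fun s => r s + x s)); auto.
      - exact (is_derive_plus (V := R_NormedModule) _ _ _ _ _ Hm H1).
      - unfold r, x; lra. }
    evar_last.
    exact (is_derive_scal _ t 2 _ (is_derive_comp (V := R_NormedModule) atan _ t _ _
      (is_derive_atan _) Hq)).
    rewrite Im_Cdiv by auto; unfold scal; simpl; unfold mult; simpl.
    change (Re (v t)) with (x t) in *; change (Im (v t)) with (y t) in *; change (Cmod (v t))
      with (r t) in *.
    set (X := x t) in *; set (Y := y t) in *; set (Rr := r t) in *.
    set (L1 := Re l); set (L2 := Im l).
    assert (E : 1 + (Y / (Rr + X))² = 2 * Rr / (Rr + X)).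
    { unfold Rsqr.
      replace (Y / (Rr + X) * (Y / (Rr + X))) with ((Rr * Rr - X * X) / ((Rr + X) * (Rr + X))).
      - field; lra.
      - replace (Rr * Rr - X * X) with (Y * Y) by lra; field; lra. }
    replace (1 + (Y / (Rr + X)) ^ 2) with (1 + (Y / (Rr + X))²) by (unfold Rsqr; ring).
    replace (1 + Y / (Rr + X) * (Y / (Rr + X) * 1)) with (1 + (Y / (Rr + X))²) by (unfold Rsqr;
      ring).
    rewrite ?E.
    apply (Rmult_eq_reg_r (Rr * Rr * (Rr + X))); [|apply Rgt_not_eq; repeat apply
      Rmult_lt_0_compat; auto].
    transitivity ((L2 * (Rr + X) * Rr - Y * (X * L1 + Y * L2 + L1 * Rr))).
    + field; lra.
    + transitivity ((L2 * X - L1 * Y) * (Rr + X)); [|field; lra].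
      replace (L2 * (Rr + X) * Rr) with (L2 * (Rr * Rr) + L2 * X * Rr) by ring.
      rewrite Hs; ring.
Qed.

Lemma dRC_Cpower v w t l : dRC v t l -> offcut (v t) ->
  dRC (fun s => Cpower (v s) w) t (w * (l / v t) * Cpower (v t) w)%C.
Proof. intros H Ho; apply dRC_Cexp, dRC_scal, dRC_Clog; auto. Qed.

Lemma Cpower_plus v w1 w2 : Cpower v (w1 + w2)%C = (Cpower v w1 * Cpower v w2)%C.
Proof. unfold Cpower; rewrite <- Cexp_plus; f_equal; ring. Qed.

Lemma Cpower_0 v : Cpower v (RtoC 0) = RtoC 1.
Proof. unfold Cpower; rewrite Cmult_0_l; apply Cexp_0. Qed.

Lemma Cpower_1 v : v <> RtoC 0 -> Cpower v (RtoC 1) = v.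
Proof. intros H; unfold Cpower; rewrite Cmult_1_l; now apply Cexp_Clog. Qed.

Lemma Cpower_neq_0 v w : Cpower v w <> RtoC 0.
Proof. apply Cexp_neq_0. Qed.

Lemma Cpower_opp v w : Cpower v (- w)%C = (/ Cpower v w)%C.
Proof.
  assert (H : (Cpower v (- w)%C * Cpower v w)%C = 1).
  { rewrite <- Cpower_plus; replace (- w + w)%C with (RtoC 0) by ring; apply Cpower_0. }
  apply (f_equal (fun z => (z * / Cpower v w)%C)) in H.
  rewrite <- Cmult_assoc, Cinv_r, Cmult_1_r, Cmult_1_l in H by apply Cpower_neq_0; auto.
Qed.

Lemma Cpower_INR v n : v <> RtoC 0 -> Cpower v (RtoC (INR n)) = (v ^ n)%C.
Proof.
  intros H; induction n as [|n IH]; [apply Cpower_0|].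
  rewrite RtoC_INR_S, Cpower_plus, IH, Cpower_1 by auto; rewrite Cpow_S; ring.
Qed.

Lemma Cpower_opp_plus_INR v a n : v <> RtoC 0 ->
  Cpower v (- (a + INR n))%C = (Cpower v (- a)%C * / v ^ n)%C.
Proof.
  intros H; rewrite <- Cpower_INR by auto; rewrite <- Cpower_opp, <- Cpower_plus; f_equal; ring.
Qed.

Lemma Carg_pos t : 0 < t -> Carg (RtoC t) = 0.
Proof.
  intros H; unfold Carg; rewrite im_RtoC, re_RtoC, Cmod_R, Rabs_pos_eq by lra.
  destruct (Rle_dec 0 0); [|lra]; unfold Rdiv; rewrite Rinv_r by lra; apply acos_1.
Qed.

Lemma Clog_pos t : 0 < t -> Clog (RtoC t) = RtoC (ln t).
Proof.
  intros H; unfold Clog; rewrite Carg_pos, Cmod_R, Rabs_pos_eq by lra; reflexivity.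
Qed.

Lemma Cpower_pos_mult s t w : 0 < s -> 0 < t ->
  Cpower (RtoC (s * t)) w = (Cpower (RtoC s) w * Cpower (RtoC t) w)%C.
Proof.
  intros Hs Ht; unfold Cpower.
  rewrite !Clog_pos, ln_mult, RtoC_plus, <- Cexp_plus by (auto; nra); f_equal; ring.
Qed.

Lemma Cmod_Cpower_pos t w : 0 < t -> Cmod (Cpower (RtoC t) w) = Rpower t (Re w).
Proof.
  intros H; unfold Cpower; rewrite Cmod_Cexp, Clog_pos, re_scal_r by auto; reflexivity.
Qed.

Lemma offcut_pos t : 0 < t -> offcut (RtoC t).
Proof. now left. Qed.

(** Along the segment from v0 to v0 - h the product (v0 - t h)^al * sum_k rf al k (t w)^k, with w =
    h/v0, has derivative 0, because the series D satisfies (1 - t w) D' = al w D. The segment has to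
    avoid the cut for the principal power to be differentiable on it. *)
Theorem binomial_series al v0 h :
  (forall t, 0 <= t <= 1 -> offcut (v0 - RtoC t * h)) -> Cmod h < Cmod v0 ->
  Cpower (v0 - h) (- al)%C = (Cpower v0 (- al)%C * hC (rf al) (h / v0)%C)%C.
Proof.
  intros Hoff Hh.
  assert (Hv0 : v0 <> 0).
  { apply Cmod_gt_0; apply Rle_lt_trans with (2 := Hh), Cmod_ge_0. }
  set (w := (h / v0)%C).
  assert (Hw : Cmod w < 1).
  { unfold w; rewrite Cmod_div by auto.
    assert (Hp : 0 < Cmod v0) by now apply Cmod_gt_0.
    apply (Rmult_lt_reg_r (Cmod v0)); auto; unfold Rdiv; rewrite Rmult_assoc, Rinv_l; lra. }
  set (d := fun k => (rf al k * w ^ k)%C).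
  assert (Hd : rate d (Cmod w)).
  { apply rate_ext with (fun k => (w ^ k * rf al k)%C); [intros; unfold d; ring|].
    apply rate_mult1; [apply Cmod_ge_0|apply rate_Cpow|apply rate_rf]. }
  assert (HR : forall t, 0 <= t <= 1 -> Cmod w * Rabs t < 1).
  { intros t Ht; rewrite Rabs_pos_eq by lra; assert (h0 := Cmod_ge_0 w); nra. }
  assert (HRC : forall t, 0 <= t <= 1 -> Cmod w * Cmod (RtoC t) < 1).
  { intros t Ht; rewrite Cmod_R; auto. }
  assert (Hode : forall t, 0 <= t <= 1 ->
    (hC (dS d) (RtoC t) * (1 - RtoC t * w))%C =
    (al * w * hC d (RtoC t))%C).
  { intros t Ht.
    assert (E : hC (dS d) (RtoC t) =
      (w * (al * hC d (RtoC t) + RtoC t * hC (dS d) (RtoC t)))%C).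
    { rewrite <- (hC_theta d (Cmod w)) by (auto; apply Cmod_ge_0).
      rewrite <- (hC_scal al d (Cmod w)) by (auto; apply Cmod_ge_0).
      assert (h0 := Cmod_ge_0 w).
      assert (Hal : rate (fun k => (al * d k)%C) (Cmod w)).
      { apply rate_ext with (fun k => (d k * al)%C); [intros; ring|].
        apply rate_mult1; auto; apply rate_const. }
      rewrite <- (hC_plus _ _ (Cmod w)) by (auto using rate_INR_mult).
      assert (Hsum : rate (fun k => (al * d k + INR k * d k)%C) (Cmod w)).
      { apply rate_ext with (fun k => (d k * (al + INR k))%C); [intros; ring|].
        apply rate_mult1; auto; apply rate_INR_plus. }
      rewrite <- (hC_scal w _ (Cmod w)) by auto.
      apply hC_ext; intros k; unfold dS, d.
      rewrite Cmult_assoc, rf_S, Cpow_S; ring. }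
    replace (1 - RtoC t * w)%C with
      (1 - w * RtoC t)%C by ring.
    transitivity (hC (dS d) (RtoC t) - w * (RtoC t * hC (dS d) (RtoC t)))%C; [ring|].
    rewrite E at 1; ring. }
  set (g := fun t => (Cpower (v0 - RtoC t * h) al * hC d (RtoC t))%C).
  assert (Hg : g 0 = g 1).
  { apply dRC_zero_const; [lra|]; intros t Ht.
    assert (Hv : dRC (fun s => (v0 - RtoC s * h)%C) t (- h)%C).
    { eapply dRC_eq; [apply dRC_minus; [apply dRC_const|apply dRC_mult; [apply dRC_id|apply
      dRC_const]]|].
      simpl; ring. }
    eapply dRC_eq.
    - apply dRC_mult; [apply dRC_Cpower; [exact Hv|now apply Hoff]|].
      apply dRC_hC with (Cmod w); auto; apply Cmod_ge_0.
    - cbv beta; assert (Hn := offcut_neq_0 _ (Hoff t Ht)).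
      set (V := (v0 - RtoC t * h)%C) in *.
      assert (EV : (1 - RtoC t * w)%C = (V / v0)%C).
      { unfold w, V; field; auto. }
      specialize (Hode t Ht); rewrite EV in Hode.
      assert (E' : hC (dS d) (RtoC t) = (al * h * hC d (RtoC t) / V)%C).
      { transitivity (hC (dS d) (RtoC t) * (V / v0) * (v0 / V))%C; [field; auto|].
        rewrite Hode; unfold w; field; auto. }
      rewrite E'; field; auto. }
  unfold g in Hg.
  replace (v0 - 0 * h)%C with v0 in Hg by ring.
  replace (v0 - 1 * h)%C with (v0 - h)%C in Hg by ring.
  assert (E0 : hC d (RtoC 0) = 1).
  { rewrite (hC_step d (Cmod w)); auto; [|apply Cmod_ge_0|rewrite Cmod_0; lra].
    unfold d; rewrite rf_0; simpl; ring. }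
  assert (E1 : hC d (RtoC 1) = hC (rf al) w).
  { unfold hC; apply CSeries_ext; intros; unfold d; rewrite Cpow_1_l; ring. }
  rewrite E0, E1 in Hg; rewrite !Cpower_opp.
  apply (f_equal (fun z => (z * (/ Cpower v0 al * / Cpower (v0 - h) al))%C)) in Hg.
  transitivity (Cpower v0 al * 1 *
    (/ Cpower v0 al * / Cpower (v0 - h) al))%C.
  - field; split; apply Cpower_neq_0.
  - rewrite Hg; field; split; apply Cpower_neq_0.
Qed.

(** * The Gamma function *)

Definition Clim (u : nat -> C) (l : C) : Prop :=
  forall eps, 0 < eps -> exists N, forall n, (N <= n)%nat -> Cmod (u n - l) < eps.

Lemma CLim_seq_unique u l : Clim u l -> CLim_seq u = l.
Proof.
  intros H; unfold CLim_seq.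
  assert (H1 : is_lim_seq (fun n => Re (u n)) (Re l)).
  { apply is_lim_seq_spec; intros eps; destruct (H eps (cond_pos eps)) as [N HN].
    exists N; intros n Hn; apply Rle_lt_trans with (2 := HN n Hn).
    exact (re_le_Cmod (u n - l)%C). }
  assert (H2 : is_lim_seq (fun n => Im (u n)) (Im l)).
  { apply is_lim_seq_spec; intros eps; destruct (H eps (cond_pos eps)) as [N HN].
    exists N; intros n Hn; apply Rle_lt_trans with (2 := HN n Hn).
    exact (Im_le_Cmod (u n - l)%C). }
  rewrite (is_lim_seq_unique _ _ H1), (is_lim_seq_unique _ _ H2); now destruct l.
Qed.

Lemma Clim_unique u l l' : Clim u l -> Clim u l' -> l = l'.
Proof. intros H H'; now rewrite <- (CLim_seq_unique _ _ H), (CLim_seq_unique _ _ H'). Qed.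

Lemma Clim_ext_loc u v l N0 : (forall n, (N0 <= n)%nat -> u n = v n) -> Clim u l -> Clim v l.
Proof.
  intros E H eps Heps; destruct (H eps Heps) as [N HN]; exists (Nat.max N0 N).
  intros n Hn; rewrite <- E by lia; apply HN; lia.
Qed.

Lemma Clim_shift u l N0 : Clim u l <-> Clim (fun n => u (n + N0)%nat) l.
Proof.
  split; intros H eps Heps; destruct (H eps Heps) as [N HN].
  - exists N; intros n Hn; apply HN; lia.
  - exists (N + N0)%nat; intros n Hn.
    replace n with (n - N0 + N0)%nat by lia; apply HN; lia.
Qed.

Lemma Clim_const c : Clim (fun _ => c) c.
Proof.
  intros eps Heps; exists O; intros; replace (c - c)%C with (RtoC 0) by ring.
  now rewrite Cmod_0.
Qed.

Lemma Clim_plus u v l m : Clim u l -> Clim v m -> Clim (fun n => (u n + v n)%C) (l + m)%C.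
Proof.
  intros Hu Hv eps Heps.
  destruct (Hu (eps / 2) ltac:(lra)) as [N HN]; destruct (Hv (eps / 2) ltac:(lra)) as [M HM].
  exists (Nat.max N M); intros n Hn.
  specialize (HN n ltac:(lia)); specialize (HM n ltac:(lia)).
  replace (u n + v n - (l + m))%C with (u n - l + (v n - m))%C by ring.
  apply Rle_lt_trans with (1 := Cmod_triangle _ _); lra.
Qed.

Lemma Clim_mult u v l m : Clim u l -> Clim v m -> Clim (fun n => (u n * v n)%C) (l * m)%C.
Proof.
  intros Hu Hv eps Heps.
  assert (Hl := Cmod_ge_0 l); assert (Hm := Cmod_ge_0 m).
  set (e := Rmin 1 (eps / (Cmod l + Cmod m + 1))).
  assert (He1 : 0 < eps / (Cmod l + Cmod m + 1)) by (apply Rdiv_lt_0_compat; lra).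
  assert (He : 0 < e) by (apply Rmin_glb_lt; lra).
  assert (He' : e <= 1) by apply Rmin_l.
  assert (He2 : e * (Cmod l + Cmod m + 1) <= eps).
  { apply Rle_trans with (eps / (Cmod l + Cmod m + 1) * (Cmod l + Cmod m + 1)).
    - apply Rmult_le_compat_r; [lra|apply Rmin_r].
    - right; field; lra. }
  destruct (Hu e He) as [N HN]; destruct (Hv e He) as [M HM].
  exists (Nat.max N M); intros n Hn.
  specialize (HN n ltac:(lia)); specialize (HM n ltac:(lia)).
  replace (u n * v n - l * m)%C with
    ((u n - l) * (v n - m) +
       (l * (v n - m) + m * (u n - l)))%C by ring.
  apply Rle_lt_trans with (1 := Cmod_triangle _ _).
  assert (h := Cmod_triangle (l * (v n - m))%C (m * (u n - l))%C).
  rewrite !Cmod_mult in *.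
  set (x := Cmod (u n - l)) in *; set (y := Cmod (v n - m)) in *.
  assert (0 <= x) by apply Cmod_ge_0; assert (0 <= y) by apply Cmod_ge_0.
  assert (x * y < e * 1) by nra.
  assert (Cmod l * y <= Cmod l * e) by (apply Rmult_le_compat_l; lra).
  assert (Cmod m * x <= Cmod m * e) by (apply Rmult_le_compat_l; lra).
  lra.
Qed.

Lemma Clim_scal c u l : Clim u l -> Clim (fun n => (c * u n)%C) (c * l)%C.
Proof. intros H; apply (Clim_mult (fun _ => c)); auto; apply Clim_const. Qed.

Lemma Clim_inv_INR : Clim (fun n => (/ RtoC (INR n))%C) (RtoC 0).
Proof.
  intros eps Heps.
  destruct (nfloor_ex (/ eps)) as [N [_ HN]]; [apply Rlt_le, Rinv_0_lt_compat, Heps|].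
  exists (S N); intros n Hn; apply le_INR in Hn; rewrite S_INR in Hn.
  assert (0 < / eps) by now apply Rinv_0_lt_compat.
  replace (/ RtoC (INR n) - 0)%C with (/ RtoC (INR n))%C by ring.
  rewrite Cmod_inv by (apply RtoC_neq_0; lra).
  rewrite Cmod_R, Rabs_pos_eq by lra.
  rewrite <- (Rinv_inv eps); apply Rinv_lt_contravar; nra.
Qed.

Lemma Clim_inv u l : l <> RtoC 0 -> Clim u l -> Clim (fun n => (/ u n)%C) (/ l)%C.
Proof.
  intros Hl H eps Heps.
  assert (Hl0 : 0 < Cmod l) by now apply Cmod_gt_0.
  assert (Hp : 0 < eps * (Cmod l * Cmod l / 2)).
  { apply Rmult_lt_0_compat; auto; nra. }
  destruct (H (Rmin (Cmod l / 2) (eps * (Cmod l * Cmod l / 2)))) as [N HN].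
  { apply Rmin_glb_lt; lra. }
  exists N; intros n Hn; specialize (HN n Hn).
  assert (H1 := Rlt_le_trans _ _ _ HN (Rmin_l _ _)).
  assert (H2 := Rlt_le_trans _ _ _ HN (Rmin_r _ _)).
  assert (H3 : Cmod l / 2 <= Cmod (u n)).
  { assert (h := Cmod_triangle (u n) (- (u n - l))%C).
    replace (u n + - (u n - l))%C with l in h by ring.
    rewrite Cmod_opp in h; lra. }
  assert (Hu : u n <> 0) by (apply Cmod_gt_0; lra).
  replace (/ u n - / l)%C with (- (u n - l) / (u n * l))%C
    by (field; auto).
  rewrite Cmod_div, Cmod_opp, Cmod_mult by now apply Cmult_neq_0.
  apply (Rmult_lt_reg_r (Cmod (u n) * Cmod l)); [nra|].
  unfold Rdiv; rewrite Rmult_assoc, Rinv_l, Rmult_1_r by nra.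
  apply Rlt_le_trans with (1 := H2), Rmult_le_compat_l; nra.
Qed.

Lemma Clim_bounded u l : Clim u l -> exists M, 0 <= M /\ forall n, Cmod (u n) <= M.
Proof.
  intros H; destruct (H 1 ltac:(lra)) as [N HN].
  assert (Hf : forall m, exists M, 0 <= M /\ forall n, (n <= m)%nat -> Cmod (u n) <= M).
  { induction m as [|m [M [HM0 HM]]].
    - exists (Cmod (u O)); split; [apply Cmod_ge_0|intros n Hn; replace n with O by lia; lra].
    - exists (Rmax M (Cmod (u (S m)))); split; [apply Rle_trans with (1 := HM0), Rmax_l|].
      intros n Hn; destruct (Nat.eq_dec n (S m)) as [->|]; [apply Rmax_r|].
      apply Rle_trans with (2 := Rmax_l _ _), HM; lia. }
  destruct (Hf N) as [M [HM0 HM]].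
  exists (Rmax M (Cmod l + 1)); split; [apply Rle_trans with (1 := HM0), Rmax_l|].
  intros n; destruct (Nat.le_gt_cases n N) as [Hn|Hn].
  - apply Rle_trans with (2 := Rmax_l _ _), HM; auto.
  - apply Rle_trans with (2 := Rmax_r _ _).
    specialize (HN n ltac:(lia)).
    assert (h := Cmod_triangle (u n - l)%C l).
    replace (u n - l + l)%C with (u n) in h by ring; lra.
Qed.

Lemma Clim_telescope u : csummable (fun n => (u (S n) - u n)%C) -> exists l, Clim u l.
Proof.
  intros H; apply csum_correct in H.
  set (s := CSeries _) in H; exists (s + u O)%C.
  apply (Clim_shift _ _ 1).
  intros eps Heps; destruct (proj1 (csum_eps _ _) H eps Heps) as [N HN].
  exists N; intros n Hn; specialize (HN n Hn).
  assert (E : forall m, sum_n (fun n => (u (S n) - u n)%C) m = (u (S m) - u O)%C).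
  { induction m as [|m IH]; [now rewrite sum_O|].
    rewrite sum_n_C_S, IH; cring. }
  rewrite E in HN; rewrite Nat.add_1_r.
  replace (u (S n) - (s + u O))%C with (u (S n) - u O - s)%C by ring.
  exact HN.
Qed.

Lemma ex_series_inv_sqr : ex_series (fun n => / ((INR n + 2) * (INR n + 2))).
Proof.
  apply ex_series_pos_bounded with 1.
  - intros n; assert (h := pos_INR n); apply Rlt_le, Rinv_0_lt_compat; nra.
  - assert (H : forall N, sum_n (fun n => / ((INR n + 2) * (INR n + 2))) N <= 1 - / (INR N + 2)).
    { induction N as [|N IH]; [rewrite sum_O; simpl; lra|].
      rewrite sum_n_R_S; assert (h := pos_INR N).
      rewrite S_INR; replace (INR N + 1 + 2) with (INR N + 3) by ring.
      apply Rle_trans with (1 - / (INR N + 2) + / ((INR N + 3) * (INR N + 3))); [lra|].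
      assert (/ ((INR N + 3) * (INR N + 3)) <= / (INR N + 2) - / (INR N + 3)); [|lra].
      replace (/ (INR N + 2) - / (INR N + 3)) with (/ ((INR N + 2) * (INR N + 3))) by (field; lra).
      apply Rinv_le_contravar; nra. }
    intros N; apply Rle_trans with (1 := H N).
    assert (h := pos_INR N); assert (0 < / (INR N + 2)) by (apply Rinv_0_lt_compat; lra); lra.
Qed.

(** From |q n| <= 1 + e n <= exp (e n) with summable e the products stay bounded; then the
    increments (q n - 1) u n are summable. *)
Lemma product_converges (u q : nat -> C) (K : R) :
  (forall n, u (S n) = (q n * u n)%C) ->
  (forall n, Cmod (q n - 1) <= K * / ((INR n + 2) * (INR n + 2))) ->
  exists l, Clim u l.
Proof.
  intros Hu Hq; set (e := fun n => K * / ((INR n + 2) * (INR n + 2))) in *.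
  assert (He0 : forall n, 0 <= e n).
  { intros n; apply Rle_trans with (2 := Hq n), Cmod_ge_0. }
  assert (He : ex_series e) by apply (ex_series_scal (V := R_NormedModule)), ex_series_inv_sqr.
  assert (Hb : forall n, Cmod (u n) <= Cmod (u O) * exp (Series e)).
  { assert (Hb' : forall n, Cmod (u (S n)) <= Cmod (u O) * exp (sum_n e n)).
    { assert (Hstep : forall n, Cmod (u (S n)) <= exp (e n) * Cmod (u n)).
      { intros n; rewrite Hu, Cmod_mult; apply Rmult_le_compat_r; [apply Cmod_ge_0|].
        apply Rle_trans with (1 + e n); [|apply exp_ineq1_le].
        assert (h := Cmod_triangle (q n - 1)%C (RtoC 1)).
        replace (q n - 1 + 1)%C with (q n) in h by ring.
        rewrite Cmod_1 in h; specialize (Hq n); fold (e n) in Hq; lra. }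
      induction n as [|n IH].
      - rewrite sum_O; specialize (Hstep O); lra.
      - rewrite sum_n_R_S, exp_plus; apply Rle_trans with (1 := Hstep (S n)).
        apply Rle_trans with (exp (e (S n)) * (Cmod (u O) * exp (sum_n e n))); [|right; ring].
        apply Rmult_le_compat_l; [apply Rlt_le, exp_pos|exact IH]. }
    intros [|n].
    - assert (h := sum_n_le_Series e 0 He0 He); rewrite sum_O in h.
      assert (h1 := He0 O); assert (h2 := exp_ineq1_le (Series e)); assert (h3 := Cmod_ge_0 (u O)).
      nra.
    - apply Rle_trans with (1 := Hb' n), Rmult_le_compat_l; [apply Cmod_ge_0|].
      assert (h := sum_n_le_Series e n He0 He); destruct h as [h|h].
      + left; now apply exp_increasing.
      + rewrite h; lra. }
  apply Clim_telescope.
  apply csummable_le with (fun n => (Cmod (u O) * exp (Series e)) * e n).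
  - intros n; rewrite Hu.
    replace (q n * u n - u n)%C with ((q n - 1) * u n)%C by ring.
    rewrite Cmod_mult, Rmult_comm; apply Rmult_le_compat; auto; apply Cmod_ge_0.
  - now apply (ex_series_scal (V := R_NormedModule)).
Qed.

Definition gauss_prod (z : C) (n : nat) : C :=
  (poch z (S n) / (Cfact n * Cpower (RtoC (INR n)) z))%C.

(** With w = 1/(n+2) the ratio is (1 + z w)(1-w)^z, and (1-w)^z = 1 - z w + O(w^2) cancels the term
    of first order. The index starts at 1, as the power of [INR 0] is a default value. *)
Lemma gauss_prod_ratio z : exists q K,
  (forall n, gauss_prod z (S (S n)) = (q n * gauss_prod z (S n))%C) /\
  (forall n, Cmod (q n - 1) <= K * / ((INR n + 2) * (INR n + 2))).
Proof.
  set (d := rf (- z)).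
  (* [K] bounds the second-order remainder of the binomial series of (1-w)^z, divided by w^2, for w
     <= 1/2. *)
  destruct (hC_bound (fun k => d (S (S k))) 1 (1/2)) as [K [HK0 HK]]; try lra.
  { apply (rate_shift (fun k => d (S k))), (rate_shift d), rate_rf; lra. }
  exists (fun n => ((1 + z * RtoC (/ (INR n + 2))) *
    Cpower (RtoC (1 - / (INR n + 2))) z)%C).
  exists (Cmod z * Cmod z + (1 + Cmod z) * K).
  assert (Hw : forall n, 0 < / (INR n + 2) <= 1 / 2).
  { intros n; assert (h := pos_INR n); split; [apply Rinv_0_lt_compat; lra|].
    unfold Rdiv; rewrite Rmult_1_l; apply Rinv_le_contravar; lra. }
  split; intros n; assert (h := pos_INR n); specialize (Hw n); set (w := / (INR n + 2)) in *.
  - unfold gauss_prod; rewrite (Cfact_S (S n)).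
    change (poch z (S (S (S n)))) with (poch z (S (S n)) * (z + INR (S (S n))))%C.
    assert (E : INR (S n) = INR (S (S n)) * (1 - w)).
    { unfold w; rewrite !S_INR; field; lra. }
    assert (E2 : RtoC w = (/ RtoC (INR (S (S n))))%C).
    { unfold w; rewrite RtoC_inv by lra; f_equal; f_equal; rewrite !S_INR; ring. }
    assert (Hpos : 0 < INR (S (S n))) by (rewrite !S_INR; lra).
    assert (EC : Cpower (RtoC (INR (S n))) z =
      (Cpower (RtoC (INR (S (S n)))) z * Cpower (RtoC (1 - w)) z)%C).
    { rewrite E; apply Cpower_pos_mult; lra. }
    rewrite EC, E2.
    generalize (Cpower_neq_0 (RtoC (INR (S (S n)))) z) (Cpower_neq_0 (RtoC (1 - w)) z)
      (Cfact_neq_0 (S n)) (INR_S_neq_0 (S n)); intros H1 H2 H3 H4.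
    set (P1 := Cpower _ _) in *; set (P2 := Cpower _ _) in *.
    field; auto.
  - assert (Eb : Cpower (RtoC (1 - w)) z = hC d (RtoC w)).
    { assert (B := binomial_series (- z)%C (RtoC 1) (RtoC w)).
      rewrite <- RtoC_minus in B.
      replace (- (- z))%C with z in B by ring.
      rewrite B.
      - fold d; replace (RtoC w / 1)%C with (RtoC w) by (field; exact C1_nz).
        unfold Cpower; rewrite Clog_pos, ln_1 by lra.
        replace (z * 0)%C with (RtoC 0) by ring; rewrite Cexp_0; ring.
      - intros t Ht; rewrite <- RtoC_mult, <- RtoC_minus; apply offcut_pos; nra.
      - rewrite Cmod_R, Cmod_1, Rabs_pos_eq; lra. }
    rewrite Eb.
    assert (Hm : 1 * Cmod (RtoC w) < 1) by (rewrite Cmod_R, Rabs_pos_eq; lra).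
    assert (Hd : rate d 1) by apply rate_rf.
    rewrite (hC_step d 1), (hC_step (fun k => d (S k)) 1) by (auto; try lra; apply rate_shift;
      auto; lra).
    assert (HK' := HK (RtoC w) ltac:(rewrite Cmod_R, Rabs_pos_eq; lra)).
    clear Eb; set (H := hC (fun k => d (S (S k))) (RtoC w)) in *.
    assert (d0 : d O = 1) by apply rf_0.
    assert (d1 : d 1%nat = (- z)%C).
    { assert (e := rf_S (- z)%C 0); rewrite rf_0 in e; simpl INR in e.
      unfold d; rewrite <- (Cmult_1_l (rf _ 1)), e; ring. }
    cbv beta; rewrite d0, d1.
    replace (_ - _)%C with (RtoC w * RtoC w *
      (- (z * z) + (1 + z * RtoC w) * H))%C by ring.
    rewrite !Cmod_mult, Cmod_R, Rabs_pos_eq by lra.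
    replace (/ ((INR n + 2) * (INR n + 2))) with (w * w) by (unfold w; field; lra).
    rewrite (Rmult_comm _ (w * w)); apply Rmult_le_compat_l; [nra|].
    apply Rle_trans with (1 := Cmod_triangle _ _); rewrite Cmod_opp, !Cmod_mult.
    apply Rplus_le_compat_l, Rmult_le_compat; auto; try apply Cmod_ge_0.
    apply Rle_trans with (1 := Cmod_triangle _ _); rewrite Cmod_1, Cmod_mult, Cmod_R, Rabs_pos_eq
      by lra.
    assert (h' := Cmod_ge_0 z); nra.
Qed.

Lemma rGamma_lim z : Clim (gauss_prod z) (rGamma z).
Proof.
  destruct (gauss_prod_ratio z) as [q [K [H1 H2]]].
  destruct (product_converges (fun n => gauss_prod z (S n)) q K H1 H2) as [l Hl].
  assert (Hl' : Clim (gauss_prod z) l).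
  { apply (Clim_shift _ _ 1); apply Clim_ext_loc with (2 := Hl) (N0 := O).
    intros n _; now rewrite Nat.add_1_r. }
  unfold rGamma; fold (gauss_prod z); now rewrite (CLim_seq_unique _ _ Hl').
Qed.

(** The reciprocals of the Gauss products form a convergent product as well, and the two limits
    multiply to 1. *)
Lemma rGamma_neq_0 z : ~ nonpos_int z -> rGamma z <> RtoC 0.
Proof.
  intros Hz.
  destruct (gauss_prod_ratio z) as [q [K [H1 H2]]].
  assert (Hne : forall n, gauss_prod z n <> 0).
  { intros n; unfold gauss_prod, Cdiv; apply Cmult_neq_0; [now apply poch_neq_0|].
    intros E; apply C1_nz.
    assert (Hd : (Cfact n * Cpower (RtoC (INR n)) z)%C <> 0).
    { apply Cmult_neq_0; [apply Cfact_neq_0|apply Cpower_neq_0]. }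
    rewrite <- (Cinv_r _ Hd), E; ring. }
  (* Beyond this index |q - 1| <= 1/2, so q is invertible with |1/q - 1| <= 2 |q - 1|, which is
     again O(1/n^2). *)
  destruct (nfloor_ex (2 * Rabs K)) as [N [_ HN]]; [assert (h := Rabs_pos K); lra|].
  set (M := S N).
  assert (Hsmall : forall n, Cmod (q (n + M)%nat - 1) <= 1 / 2).
  { intros n; apply Rle_trans with (1 := H2 _).
    rewrite plus_INR; unfold M; rewrite S_INR; set (X := INR n + (INR N + 1) + 2).
    assert (h := pos_INR n); assert (h' := pos_INR N).
    assert (hK := Rle_abs K); assert (hK' := Rabs_pos K).
    assert (HX : 2 * Rabs K < X) by (unfold X; lra).
    assert (HX1 : 1 <= X) by (unfold X; lra).
    apply (Rmult_le_reg_r (X * X)); [nra|].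
    rewrite Rmult_assoc, Rinv_l by nra; nra. }
  assert (Hqne : forall n, q (n + M)%nat <> 0).
  { intros n E; specialize (Hsmall n); rewrite E in Hsmall.
    replace (0 - 1)%C with (- RtoC 1)%C in Hsmall by ring.
    rewrite Cmod_opp, Cmod_1 in Hsmall; lra. }
  destruct (product_converges (fun n => (/ gauss_prod z (S (n + M)))%C)
    (fun n => (/ q (n + M)%nat)%C) (2 * Rabs K)) as [l Hl].
  { intros n; replace (S (S n + M)) with (S (S (n + M))) by lia; rewrite H1; field; auto. }
  { intros n; set (Q := q (n + M)%nat).
    assert (HQ : Q <> 0) by apply Hqne.
    replace (/ Q - 1)%C with (- (Q - 1) / Q)%C by (field; auto).
    rewrite Cmod_div, Cmod_opp by auto.
    specialize (Hsmall n); fold Q in Hsmall.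
    assert (HQ2 : 1 / 2 <= Cmod Q).
    { assert (t := Cmod_triangle Q (- (Q - 1))%C).
      replace (Q + - (Q - 1))%C with (RtoC 1) in t by ring.
      rewrite Cmod_1, Cmod_opp in t; lra. }
    apply Rle_trans with (2 * Cmod (Q - 1)).
    - apply (Rmult_le_reg_r (Cmod Q)); [lra|].
      unfold Rdiv; rewrite Rmult_assoc, Rinv_l by lra; assert (t := Cmod_ge_0 (Q - 1)%C); nra.
    - rewrite Rmult_assoc; apply Rmult_le_compat_l; [lra|].
      apply Rle_trans with (1 := H2 _).
      assert (h := pos_INR n); assert (h' := pos_INR M); rewrite plus_INR.
      apply Rmult_le_compat; try apply Rle_abs.
      2:{ apply Rlt_le, Rinv_0_lt_compat; nra. }
      2:{ apply Rinv_le_contravar; nra. }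
      assert (h2 := H2 O); assert (h3 := Cmod_ge_0 (q O - 1)%C).
      simpl INR in h2. apply (Rmult_le_reg_r (/ ((0 + 2) * (0 + 2)))); [apply Rinv_0_lt_compat;
        lra|lra]. }
  intros E.
  assert (Hg : Clim (fun n => gauss_prod z (n + S M)) (RtoC 0)).
  { rewrite <- E; apply (Clim_shift (gauss_prod z)), rGamma_lim. }
  assert (Hm := Clim_mult _ _ _ _ Hg Hl).
  apply C1_nz; transitivity (0 * l)%C; [|ring].
  apply Clim_unique with (2 := Hm).
  apply Clim_ext_loc with (fun _ => RtoC 1) O; [|apply Clim_const].
  intros n _; replace (n + S M)%nat with (S (n + M)) by lia; field; auto.
Qed.

(** For n >= 1 the Gauss product at [z], times 1 + (z+1)/n, is exactly [z] times the one at z+1; the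
    extra factor tends to 1. *)
Lemma rGamma_shift z : rGamma z = (z * rGamma (z + 1))%C.
Proof.
  apply Clim_unique with (fun n => (z * gauss_prod (z + 1)%C n)%C).
  2: apply Clim_scal, rGamma_lim.
  apply Clim_ext_loc with (fun n => (gauss_prod z n *
    (1 + (z + 1) * / RtoC (INR n)))%C) 1%nat.
  - intros n Hn.
    assert (Hp := lt_0_INR n ltac:(lia)).
    assert (Hn0 : RtoC (INR n) <> 0) by (apply RtoC_neq_0; lra).
    unfold gauss_prod; rewrite Cpower_plus, Cpower_1 by auto.
    replace (z * (poch (z + 1) (S n) / (Cfact n * (Cpower (RtoC (INR n)) z * INR n))))%C
      with (z * poch (z + 1) (S n) / (Cfact n * (Cpower (RtoC (INR n)) z * INR n)))%C.
    + rewrite <- poch_S_l; change (poch z (S (S n))) with (poch z (S n) * (z + INR (S n)))%C.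
      rewrite RtoC_INR_S; field; repeat split; auto using Cfact_neq_0, Cpower_neq_0.
    + field; repeat split; auto using Cfact_neq_0, Cpower_neq_0.
  - rewrite <- (Cmult_1_r (rGamma z)).
    apply Clim_mult; [apply rGamma_lim|].
    assert (E : (1 + (z + 1) * 0)%C = 1) by ring.
    exact (eq_ind _ (Clim _) (Clim_plus _ _ _ _ (Clim_const _) (Clim_scal _ _ _ Clim_inv_INR)) _ E).
Qed.

Lemma rGamma_poch z n : rGamma z = (poch z n * rGamma (z + INR n))%C.
Proof.
  induction n as [|n IH].
  - simpl; rewrite Cmult_1_l; f_equal; ring.
  - rewrite IH, (rGamma_shift (z + INR n)%C); simpl poch.
    rewrite RtoC_INR_S; replace (z + INR n + 1)%C with
      (z + (INR n + 1))%C by ring; ring.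
Qed.

(** * Analytic functions *)

Notation is_Cpseries := (@is_pseries C_AbsRing C_NormedModule).

Lemma pow_n_Cpow (h : C) k : pow_n (K := C_AbsRing) h k = (h ^ k)%C.
Proof. induction k as [|k IH]; [reflexivity|simpl; now rewrite IH]. Qed.

Lemma Cpseries_csum (u : nat -> C) (h s : C) :
  is_Cpseries u h s <-> is_csum (fun k => (u k * h ^ k)%C) s.
Proof.
  unfold is_pseries; split; intros H; refine (is_series_ext _ _ _ _ H);
    intros k; rewrite <- (pow_n_Cpow h k); apply Cmult_comm.
Qed.

Lemma analytic_at_ext_ball f g z0 r : 0 < r ->
  (forall z, Cmod (z - z0) < r -> f z = g z) -> analytic_at f z0 -> analytic_at g z0.
Proof.
  intros Hr E [u [r' H]].
  assert (Hm : 0 < Rmin r r') by (apply Rmin_glb_lt; [auto|apply cond_pos]).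
  exists u, (mkposreal _ Hm); simpl; intros z Hz.
  rewrite <- E by apply (Rlt_le_trans _ _ _ Hz (Rmin_l _ _)).
  apply H, (Rlt_le_trans _ _ _ Hz (Rmin_r _ _)).
Qed.

Lemma analytic_at_plus f g z0 : analytic_at f z0 -> analytic_at g z0 ->
  analytic_at (fun z => (f z + g z)%C) z0.
Proof.
  intros [u [r H]] [v [r' H']].
  assert (Hm : 0 < Rmin r r') by (apply Rmin_glb_lt; apply cond_pos).
  exists (fun k => (u k + v k)%C), (mkposreal _ Hm); simpl; intros z Hz.
  exact (is_pseries_plus (K := C_AbsRing) (V := C_NormedModule) u v _ _ _
    (H z (Rlt_le_trans _ _ _ Hz (Rmin_l _ _))) (H' z (Rlt_le_trans _ _ _ Hz (Rmin_r _ _)))).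
Qed.

Lemma analytic_at_scal c f z0 : analytic_at f z0 -> analytic_at (fun z => (c * f z)%C) z0.
Proof.
  intros [u [r H]]; exists (fun k => (c * u k)%C), r; intros z Hz.
  apply Cpseries_csum; apply csum_ext with (fun k => (c * (u k * (z - z0) ^ k))%C).
  - intros k; ring.
  - now apply csum_scal, Cpseries_csum, H.
Qed.

Lemma analytic_at_minus f g z0 : analytic_at f z0 -> analytic_at g z0 ->
  analytic_at (fun z => (f z - g z)%C) z0.
Proof.
  intros Hf Hg.
  apply (analytic_at_ext_ball (fun z => (f z + - RtoC 1 * g z)%C) _ z0 1 Rlt_0_1).
  - intros z _; ring.
  - now apply analytic_at_plus, analytic_at_scal.
Qed.

(** Regrouping by powers of [h], allowed by absolute convergence at radius [r], yields the Taylor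
    coefficients as column sums of [T]. Both power series and series in inverse powers are shown
    analytic in this way. *)
Lemma analytic_double_series f z0 (T : nat -> nat -> C) r B : 0 < r ->
  (forall N M, sum_n (fun k => sum_n (fun m => Cmod (T k m * RtoC r ^ m)) M) N <= B) ->
  (forall h, Cmod h < r ->
    f (z0 + h)%C = CSeries (fun k => CSeries (fun m => (T k m * h ^ m)%C))) ->
  analytic_at f z0.
Proof.
  intros Hr HB Hf.
  exists (fun m => CSeries (fun k => T k m)), (mkposreal r Hr); simpl; intros z Hz.
  set (h := (z - z0)%C) in *.
  replace z with (z0 + h)%C by (unfold h; ring).
  rewrite Hf by auto; apply Cpseries_csum.
  assert (HB' : forall N M, sum_n (fun k => sum_n (fun m => Cmod (T k m * h ^ m)) M) N <= B).
  { intros N M; apply Rle_trans with (2 := HB N M).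
    apply sum_n_le; intros k _; apply sum_n_le; intros m _.
    rewrite !Cmod_mult, !Cmod_pow, Cmod_R, (Rabs_pos_eq r) by lra.
    apply Rmult_le_compat_l; [apply Cmod_ge_0|].
    apply pow_incr; split; [apply Cmod_ge_0|lra]. }
  rewrite (CSeries_fubini _ B HB').
  assert (Hcol : forall m, csummable (fun k => T k m)).
  { intros m.
    assert (Hr' : (RtoC r ^ m)%C <> 0) by (apply Cpow_nz, RtoC_neq_0; lra).
    apply ex_series_ext with
      (fun k => Cmod (/ RtoC r ^ m * (T k m * RtoC r ^ m))).
    - intros k; f_equal; field; auto.
    - apply csummable_scal.
      apply (double_row_summable (fun m k => (T k m * RtoC r ^ m)%C) B).
      intros N M; rewrite (sum_n_switch (fun m k => Cmod (T k m * RtoC r ^ m))).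
      apply HB. }
  assert (E : forall m, CSeries (fun k => (T k m * h ^ m)%C) =
    (CSeries (fun k => T k m) * h ^ m)%C).
  { intros m; rewrite Cmult_comm, <- CSeries_scal by auto; apply CSeries_ext; intros; ring. }
  rewrite (CSeries_ext _ _ E).
  apply csum_correct.
  apply ex_series_ext with (fun m => Cmod (CSeries (fun k => (T k m * h ^ m)%C))).
  { intros m; now rewrite E. }
  apply (double_rows_summable (fun m k => (T k m * h ^ m)%C) B).
  intros N M; rewrite (sum_n_switch (fun m k => Cmod (T k m * h ^ m))).
  apply HB'.
Qed.

(** The coefficients of [(z0 + h) ^ k] as a polynomial in [h]. *)
Fixpoint binrow (z0 : C) (k m : nat) : C :=
  match k with
  | O => match m with O => RtoC 1 | S _ => RtoC 0 end
  | S k' => (z0 * binrow z0 k' m +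
                  (match m with O => RtoC 0 | S m' => binrow z0 k' m' end))%C
  end.

Lemma csum_shift_r (v : nat -> C) (s : C) :
  is_csum v s -> is_csum (fun m => match m with O => RtoC 0 | S m' => v m' end) s.
Proof.
  intros H; apply (is_series_decr_1 (K := C_AbsRing) (V := C_NormedModule)).
  assert (E : (s + - RtoC 0)%C = s) by ring.
  exact (eq_ind_r (fun x => is_csum v x) H E).
Qed.

Definition single (c : C) (m : nat) : C := match m with O => c | S _ => RtoC 0 end.

Lemma csum_singleton (c : C) : is_csum (single c) c.
Proof.
  apply csum_eps; intros eps Heps; exists O; intros N _.
  assert (E : sum_n (single c) N = c).
  { induction N as [|N IH]; [now rewrite sum_O|rewrite sum_n_C_S, IH; simpl; cring]. }
  rewrite E; replace (c - c)%C with (RtoC 0) by ring; now rewrite Cmod_0.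
Qed.

Lemma binrow_csum z0 h k :
  is_csum (fun m => (binrow z0 k m * h ^ m)%C) ((z0 + h) ^ k)%C.
Proof.
  induction k as [|k IH].
  - apply csum_ext with (2 := csum_singleton (RtoC 1)).
    intros [|m]; simpl; ring.
  - rewrite Cpow_S.
    replace ((z0 + h) * (z0 + h) ^ k)%C with
      (z0 * (z0 + h) ^ k + h * (z0 + h) ^ k)%C by ring.
    eapply csum_ext; [|exact (csum_plus _ _ _ _ (csum_scal z0 _ _ IH)
      (csum_shift_r _ _ (csum_scal h _ _ IH)))].
    intros [|m]; simpl; ring.
Qed.

(** Pascal's recursion, taken in moduli, is dominated by the recursion of (|z0| + r)^k. *)
Lemma binrow_bound z0 r k M : 0 <= r ->
  sum_n (fun m => Cmod (binrow z0 k m * RtoC r ^ m)) M <= (Cmod z0 + r) ^ k.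
Proof.
  intros Hr; revert M; induction k as [|k IH]; intros M.
  - assert (E : sum_n (fun m => Cmod (binrow z0 0 m * RtoC r ^ m)) M = 1).
    { induction M as [|M IH].
      - rewrite sum_O; simpl; rewrite Cmult_1_l; apply Cmod_1.
      - rewrite sum_n_R_S, IH; simpl binrow; rewrite Cmult_0_l, Cmod_0; apply Rplus_0_r. }
    rewrite E; simpl; lra.
  - set (X := (Cmod z0 + r) ^ k) in *.
    set (Y := fun M => sum_n (fun m => Cmod (binrow z0 k m * RtoC r ^ m)) M).
    assert (Hz := Cmod_ge_0 z0).
    assert (H : forall M, sum_n (fun m => Cmod (binrow z0 (S k) m * RtoC r ^ m)) M <=
      Cmod z0 * Y M + match M with O => 0 | S M' => r * Y M' end).
    { induction M0 as [|M0 IHM].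
      - unfold Y; rewrite !sum_O; simpl; rewrite Cplus_0_r, !Cmult_1_r, Cmod_mult; lra.
      - rewrite sum_n_R_S; unfold Y; rewrite sum_n_R_S; fold (Y M0).
        assert (Hs : r * Y M0 = match M0 with O => 0 | S M' => r * Y M' end +
          r * Cmod (binrow z0 k M0 * RtoC r ^ M0)).
        { unfold Y; destruct M0; [rewrite sum_O; ring|rewrite sum_n_R_S; ring]. }
        rewrite Hs.
        assert (Ht : Cmod (binrow z0 (S k) (S M0) * RtoC r ^ (S M0)) <=
          Cmod z0 * Cmod (binrow z0 k (S M0) * RtoC r ^ (S M0)) +
          r * Cmod (binrow z0 k M0 * RtoC r ^ M0)).
        { replace (binrow z0 (S k) (S M0) * RtoC r ^ (S M0))%C with
            (z0 * (binrow z0 k (S M0) * RtoC r ^ (S M0)) +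
              RtoC r * (binrow z0 k M0 * RtoC r ^ M0))%C by (simpl; ring).
          apply Rle_trans with (1 := Cmod_triangle _ _); rewrite (Cmod_mult z0), (Cmod_mult (RtoC
            r)).
          rewrite Cmod_R, Rabs_pos_eq; lra. }
        lra. }
    apply Rle_trans with (1 := H M).
    simpl; fold X; rewrite Rmult_plus_distr_r; apply Rplus_le_compat.
    + apply Rmult_le_compat_l; [auto|apply IH].
    + destruct M as [|M].
      * apply Rmult_le_pos; auto; unfold X; apply pow_le; lra.
      * apply Rmult_le_compat_l; auto; apply IH.
Qed.

Lemma geometric_sum_le x N : 0 <= x < 1 -> sum_n (fun k => x ^ k) N <= / (1 - x).
Proof.
  intros Hx.
  assert (Hs := is_series_geom x ltac:(rewrite Rabs_pos_eq; lra)).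
  rewrite <- (is_series_unique _ _ Hs).
  apply sum_n_le_Series; [intros; apply pow_le; lra|eexists; exact Hs].
Qed.

Lemma sum_n_geom_bound (u : nat -> R) K x N : 0 <= x < 1 -> 0 <= K ->
  (forall k, u k <= K * x ^ k) -> sum_n u N <= K * / (1 - x).
Proof.
  intros Hx HK H; apply Rle_trans with (sum_n (fun k => K * x ^ k) N).
  - apply sum_n_le; auto.
  - replace (sum_n (fun k => K * x ^ k) N) with (K * sum_n (fun k => x ^ k) N)
      by (symmetry; apply (sum_n_mult_l (K := R_Ring))).
    apply Rmult_le_compat_l; auto; now apply geometric_sum_le.
Qed.

Lemma analytic_hC d rho z0 : 0 <= rho -> rate d rho -> rho * Cmod z0 < 1 ->
  analytic_at (hC d) z0.
Proof.
  intros H0 Hd Hz.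
  set (R0 := Cmod z0) in *; assert (HR : 0 <= R0) by apply Cmod_ge_0.
  (* Half of the gap is spent: as e <= 1/2, (rho+e)(R0+e) <= rho R0 + e (rho+R0+1) = (1 + rho R0)/2
     < 1. *)
  set (e := (1 - rho * R0) / (2 * (rho + R0 + 1))).
  assert (Ee : e * (2 * (rho + R0 + 1)) = 1 - rho * R0) by (unfold e; field; lra).
  assert (He : 0 < e) by (apply Rdiv_lt_0_compat; lra).
  assert (He1 : e <= 1 / 2) by nra.
  assert (Hx : 0 <= (rho + e) * (R0 + e) < 1).
  { split; [apply Rmult_le_pos; lra|]; nra. }
  destruct (Hd (rho + e) ltac:(lra)) as [K HK].
  assert (HK0 := rate_nonneg_const _ _ _ HK).
  apply analytic_double_series with
    (fun k m => (d k * binrow z0 k m)%C) e (K * / (1 - (rho + e) * (R0 + e))); auto.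
  - intros N M; apply sum_n_geom_bound; auto; intros k.
    rewrite Rpow_mult_distr, <- Rmult_assoc.
    apply Rle_trans with (Cmod (d k) *
      sum_n (fun m => Cmod (binrow z0 k m * RtoC e ^ m)) M).
    + right; rewrite <- (sum_n_mult_l (K := R_Ring)); apply sum_n_ext; intros m.
      rewrite <- Cmult_assoc, Cmod_mult; reflexivity.
    + apply Rmult_le_compat; auto; [apply Cmod_ge_0|apply sum_n_nonneg; intros; apply Cmod_ge_0|].
      apply binrow_bound; lra.
  - intros h Hh; unfold hC; apply CSeries_ext; intros k.
    symmetry; apply CSeries_unique.
    apply csum_ext with (fun m => (d k * (binrow z0 k m * h ^ m))%C).
    + intros m; ring.
    + apply csum_scal, binrow_csum.
Qed.

(** * The identity theorem *)

Lemma csum_terms_bounded (u : nat -> C) (s : C) : is_csum u s -> exists K, 0 <= K /\ forall n,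
  Cmod (u n) <= K.
Proof.
  intros H; apply Clim_bounded with (RtoC 0).
  apply (Clim_shift _ _ 1).
  intros eps Heps.
  destruct (proj1 (csum_eps _ _) H (eps / 2) ltac:(lra)) as [N HN].
  exists N; intros n Hn; rewrite Nat.add_1_r.
  assert (h1 := HN n Hn); assert (h2 := HN (S n) ltac:(lia)).
  rewrite sum_n_C_S in h2.
  replace (u (S n) - 0)%C with
    (sum_n u n + u (S n) - s + - (sum_n u n - s))%C by cring.
  apply Rle_lt_trans with (1 := Cmod_triangle _ _); rewrite Cmod_opp; lra.
Qed.

Lemma rate_shift_n u rho N : 0 <= rho -> rate u rho -> rate (fun k => u (N + k)%nat) rho.
Proof.
  intros H0 H; induction N as [|N IH]; [exact H|].
  apply rate_ext with (fun k => u (N + S k)%nat); [intros; f_equal; lia|].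
  exact (rate_shift _ _ H0 IH).
Qed.

Lemma hC_leading_zeros u rho h N : 0 <= rho -> rate u rho -> rho * Cmod h < 1 ->
  (forall m, (m < N)%nat -> u m = 0) ->
  hC u h = (h ^ N * hC (fun k => u (N + k)%nat) h)%C.
Proof.
  intros H0 Hu Hh; induction N as [|N IH]; intros Hz.
  { change (hC u h = (1 * hC u h)%C); ring. }
  rewrite IH by (intros; apply Hz; lia).
  rewrite (hC_step _ rho) by (auto using rate_shift_n).
  rewrite (Hz (N + 0)%nat) by lia; rewrite Cpow_S.
  rewrite (hC_ext (fun k => u (N + S k)%nat) (fun k => u (S N + k)%nat)) by (intros; f_equal; lia).
  ring.
Qed.

(** If u_n is the first nonzero Taylor coefficient, then f = h^n (u_n + h X) with |X| <= K near
    [z0], so there is no zero with 0 < |h| < |u_n|/(K+1) close to [z0]. A cluster of zeros therefore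
    makes every coefficient vanish. *)
Lemma analytic_zeros_cluster f z0 : analytic_at f z0 ->
  (forall eps, 0 < eps -> exists z, 0 < Cmod (z - z0) < eps /\ f z = 0) ->
  exists r, 0 < r /\ forall z, Cmod (z - z0) < r -> f z = 0.
Proof.
  intros [u [r H]] Hacc.
  assert (Hr := cond_pos r); set (r1 := r / 2).
  assert (Hr1 : 0 < r1 < r) by (unfold r1; lra).
  (* Convergence at the single point z0 + r1 bounds the terms u_n r1^n. *)
  assert (Hrate : rate u (/ r1)).
  { assert (Hs := H (z0 + RtoC r1)%C).
    replace (z0 + RtoC r1 - z0)%C with (RtoC r1) in Hs by ring.
    rewrite Cmod_R, Rabs_pos_eq in Hs by lra.
    destruct (csum_terms_bounded _ _ (proj1 (Cpseries_csum _ _ _) (Hs ltac:(lra)))) as [K [HK0 HK]].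
    intros s Hs'; exists K; intros n; specialize (HK n).
    rewrite Cmod_mult, Cmod_pow, Cmod_R, Rabs_pos_eq in HK by lra.
    apply Rle_trans with (K * (/ r1) ^ n).
    - apply (Rmult_le_reg_r (r1 ^ n)); [apply pow_lt; lra|].
      rewrite Rmult_assoc, <- Rpow_mult_distr, Rinv_l, pow1 by lra; lra.
    - apply Rmult_le_compat_l; auto; apply pow_incr; split; [apply Rlt_le, Rinv_0_lt_compat|];
      lra. }
  assert (Hri : 0 < / r1) by (apply Rinv_0_lt_compat; lra).
  assert (Hf : forall z, Cmod (z - z0) < r -> f z = hC u (z - z0)%C).
  { intros z Hz; symmetry; apply CSeries_unique, Cpseries_csum, H, Hz. }
  assert (Hu : forall n, u n = 0).
  { intros n; induction n as [n IH] using Wf_nat.lt_wf_ind.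
    apply NNPP; intros Hne; apply Cmod_gt_0 in Hne.
    assert (Hrn := rate_shift_n u _ n (Rlt_le _ _ Hri) Hrate).
    destruct (hC_bound (fun k => u (n + S k)%nat) (/ r1) (r1 / 2)) as [K [HK0 HK]]; try lra.
    { exact (rate_shift _ _ (Rlt_le _ _ Hri) Hrn). }
    { unfold Rdiv; rewrite <- Rmult_assoc, Rinv_l by lra; lra. }
    destruct (Hacc (Rmin (r1 / 2) (Cmod (u n) / (K + 1)))) as [z [[Hz0 Hz] Hfz]].
    { apply Rmin_glb_lt; [lra|apply Rdiv_lt_0_compat; lra]. }
    assert (Hz1 := Rlt_le_trans _ _ _ Hz (Rmin_l _ _)).
    assert (Hz2 := Rlt_le_trans _ _ _ Hz (Rmin_r _ _)).
    rewrite Hf in Hfz by lra; set (h := (z - z0)%C) in *.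
    assert (Hh : / r1 * Cmod h < 1).
    { apply (Rmult_lt_reg_l r1); [lra|]; rewrite <- Rmult_assoc, Rinv_r by lra; lra. }
    rewrite (hC_leading_zeros u (/ r1) h n) in Hfz by (auto; lra).
    rewrite (hC_step _ (/ r1)) in Hfz by (auto; lra).
    rewrite Nat.add_0_r in Hfz.
    set (X := hC (fun k => u (n + S k)%nat) h) in *.
    assert (HX : Cmod X <= K) by (apply HK; lra).
    assert (Hhn : h <> 0) by now apply Cmod_gt_0.
    assert (E : u n = (- (h * X))%C).
    { apply Ceq_minus; apply NNPP; intros Hn.
      apply (Cmult_neq_0 _ _ (Cpow_nz h n Hhn) Hn).
      transitivity (h ^ n * (u n + h * X))%C; [ring|exact Hfz]. }
    assert (Hc : Cmod (u n) <= Cmod h * K).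
    { rewrite E, Cmod_opp, Cmod_mult; apply Rmult_le_compat_l; [apply Cmod_ge_0|auto]. }
    apply (Rmult_lt_compat_r (K + 1)) in Hz2; [|lra].
    replace (Cmod (u n) / (K + 1) * (K + 1)) with (Cmod (u n)) in Hz2 by (field; lra).
    nra. }
  exists r; split; auto; intros z Hz; rewrite Hf by auto.
  apply CSeries_unique, csum_ext with (single (RtoC 0)).
  - intros [|k]; rewrite Hu; simpl; ring.
  - apply csum_singleton.
Qed.

Lemma path_continuous_Cmod (g : R -> C) t eps : 0 < eps ->
  continuous (fun s => Re (g s)) t -> continuous (fun s => Im (g s)) t ->
  exists delta, 0 < delta /\ forall s, Rabs (s - t) < delta -> Cmod (g s - g t) < eps.
Proof.
  intros Heps H1 H2; assert (He : 0 < eps / 2) by lra.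
  destruct (proj1 (filterlim_locally_ball_norm (K := R_AbsRing) (U := R_NormedModule) _ _) H1
    (mkposreal _ He)) as [d1 Hd1].
  destruct (proj1 (filterlim_locally_ball_norm (K := R_AbsRing) (U := R_NormedModule) _ _) H2
    (mkposreal _ He)) as [d2 Hd2].
  exists (Rmin d1 d2); split; [apply Rmin_glb_lt; apply cond_pos|].
  intros s Hs; apply Rle_lt_trans with (1 := Cmod_le_Re_Im _).
  assert (h1 := Hd1 s (Rlt_le_trans _ _ _ Hs (Rmin_l _ _))).
  assert (h2 := Hd2 s (Rlt_le_trans _ _ _ Hs (Rmin_r _ _))).
  change (Rabs (Re (g s - g t)) < eps / 2) in h1.
  change (Rabs (Im (g s - g t)) < eps / 2) in h2.
  lra.
Qed.

(** Let tau be the supremum of the parameters up to which f vanishes. Zeros cluster at g tau, so f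
    vanishes on a disk around it; for tau < 1 the path would continue inside this disk. Injectivity
    of [g] ensures that the clustering zeros differ from g tau. *)
Theorem identity_along_path (f : C -> C) (g : R -> C) (s0 : R) :
  (forall t, continuous (fun s => Re (g s)) t) -> (forall t, continuous (fun s => Im (g s)) t) ->
  (forall s t, 0 <= s < t -> t <= 1 -> g s <> g t) ->
  (forall t, 0 <= t <= 1 -> analytic_at f (g t)) ->
  0 < s0 -> (forall s, 0 <= s <= s0 -> f (g s) = 0) ->
  f (g 1) = 0.
Proof.
  intros Hc1 Hc2 Hinj Han Hs0 Hf0.
  set (E := fun t => 0 <= t <= 1 /\ forall s, 0 <= s <= t -> f (g s) = 0).
  assert (HE0 : E (Rmin s0 1)).
  { split; [split; [apply Rmin_glb; lra|apply Rmin_r]|].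
    intros s Hs; apply Hf0; assert (h := Rmin_l s0 1); lra. }
  destruct (completeness E) as [tau [Hub Hlub]].
  { exists 1; intros t [Ht _]; lra. }
  { now exists (Rmin s0 1). }
  assert (Htau0 : 0 < tau).
  { apply Rlt_le_trans with (Rmin s0 1); [apply Rmin_glb_lt; lra|now apply Hub]. }
  assert (Htau1 : tau <= 1) by (apply Hlub; intros t [Ht _]; lra).
  assert (Hbelow : forall s, 0 <= s < tau -> f (g s) = 0).
  { intros s Hs; apply NNPP; intros Hne.
    assert (tau <= s); [|lra].
    apply Hlub; intros t [Ht Ht']; destruct (Rle_or_lt t s); auto.
    exfalso; apply Hne, Ht'; lra. }
  destruct (analytic_zeros_cluster f (g tau)) as [r [Hr Hz]].
  { apply Han; lra. }
  { intros eps Heps; destruct (path_continuous_Cmod g tau eps Heps (Hc1 tau) (Hc2 tau)) as [d [Hd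
    Hd']].
    set (s := Rmax 0 (tau - d / 2)).
    assert (Hs : 0 <= s < tau) by (unfold s; split; [apply Rmax_l|apply Rmax_lub_lt; lra]).
    exists (g s); split; [split|now apply Hbelow].
    - apply Cmod_gt_0; intros e; apply (Hinj s tau); auto; now apply Ceq_minus.
    - apply Hd'; assert (h := Rmax_r 0 (tau - d / 2)); fold s in h; apply Rabs_def1; lra. }
  destruct (path_continuous_Cmod g tau r Hr (Hc1 tau) (Hc2 tau)) as [d [Hd Hd']].
  assert (Hnear : forall s, Rabs (s - tau) < d -> f (g s) = 0) by auto.
  destruct (Rle_lt_or_eq_dec _ _ Htau1) as [Hlt|Heq].
  - exfalso; set (t := Rmin 1 (tau + d / 2)).
    assert (Ht : tau < t) by (apply Rmin_glb_lt; lra).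
    assert (Ht1 : t <= 1) by apply Rmin_l.
    assert (Ht2 : t <= tau + d / 2) by apply Rmin_r.
    assert (E t); [|assert (h := Hub t H); lra].
    split; [lra|]; intros s Hs; destruct (Rlt_or_le s tau); [apply Hbelow; lra|].
    apply Hnear, Rabs_def1; lra.
  - apply Hnear; rewrite Heq, Rminus_eq_0, Rabs_R0; auto.
Qed.

Lemma continuous_affine a b t : continuous (fun s : R => a + s * b) t.
Proof.
  apply (ex_derive_continuous (fun s : R => a + s * b)); auto_derive; auto.
Qed.

Corollary identity_along_segment (f : C -> C) (z0 z1 : C) (s0 : R) : z0 <> z1 ->
  let g := fun s => (z0 + RtoC s * (z1 - z0))%C in
  (forall t, 0 <= t <= 1 -> analytic_at f (g t)) ->
  0 < s0 -> (forall s, 0 <= s <= s0 -> f (g s) = 0) ->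
  f z1 = 0.
Proof.
  intros Hne g Han Hs0 Hf.
  replace z1 with (g 1) by (unfold g; ring).
  apply identity_along_path with s0; auto.
  - intros t; apply continuous_ext with (fun s => Re z0 + s * Re (z1 - z0)).
    + intros s; unfold g; now rewrite re_plus, re_scal_l.
    + apply continuous_affine.
  - intros t; apply continuous_ext with (fun s => Im z0 + s * Im (z1 - z0)).
    + intros s; unfold g; now rewrite im_plus, im_scal_l.
    + apply continuous_affine.
  - intros s t Hst Ht E; unfold g in E.
    apply (Cmult_neq_0 (RtoC (t - s)) (z1 - z0)%C).
    + apply RtoC_neq_0; lra.
    + intros E'; apply Hne; symmetry; now apply Ceq_minus.
    + rewrite RtoC_minus; apply Ceq_minus in E.
      replace (RtoC 0) with (- RtoC 0)%C by ring; rewrite <- E; ring.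
Qed.

(** The arc runs from -|z| to [z] on the side of the real axis where [z] lies. Parametrized by its
    real part it needs only the continuity of the square root, and the points it meets satisfy |w| =
    |z| and Re w <= Re z, a condition that the applications can check algebraically. *)
Corollary identity_along_arc (f : C -> C) (z : C) :
  z <> 0 -> (forall w, Cmod w = Cmod z -> Re w <= Re z -> analytic_at f w) ->
  (exists e, 0 < e /\ forall t : R, Rabs (t + Cmod z) < e -> f (RtoC t) = 0) ->
  f z = 0.
Proof.
  intros Hz Han [e [He Hfe]].
  set (r := Cmod z) in *; assert (Hr : 0 < r) by now apply Cmod_gt_0.
  assert (Hsq := Cmod_sqr z); fold r in Hsq.
  assert (Hx : - r <= Re z <= r) by (apply Rabs_le_between, re_le_Cmod).
  set (sg := if Rle_dec 0 (Im z) then 1 else -1).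
  assert (Hsg : sg * sg = 1) by (unfold sg; destruct (Rle_dec 0 (Im z)); ring).
  destruct (Rle_lt_or_eq_dec _ _ (proj1 Hx)) as [Hlt|Heq].
  2:{ assert (Him : Im z = 0) by nra.
      replace z with (RtoC (- r)).
      - apply Hfe; replace (- r + r) with 0 by ring; rewrite Rabs_R0; auto.
      - destruct z as [a b]; unfold Re, Im in *; simpl in *; unfold RtoC; now rewrite Heq, Him. }
  set (x := fun s => - r + s * (Re z + r)).
  set (g := fun s => (x s, sg * sqrt (r * r - x s * x s)) : C).
  assert (Hg1 : g 1 = z).
  { unfold g; assert (Ex : x 1 = Re z) by (unfold x; ring); rewrite Ex.
    replace (r * r - Re z * Re z) with (Im z * Im z) by lra.
    assert (Es : sg * sqrt (Im z * Im z) = Im z).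
    { fold (Rsqr (Im z)); rewrite sqrt_Rsqr_abs; unfold sg.
      destruct (Rle_dec 0 (Im z)); [rewrite Rabs_pos_eq by auto; ring|rewrite Rabs_left by lra;
        ring]. }
    rewrite Es; now destruct z. }
  assert (Hxr : forall s, 0 <= s <= 1 -> - r <= x s <= Re z).
  { intros s Hs; unfold x; nra. }
  assert (Hmod : forall s, 0 <= s <= 1 -> Cmod (g s) = r).
  { intros s Hs; specialize (Hxr s Hs).
    rewrite Cmod_sqrt; unfold g, Re, Im; simpl.
    replace (sg * sqrt (r * r - x s * x s) * (sg * sqrt (r * r - x s * x s))) with
      (sg * sg * (sqrt (r * r - x s * x s) * sqrt (r * r - x s * x s))) by ring.
    rewrite Hsg, sqrt_sqrt by nra.
    replace (x s * x s + 1 * (r * r - x s * x s)) with (Rsqr r) by (unfold Rsqr; ring).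
    apply sqrt_Rsqr; lra. }
  assert (Hci : forall t, continuous (fun s => Im (g s)) t).
  { intros t.
    change (continuous (fun s => scal sg (sqrt (r * r - x s * x s))) t).
    apply (continuous_scal_r (K := R_AbsRing) (V := R_NormedModule) sg (fun s => sqrt (r * r - x
      s * x s))).
    apply continuous_comp with (f := fun s => r * r - x s * x s) (g := sqrt).
    - apply (ex_derive_continuous (fun s => r * r - x s * x s)); unfold x; auto_derive; auto.
    - apply continuous_sqrt. }
  assert (Hcr : forall t, continuous (fun s => Re (g s)) t).
  { intros t; apply continuous_affine. }
  assert (Hang : forall t, 0 <= t <= 1 -> analytic_at f (g t)).
  { intros t Ht; apply Han; [now apply Hmod|apply (Hxr t Ht)]. }
  assert (Hg0 : g 0 = RtoC (- r)).
  { unfold g, RtoC; assert (Ex : x 0 = - r) by (unfold x; ring); rewrite Ex.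
    replace (r * r - - r * - r) with 0 by ring; rewrite sqrt_0, Rmult_0_r; reflexivity. }
  (* The known zeros lie on the real axis, across the circle rather than along it. The local
     identity theorem at -r carries them over to an initial piece of the arc. *)
  destruct (analytic_zeros_cluster f (g 0)) as [rr [Hrr Hzz]].
  { apply Hang; lra. }
  { intros eps Heps; rewrite Hg0.
    set (d := Rmin eps e / 2).
    assert (Hd : 0 < d) by (unfold d; assert (0 < Rmin eps e) by (apply Rmin_glb_lt; auto); lra).
    assert (Hd1 : d < eps) by (unfold d in *; assert (h := Rmin_l eps e); lra).
    assert (Hd2 : d < e) by (unfold d in *; assert (h := Rmin_r eps e); lra).
    exists (RtoC (- r + d)); split.
    - rewrite <- RtoC_minus, Cmod_R; replace (- r + d - - r) with d by ring.
      rewrite Rabs_pos_eq; lra.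
    - apply Hfe; replace (- r + d + r) with d by ring; rewrite Rabs_pos_eq; lra. }
  destruct (path_continuous_Cmod g 0 rr Hrr (Hcr 0) (Hci 0)) as [d [Hd Hd']].
  rewrite <- Hg1; apply identity_along_path with (d / 2); auto; [|lra|].
  - intros s t Hst Ht E; apply (f_equal Re) in E; unfold g, Re, x in E; simpl in E; nra.
  - intros s Hs; apply Hzz, Hd'; rewrite Rminus_0_r, Rabs_pos_eq; lra.
Qed.

(** * Rearrangement of finite and infinite sums *)

Lemma sum_n_C_first (f : nat -> C) N : sum_n f (S N) = (f O + sum_n (fun n => f (S n)) N)%C.
Proof.
  induction N as [|N IH]; [rewrite sum_n_C_S, !sum_O; reflexivity|].
  rewrite sum_n_C_S, IH, sum_n_C_S; cring.
Qed.

Lemma sum_n_C_ext (f g : nat -> C) N : (forall n, (n <= N)%nat -> f n = g n) -> sum_n f N = sum_n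
  g N.
Proof. exact (sum_n_ext_loc f g N). Qed.

Lemma sum_n_C_plus (f g : nat -> C) N :
  sum_n (fun n => (f n + g n)%C) N = (sum_n f N + sum_n g N)%C.
Proof. exact (sum_n_plus f g N). Qed.

Lemma sum_n_C_scal (c : C) (f : nat -> C) N :
  sum_n (fun n => (c * f n)%C) N = (c * sum_n f N)%C.
Proof. exact (sum_n_mult_l (K := C_Ring) c f N). Qed.

Lemma sum_n_C_rev (f : nat -> C) N : sum_n (fun n => f (N - n)%nat) N = sum_n f N.
Proof.
  revert f; induction N as [|N IH]; intros f; [rewrite !sum_O; reflexivity|].
  rewrite sum_n_C_first, (sum_n_C_S f), Nat.sub_0_r.
  rewrite (sum_n_C_ext (fun n => f (S N - S n)%nat) (fun n => f (N - n)%nat)) by reflexivity.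
  rewrite IH; cring.
Qed.

Lemma sum_n_C_triangle (f : nat -> nat -> C) k :
  sum_n (fun i => sum_n (fun n => f i n) (k - i)) k =
  sum_n (fun n => sum_n (fun i => f i n) (k - n)) k.
Proof.
  induction k as [|k IH]; [rewrite !sum_O; reflexivity|].
  assert (Hstep : forall g : nat -> nat -> C,
    sum_n (fun i => sum_n (fun n => g i n) (S k - i)) (S k) =
    (sum_n (fun i => sum_n (fun n => g i n) (k - i)) k +
          sum_n (fun i => g i (S k - i)%nat) (S k))%C).
  { intros g; rewrite !sum_n_C_S, Nat.sub_diag, sum_O.
    rewrite (sum_n_C_ext (fun i => sum_n (fun n => g i n) (S k - i))
      (fun i => (sum_n (fun n => g i n) (k - i) + g i (S k - i)%nat)%C)).
    - rewrite sum_n_C_plus; cring.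
    - intros i Hi; replace (S k - i)%nat with (S (k - i)) by lia; apply sum_n_C_S. }
  rewrite Hstep, (Hstep (fun n i => f i n)), IH; f_equal.
  rewrite <- (sum_n_C_rev (fun i => f i (S k - i)%nat)).
  apply sum_n_C_ext; intros n Hn; f_equal; lia.
Qed.

Lemma sum_n_mono (a : nat -> R) N M : (N <= M)%nat -> (forall n, 0 <= a n) -> sum_n a N <= sum_n
  a M.
Proof.
  intros H Ha; induction H as [|M H IH]; [lra|].
  rewrite sum_n_R_S; specialize (Ha (S M)); lra.
Qed.

Lemma csum_finite (v : nat -> C) j : (forall k, (j < k)%nat -> v k = RtoC 0) -> is_csum v (sum_n
  v j).
Proof.
  intros H; apply csum_eps; intros eps Heps; exists j; intros N HN.
  assert (E : sum_n v N = sum_n v j).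
  { induction HN as [|N HN IH]; [reflexivity|].
    rewrite sum_n_C_S, IH, H by lia; cring. }
  rewrite E; replace (_ - _)%C with (RtoC 0) by cring; now rewrite Cmod_0.
Qed.

Lemma csum_skip (v : nat -> C) n s : (forall k, (k < n)%nat -> v k = RtoC 0) ->
  is_csum (fun m => v (n + m)%nat) s -> is_csum v s.
Proof.
  revert v; induction n as [|n IH]; intros v Hz H; [exact H|].
  apply csum_ext with (2 := csum_shift_r _ _ (IH (fun m => v (S m)) (fun k Hk => Hz (S k)
    ltac:(lia)) H)).
  intros [|m]; [symmetry; apply Hz; lia|reflexivity].
Qed.

(** Delaying row k by k zeros turns the antidiagonals of [u] into the columns of [w], to which the
    exchange of summations applies. *)
Lemma CSeries_diagonal (u : nat -> nat -> C) B :
  (forall N M, sum_n (fun n => sum_n (fun m => Cmod (u n m)) M) N <= B) ->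
  CSeries (fun k => CSeries (u k)) = CSeries (fun j => sum_n (fun k => u k (j - k)%nat) j).
Proof.
  intros HB.
  set (w := fun k j => if (k <=? j)%nat then u k (j - k)%nat else RtoC 0).
  assert (Hw0 : forall k j, (j < k)%nat -> w k j = 0).
  { intros k j Hj; unfold w; destruct (Nat.leb_spec k j); [lia|reflexivity]. }
  assert (Hw1 : forall k m, w k (k + m)%nat = u k m).
  { intros k m; unfold w; destruct (Nat.leb_spec k (k + m)); [f_equal; lia|lia]. }
  assert (Hrow : forall k, CSeries (u k) = CSeries (w k)).
  { intros k; symmetry; apply CSeries_unique, csum_skip with k; [apply Hw0|].
    apply csum_ext with (u k); [intros; now rewrite Hw1|].
    apply csum_correct, (double_row_summable u B HB). }
  assert (HwB : forall N M, sum_n (fun n => sum_n (fun m => Cmod (w n m)) M) N <= B).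
  { intros N M; apply Rle_trans with (2 := HB N M); apply sum_n_le; intros k _.
    assert (Hzero : forall M, (M < k)%nat -> sum_n (fun m => Cmod (w k m)) M = 0).
    { intros M' HM'; induction M' as [|M' IH]; [rewrite sum_O, Hw0, Cmod_0 by lia; auto|].
      rewrite sum_n_R_S, IH, Hw0, Cmod_0 by lia; apply Rplus_0_r. }
    assert (Hpos : forall M, 0 <= sum_n (fun m => Cmod (u k m)) M).
    { intros; apply sum_n_nonneg; intros; apply Cmod_ge_0. }
    assert (Hshift : forall t, sum_n (fun m => Cmod (w k m)) (k + t) = sum_n (fun m => Cmod (u k
      m)) t).
    { induction t as [|t IH].
      - rewrite Nat.add_0_r, sum_O; destruct k as [|k'].
        + now rewrite sum_O, <- (Hw1 0%nat 0%nat).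
        + rewrite sum_n_R_S, Hzero by lia.
          rewrite <- (Hw1 (S k') 0%nat), Nat.add_0_r; apply Rplus_0_l.
      - rewrite Nat.add_succ_r, !sum_n_R_S, IH, <- Nat.add_succ_r, Hw1; auto. }
    destruct (Nat.le_gt_cases k M) as [Hk|Hk].
    - replace M with (k + (M - k))%nat at 1 by lia; rewrite Hshift.
      apply sum_n_mono; [lia|intros; apply Cmod_ge_0].
    - rewrite Hzero by lia; apply Hpos. }
  rewrite (CSeries_ext _ _ Hrow), (CSeries_fubini w B HwB).
  apply CSeries_ext; intros j; apply CSeries_unique.
  assert (E : sum_n (fun k => u k (j - k)%nat) j = sum_n (fun k => w k j) j).
  { apply sum_n_C_ext; intros k Hk; unfold w; destruct (Nat.leb_spec k j); [reflexivity|lia]. }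
  rewrite E; apply csum_finite; auto.
Qed.

(** The case [e = 1] is the Chu-Vandermonde identity, the case [e = 0] the binomial theorem. *)
Lemma convolution_first_order (e x y : C) (A B D : nat -> C) :
  A O = 1 -> B O = 1 -> D O = 1 ->
  (forall i, (INR (S i) * A (S i))%C = ((x + e * INR i) * A i)%C) ->
  (forall i, (INR (S i) * B (S i))%C = ((y + e * INR i) * B i)%C) ->
  (forall i, (INR (S i) * D (S i))%C =
     ((x + y + e * INR i) * D i)%C) ->
  forall N, sum_n (fun i => (A i * B (N - i)%nat)%C) N = D N.
Proof.
  intros A0 B0 D0 HA HB HD; induction N as [|N IH].
  - rewrite sum_O; simpl Nat.sub; rewrite A0, B0, D0; cring.
  - assert (Hinj : forall u v, (INR (S N) * u)%C = (INR (S N) * v)%C -> u = v).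
    { intros u v E; assert (Hn := INR_S_neq_0 N).
      transitivity (/ RtoC (INR (S N)) * (INR (S N) * u))%C; [field; auto|].
      rewrite E; field; auto. }
    apply Hinj; rewrite HD, <- IH, <- !sum_n_C_scal.
    (* The weight N+1 is split as i + (N+1-i), as in the product rule, so that each recurrence acts
       on its own factor. *)
    rewrite (sum_n_C_ext _ (fun i => (INR i * (A i * B (S N - i)%nat) +
      INR (S N - i) * (A i * B (S N - i)%nat))%C)).
    2:{ intros i Hi; replace (INR (S N)) with (INR i + INR (S N - i))
          by (rewrite <- plus_INR; f_equal; lia).
        rewrite RtoC_plus; ring. }
    rewrite sum_n_C_plus, sum_n_C_first, (sum_n_C_S (fun i => (INR (S N - i) * _)%C)).
    rewrite Nat.sub_diag; change (INR 0) with 0.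
    rewrite !Cmult_0_l, Cplus_0_l, Cplus_0_r, <- sum_n_C_plus.
    apply sum_n_C_ext; intros i Hi.
    change (S N - S i)%nat with (N - i)%nat.
    rewrite Cmult_assoc, HA.
    replace (S N - i)%nat with (S (N - i)) by lia.
    replace (INR (S (N - i)) * (A i * B (S (N - i))))%C with
      (A i * (INR (S (N - i)) * B (S (N - i))))%C by ring.
    rewrite HB; replace (INR N) with (INR i + INR (N - i)) by (rewrite <- plus_INR; f_equal; lia).
    rewrite RtoC_plus; ring.
Qed.

Lemma vandermonde x y N :
  sum_n (fun i => (rf x i * rf y (N - i)%nat)%C) N = rf (x + y) N.
Proof.
  apply (convolution_first_order (RtoC 1) x y); try apply rf_0;
    intros i; rewrite rf_S, Cmult_1_l; reflexivity.
Qed.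

Lemma binomial_theorem s t N :
  sum_n (fun i => (s ^ i / Cfact i * (t ^ (N - i) / Cfact (N - i)))%C) N =
  ((s + t) ^ N / Cfact N)%C.
Proof.
  assert (H0 : forall s, (s ^ 0 / Cfact 0)%C = 1).
  { intros; unfold Cfact; simpl; field; exact C1_nz. }
  assert (HS : forall s i, (INR (S i) * (s ^ (S i) / Cfact (S i)))%C =
    ((s + 0 * INR i) * (s ^ i / Cfact i))%C).
  { intros z i; rewrite Cfact_S, Cpow_S; field; split; auto using INR_S_neq_0, Cfact_neq_0. }
  apply (convolution_first_order (RtoC 0) s t (fun i => (s ^ i / Cfact i)%C)
    (fun i => (t ^ i / Cfact i)%C) (fun i => ((s + t) ^ i / Cfact i)%C)); auto.
Qed.

Lemma rf_poch_sub x n j : (n <= j)%nat ->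
  (poch x n * poch (x + INR n) (j - n))%C = poch x j.
Proof. intros H; rewrite <- poch_add; f_equal; lia. Qed.

Lemma rf_power_expand be q j :
  (rf be j * (q - 1) ^ j)%C =
  sum_n (fun n => ((- RtoC 1) ^ n * rf be n *
    (rf (be + INR n) (j - n) * q ^ (j - n)))%C) j.
Proof.
  transitivity (poch be j * ((- RtoC 1 + q) ^ j / Cfact j))%C.
  { replace (q - 1)%C with (- RtoC 1 + q)%C by ring.
    unfold rf; field; apply Cfact_neq_0. }
  rewrite <- binomial_theorem, <- sum_n_C_scal.
  apply sum_n_C_ext; intros n Hn; rewrite <- (rf_poch_sub be n j Hn).
  unfold rf; field; auto using Cfact_neq_0.
Qed.

(** Both sides are the coefficient of w^k in (1-qw)^(-de) (1-(q-1)w)^(-be): on the right, 1-(q-1)w =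
    (1-qw) + w is expanded in powers of w/(1-qw). *)
Lemma rf_convolution_expand de be q k :
  sum_n (fun i => (rf de i * q ^ i *
    (rf be (k - i) * (q - 1) ^ (k - i)))%C) k =
  sum_n (fun n => ((- RtoC 1) ^ n * rf be n *
    (rf (de + be + INR n) (k - n) * q ^ (k - n)))%C) k.
Proof.
  set (f := fun i n => (rf de i * q ^ i *
    ((- RtoC 1) ^ n * rf be n *
      (rf (be + INR n) (k - i - n) * q ^ (k - i - n))))%C).
  transitivity (sum_n (fun i => sum_n (fun n => f i n) (k - i)) k).
  - apply sum_n_C_ext; intros i Hi; unfold f; rewrite sum_n_C_scal; f_equal.
    apply rf_power_expand.
  - rewrite sum_n_C_triangle; apply sum_n_C_ext; intros n Hn.
    replace (de + be + INR n)%C with (de + (be + INR n))%C by ring.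
    rewrite <- vandermonde.
    transitivity ((- RtoC 1) ^ n * rf be n * q ^ (k - n) *
      sum_n (fun i => (rf de i * rf (be + INR n) (k - n - i))%C) (k - n))%C; [|ring].
    rewrite <- sum_n_C_scal; apply sum_n_C_ext; intros i Hi; unfold f.
    replace (k - i - n)%nat with (k - n - i)%nat by lia.
    replace (q ^ (k - n))%C with (q ^ i * q ^ (k - n - i))%C
      by (rewrite <- Cpow_add_r; f_equal; lia).
    ring.
Qed.

(** * Expansions in inverse powers of [p - z] *)

(** A function with exponent [a] at infinity, expanded about the centre [p]. The same function has
    such expansions about several centres, convergent outside different disks. *)
Definition VF (a : C) (d : nat -> C) (p z : C) : C :=
  (Cpower (p - z) (- a)%C * hC d (/ (p - z))%C)%C.

(** The coefficient of h^m in d k (v-h)^(-(a+k)), by the binomial series at v. *)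
Definition VF_coef (a : C) (d : nat -> C) (v : C) (k m : nat) : C :=
  (d k * rf (a + INR k) m *
        (/ v ^ (k + m) * Cpower v (- a)%C))%C.

Lemma rate_hC_inv_summable d rho v : 0 <= rho -> rate d rho -> rho < Cmod v ->
  rho * Cmod (/ v) < 1.
Proof.
  intros H0 Hd Hv; assert (Hp : 0 < Cmod v) by lra.
  rewrite Cmod_inv by (now apply Cmod_gt_0).
  apply (Rmult_lt_reg_r (Cmod v)); auto; rewrite Rmult_assoc, Rinv_l; lra.
Qed.

Lemma VF_expand a d rho v h : 0 <= rho -> rate d rho -> rho + Cmod h < Cmod v ->
  (forall t, 0 <= t <= 1 -> offcut (v - RtoC t * h)) ->
  (Cpower (v - h) (- a)%C * hC d (/ (v - h))%C)%C =
  CSeries (fun k => CSeries (fun m => (VF_coef a d v k m * h ^ m)%C)).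
Proof.
  intros H0 Hd Hv Hoff.
  assert (Hh := Cmod_ge_0 h).
  assert (Hv0 : v <> 0) by (apply Cmod_gt_0; lra).
  assert (Hvh : rho < Cmod (v - h)).
  { assert (t := Cmod_triangle (v - h)%C h).
    replace (v - h + h)%C with v in t by ring; lra. }
  assert (Hvh0 : (v - h)%C <> 0) by (apply Cmod_gt_0; lra).
  unfold hC at 1; rewrite <- CSeries_scal.
  2:{ apply rate_summable with rho; auto; now apply rate_hC_inv_summable with d. }
  apply CSeries_ext; intros k.
  transitivity (d k * Cpower (v - h) (- (a + INR k))%C)%C.
  { rewrite Cpower_opp_plus_INR, Cpow_inv by auto; ring. }
  rewrite (binomial_series _ _ _ Hoff) by lra.
  rewrite Cpower_opp_plus_INR by auto.
  unfold hC; rewrite Cmult_assoc, <- CSeries_scal.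
  - apply CSeries_ext; intros m; unfold VF_coef, Cdiv.
    rewrite Cpow_mult_l, Cpow_inv, Cpow_add_r by auto.
    field; split; auto using Cpow_nz.
  - apply rate_summable with 1; [lra|apply rate_rf|].
    rewrite Cmod_div by auto; rewrite Rmult_1_l.
    apply (Rmult_lt_reg_r (Cmod v)); [lra|]; unfold Rdiv; rewrite Rmult_assoc, Rinv_l; lra.
Qed.

Fixpoint pochR (x : R) (n : nat) : R :=
  match n with O => 1 | S m => pochR x m * (x + INR m) end.

Lemma pochR_nonneg x n : 0 <= x -> 0 <= pochR x n.
Proof.
  intros Hx; induction n as [|n IH]; simpl; [lra|].
  apply Rmult_le_pos; auto; assert (h := pos_INR n); lra.
Qed.

Lemma poch_RtoC x n : poch (RtoC x) n = RtoC (pochR x n).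
Proof. induction n as [|n IH]; simpl; [reflexivity|]; now rewrite IH, RtoC_mult, RtoC_plus. Qed.

Lemma Cmod_poch_le x X n : Cmod x <= X -> Cmod (poch x n) <= pochR X n.
Proof.
  intros H; induction n as [|n IH]; simpl; [rewrite Cmod_1; lra|].
  rewrite Cmod_mult; apply Rmult_le_compat; auto; try apply Cmod_ge_0.
  apply Rle_trans with (1 := Cmod_triangle _ _); rewrite Cmod_R, Rabs_pos_eq by apply pos_INR; lra.
Qed.

Lemma Cmod_Cfact n : Cmod (Cfact n) = INR (fact n).
Proof. unfold Cfact; rewrite Cmod_R, Rabs_pos_eq; auto; apply pos_INR. Qed.

Lemma INR_fact_pos n : 0 < INR (fact n).
Proof. apply lt_0_INR, lt_O_fact. Qed.

(** |(x)_m| <= (X)_m termwise, and the majorant sums to the binomial series of (1-q)^(-X). *)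
Lemma rf_sum_bound x X q M : Cmod x <= X -> 0 <= q < 1 ->
  sum_n (fun m => Cmod (rf x m) * q ^ m) M <= Rpower (1 - q) (- X).
Proof.
  intros Hx Hq.
  assert (HX : 0 <= X) by (apply Rle_trans with (2 := Hx), Cmod_ge_0).
  set (t := fun m => pochR X m / INR (fact m) * q ^ m).
  assert (Ht0 : forall m, 0 <= t m).
  { intros m; unfold t; apply Rmult_le_pos; [apply Rmult_le_pos|apply pow_le; lra].
    - now apply pochR_nonneg.
    - apply Rlt_le, Rinv_0_lt_compat, INR_fact_pos. }
  assert (Hrf : forall m, (rf (RtoC X) m * RtoC q ^ m)%C = RtoC (t m)).
  { intros m; unfold rf, t, Cfact; rewrite poch_RtoC, <- RtoC_pow, <- RtoC_div, <- RtoC_mult; auto.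
    apply INR_fact_neq_0. }
  assert (Hsum : csummable (fun m => (rf (RtoC X) m * RtoC q ^ m)%C)).
  { apply rate_summable with 1; [lra|apply rate_rf|rewrite Cmod_R, Rabs_pos_eq; lra]. }
  assert (Hex : ex_series t).
  { apply ex_series_ext with (2 := Hsum); intros m; rewrite Hrf, Cmod_R, Rabs_pos_eq; auto. }
  assert (Hval : Series t = Rpower (1 - q) (- X)).
  { assert (B := binomial_series (RtoC X) (RtoC 1) (RtoC q)).
    rewrite <- RtoC_minus in B.
    assert (E : Re (hC (rf (RtoC X)) (RtoC q / 1)%C) = Series t).
    { replace (RtoC q / 1)%C with (RtoC q) by (field; exact C1_nz).
      unfold hC; rewrite Re_CSeries; apply Series_ext; intros m; now rewrite Hrf. }
    rewrite <- E; clear E.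
    assert (E1 : Cpower (RtoC 1) (- RtoC X)%C = 1).
    { unfold Cpower; rewrite Clog_pos, ln_1 by lra.
      replace (_ * _)%C with (RtoC 0) by ring; apply Cexp_0. }
    rewrite E1, Cmult_1_l in B; rewrite <- B.
    - unfold Cpower; rewrite Clog_pos, <- RtoC_opp, <- RtoC_mult by lra.
      unfold Cexp; rewrite re_RtoC, im_RtoC, cos_0; unfold Re; simpl; rewrite Rmult_1_r;
        reflexivity.
    - intros s Hs; rewrite <- RtoC_mult, <- RtoC_minus; apply offcut_pos; nra.
    - rewrite Cmod_R, Cmod_1, Rabs_pos_eq; lra. }
  rewrite <- Hval; apply Rle_trans with (sum_n t M).
  - apply sum_n_le; intros m _; unfold t; apply Rmult_le_compat_r; [apply pow_le; lra|].
    unfold rf; rewrite Cmod_div, Cmod_Cfact by apply Cfact_neq_0.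
    apply Rmult_le_compat_r; [apply Rlt_le, Rinv_0_lt_compat, INR_fact_pos|].
    now apply Cmod_poch_le.
  - now apply sum_n_le_Series.
Qed.

Lemma Rpower_opp_plus_INR x X k : 0 < x -> Rpower x (- (X + INR k)) = Rpower x (- X) * (/ x) ^ k.
Proof.
  intros Hx; replace (- (X + INR k)) with (- X + - INR k) by ring.
  rewrite Rpower_plus, (Rpower_Ropp x (INR k)), Rpower_pow, pow_inv by auto; reflexivity.
Qed.

(** The sum over m is at most (1-q)^(-|a|-k) with q = r/|v|, so the sum over k is geometric with
    ratio rho'/(|v|-r), below 1 because rho' < |v| - r. *)
Lemma VF_coef_bound a d rho v r : 0 <= rho -> rate d rho -> 0 <= r -> rho + r < Cmod v ->
  exists B, forall N M,
    sum_n (fun k => sum_n (fun m => Cmod (VF_coef a d v k m) * r ^ m) M) N <= B.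
Proof.
  intros H0 Hd Hr Hv.
  set (V := Cmod v) in *; assert (HV : 0 < V) by lra.
  assert (Hv0 : v <> 0) by now apply Cmod_gt_0.
  set (rho' := (rho + (V - r)) / 2).
  assert (Hrho' : rho < rho' < V - r) by (unfold rho'; lra).
  destruct (Hd rho' ltac:(lra)) as [K HK].
  assert (HK0 := rate_nonneg_const _ _ _ HK).
  set (q := r / V).
  assert (Hq : 0 <= q < 1).
  { unfold q; split; [apply Rmult_le_pos; [auto|apply Rlt_le, Rinv_0_lt_compat; auto]|].
    apply (Rmult_lt_reg_r V); auto; unfold Rdiv; rewrite Rmult_assoc, Rinv_l; lra. }
  set (P := Cmod (Cpower v (- a)%C)); assert (HP : 0 <= P) by apply Cmod_ge_0.
  set (Q := Rpower (1 - q) (- Cmod a)).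
  assert (HQ : 0 <= Q) by (apply Rlt_le, exp_pos).
  set (x := rho' * / V * / (1 - q)).
  assert (Ex : x = rho' / (V - r)) by (unfold x, q; field; lra).
  assert (Hx : 0 <= x < 1).
  { rewrite Ex; split; [apply Rmult_le_pos; [lra|apply Rlt_le, Rinv_0_lt_compat; lra]|].
    apply (Rmult_lt_reg_r (V - r)); [lra|]; unfold Rdiv; rewrite Rmult_assoc, Rinv_l; lra. }
  exists (K * P * Q * / (1 - x)); intros N M.
  apply sum_n_geom_bound; auto; [repeat apply Rmult_le_pos; auto|].
  intros k.
  apply Rle_trans with (Cmod (d k) * (/ V) ^ k * P *
    sum_n (fun m => Cmod (rf (a + INR k) m) * q ^ m) M).
  - right; rewrite <- (sum_n_mult_l (K := R_Ring)); apply sum_n_ext; intros m.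
    unfold VF_coef; rewrite !Cmod_mult, Cmod_inv, Cmod_pow by (now apply Cpow_nz).
    fold P V; unfold q, Rdiv; rewrite Rpow_mult_distr, pow_add, !pow_inv.
    unfold mult; simpl; field; split; apply pow_nonzero; lra.
  - replace (K * P * Q * x ^ k) with
      (K * rho' ^ k * (/ V) ^ k * P * (Q * (/ (1 - q)) ^ k))
      by (unfold x; rewrite !Rpow_mult_distr; ring).
    assert (HVk : 0 <= (/ V) ^ k) by (apply pow_le, Rlt_le, Rinv_0_lt_compat; auto).
    apply Rmult_le_compat.
    + repeat apply Rmult_le_pos; auto; apply Cmod_ge_0.
    + apply sum_n_nonneg; intros; apply Rmult_le_pos; [apply Cmod_ge_0|apply pow_le; lra].
    + repeat apply Rmult_le_compat_r; auto.
    + unfold Q; rewrite <- Rpower_opp_plus_INR by lra.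
      apply rf_sum_bound; auto.
      apply Rle_trans with (1 := Cmod_triangle _ _); rewrite Cmod_R, Rabs_pos_eq by apply
        pos_INR; lra.
Qed.

Lemma offcut_ball v : offcut v -> exists r, 0 < r /\ forall h, Cmod h < r -> offcut (v - h).
Proof.
  intros [H|H].
  - exists (Re v); split; auto; intros h Hh; left.
    assert (t := re_le_Cmod h); apply Rabs_le_between in t.
    change (0 < Re v + - Re h); lra.
  - exists (Rabs (Im v)); split; [now apply Rabs_pos_lt|]; intros h Hh; right.
    assert (t := Im_le_Cmod h); intros E; change (Im v + - Im h = 0) in E.
    replace (Im v) with (Im h) in Hh by lra; lra.
Qed.

Lemma analytic_VF a d rho p z0 : 0 <= rho -> rate d rho -> rho < Cmod (p - z0) ->
  offcut (p - z0) -> analytic_at (VF a d p) z0.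
Proof.
  intros H0 Hd Hv Hoff; set (v := (p - z0)%C) in *.
  destruct (offcut_ball v Hoff) as [r0 [Hr0 Hball]].
  set (r := Rmin r0 ((Cmod v - rho) / 2)).
  assert (Hr : 0 < r) by (apply Rmin_glb_lt; lra).
  assert (Hr1 : r <= r0) by apply Rmin_l.
  assert (Hr2 : r <= (Cmod v - rho) / 2) by apply Rmin_r.
  destruct (VF_coef_bound a d rho v r) as [B HB]; auto; try lra.
  apply analytic_double_series with (VF_coef a d v) r B; auto.
  - intros N M; apply Rle_trans with (2 := HB N M).
    apply sum_n_le; intros k _; apply sum_n_le; intros m _.
    rewrite Cmod_mult, Cmod_pow, Cmod_R, (Rabs_pos_eq r); lra.
  - intros h Hh; unfold VF.
    replace (p - (z0 + h))%C with (v - h)%C by (unfold v; ring).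
    apply VF_expand with rho; auto; [lra|].
    intros t Ht; apply Hball; rewrite Cmod_mult, Cmod_R, Rabs_pos_eq by lra.
    assert (t0 := Cmod_ge_0 h); nra.
Qed.

(** The coefficients after moving the centre from 0 to [p]: each (-z)^(-(a+n)) = ((p-z) -
    p)^(-(a+n)) is expanded in powers of p/(p-z), and equal powers of p-z are collected. *)
Definition shift_coef (a : C) (d : nat -> C) (p : C) (k : nat) : C :=
  sum_n (fun n => (d n * rf (a + INR n) (k - n) * p ^ (k - n))%C) k.

(** On this half line |p - z| = p + |z| > rho + p, just what absolute convergence of the double
    expansion requires. Elsewhere the equality is obtained by the identity theorem. *)
Lemma VF_recenter a d rho p z : 0 <= rho -> rate d rho -> 0 <= p -> z < - rho ->
  VF a d (RtoC 0) (RtoC z) = VF a (shift_coef a d (RtoC p)) (RtoC p) (RtoC z).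
Proof.
  intros H0 Hd Hp Hz; unfold VF.
  set (v := (RtoC p - RtoC z)%C).
  assert (Ev : v = RtoC (p - z)) by (unfold v; now rewrite RtoC_minus).
  assert (Hmv : Cmod v = p - z) by (rewrite Ev, Cmod_R, Rabs_pos_eq; lra).
  assert (Hmp : Cmod (RtoC p) = p) by (rewrite Cmod_R, Rabs_pos_eq; lra).
  replace (0 - RtoC z)%C with (v - RtoC p)%C by (unfold v; ring).
  rewrite (VF_expand a d rho v (RtoC p)); auto; try lra.
  2:{ intros t Ht; rewrite Ev, <- RtoC_mult, <- RtoC_minus; apply offcut_pos; nra. }
  destruct (VF_coef_bound a d rho v p) as [B HB]; auto; try lra.
  rewrite (CSeries_diagonal _ B).
  2:{ intros N M; apply Rle_trans with (2 := HB N M).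
      apply sum_n_le; intros k _; apply sum_n_le; intros m _.
      rewrite Cmod_mult, Cmod_pow, Hmp; lra. }
  assert (Hv0 : v <> 0) by (apply Cmod_gt_0; lra).
  assert (E : forall j, sum_n (fun k => (VF_coef a d v k (j - k) * RtoC p ^ (j - k))%C) j =
    (Cpower v (- a)%C * (shift_coef a d (RtoC p) j * (/ v) ^ j))%C).
  { intros j.
    transitivity (Cpower v (- a)%C * (/ v) ^ j * shift_coef a d (RtoC p) j)%C; [|cring].
    unfold shift_coef; rewrite <- sum_n_C_scal; apply sum_n_C_ext; intros k Hk.
    unfold VF_coef; replace (k + (j - k))%nat with j by lia.
    rewrite Cpow_inv by auto; ring. }
  rewrite (CSeries_ext _ _ E).
  apply CSeries_scal.
  apply ex_series_ext with (fun j => Cmod (/ Cpower v (- a)%C *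
    sum_n (fun k => (VF_coef a d v k (j - k) * RtoC p ^ (j - k))%C) j)).
  { intros j; rewrite E; f_equal; field; apply Cpower_neq_0. }
  apply csummable_scal.
  set (u := fun k m => (VF_coef a d v k m * RtoC p ^ m)%C).
  apply csummable_le with (fun j => sum_n (fun k => Cmod (u k (j - k)%nat)) j).
  { intros j; apply (sum_n_Cmod_le (fun k => u k (j - k)%nat)). }
  apply ex_series_pos_bounded with B.
  - intros j; apply sum_n_nonneg; intros; apply Cmod_ge_0.
  - intros N.
    apply Rle_trans with (2 := HB N N).
    set (g := fun k m => Cmod (VF_coef a d v k m) * p ^ m).
    change (sum_n (fun j => sum_n (fun k => Cmod (u k (j - k)%nat)) j) N <=
      sum_n (fun k => sum_n (g k) N) N).
    assert (Hg : forall k m, Cmod (u k m) = g k m).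
    { intros k m; unfold u, g; rewrite Cmod_mult, Cmod_pow, Hmp; auto. }
    clearbody g; clear E.
    assert (Hg0 : forall k m, 0 <= g k m) by (intros; rewrite <- Hg; apply Cmod_ge_0).
    rewrite (sum_n_ext (fun j => sum_n (fun k => Cmod (u k (j - k)%nat)) j)
      (fun j => sum_n (fun k => g k (j - k)%nat) j)) by (intros; apply sum_n_ext; intros; apply Hg).
    assert (Htri : forall N, sum_n (fun j => sum_n (fun k => g k (j - k)%nat) j) N =
      sum_n (fun k => sum_n (g k) (N - k)) N).
    { induction N0 as [|N0 IH]; [rewrite !sum_O; reflexivity|].
      rewrite !sum_n_R_S, IH, Nat.sub_diag, sum_O, <- Rplus_assoc; f_equal.
      rewrite <- (sum_n_plus (G := R_AbelianMonoid)); apply sum_n_ext_loc; intros k Hk.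
      replace (S N0 - k)%nat with (S (N0 - k)) by lia; rewrite sum_n_R_S; reflexivity. }
    rewrite Htri; apply sum_n_le; intros k Hk.
    apply sum_n_mono; [lia|auto].
Qed.

(** * The hypergeometric equation on the negative axis *)

Definition gauss_coef (a b c : C) (n : nat) : C :=
  (poch a n * poch b n / poch c n * / Cfact n)%C.

(** The coefficients of the solution with exponent [a] at infinity, expanded at [p = 0]
    and at [p = 1]. *)
Definition inf_coef (a b c : C) (n : nat) : C :=
  (poch a n / poch (1 - b + a) n *
    ((- RtoC 1) ^ n * rf (1 - c + a) n))%C.

Definition one_coef (a b c : C) (n : nat) : C :=
  (poch a n / poch (1 - b + a) n * rf (c - b) n)%C.

Lemma is_int_opp a b : ~ is_int (a - b) -> ~ is_int (b - a).
Proof.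
  intros H [k Hk]; apply H; exists (- k)%Z; rewrite opp_IZR, RtoC_opp, <- Hk; ring.
Qed.

Lemma not_is_int_exponent a b : ~ is_int (a - b) ->
  ~ nonpos_int (1 - b + a).
Proof.
  intros H [n Hn]; apply H; exists (- Z.of_nat (S n))%Z.
  rewrite opp_IZR, <- INR_IZR_INZ, S_INR.
  replace (a - b)%C with (1 - b + a - 1)%C by ring.
  rewrite Hn, <- RtoC_minus; f_equal; ring.
Qed.

Lemma not_is_int_neq a b : ~ is_int (a - b) -> (b - a)%C <> RtoC 0.
Proof.
  intros H E; apply (is_int_opp _ _ H); exists 0%Z; exact E.
Qed.

Lemma nonpos_int_succ c : ~ nonpos_int c -> ~ nonpos_int (c + 1).
Proof.
  intros H [n Hn]; apply H; exists (S n).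
  replace c with (c + 1 - 1)%C by ring.
  rewrite Hn, <- RtoC_minus, S_INR; f_equal; ring.
Qed.

Lemma rate_gauss_coef a b c : ~ nonpos_int c -> rate (gauss_coef a b c) 1.
Proof.
  intros Hc; apply rate_ext with (fun n => (poch a n / poch c n * rf b n)%C).
  - intros n; unfold gauss_coef, rf; field; split; [apply Cfact_neq_0|now apply poch_neq_0].
  - apply rate_mult1; [lra|now apply rate_poch_ratio|apply rate_rf].
Qed.

Lemma rate_one_coef a b c : ~ is_int (a - b) -> rate (one_coef a b c) 1.
Proof.
  intros H; apply rate_mult1; [lra|now apply rate_poch_ratio, not_is_int_exponent|apply rate_rf].
Qed.

Lemma rate_affine_mult x d rho : 0 <= rho -> rate d rho ->
  rate (fun k => ((x + INR k) * d k)%C) rho.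
Proof.
  intros H0 H; apply rate_ext with (fun k => (d k * (x + INR k))%C); [intros; ring|].
  apply rate_mult1; auto; apply rate_INR_plus.
Qed.

Lemma rate_scal x d rho : 0 <= rho -> rate d rho -> rate (fun k => (x * d k)%C) rho.
Proof.
  intros H0 H; apply rate_ext with (fun k => (d k * x)%C); [intros; ring|].
  apply rate_mult1; auto; apply rate_const.
Qed.

Lemma rate_plus u v rho : 0 <= rho -> rate u rho -> rate v rho ->
  rate (fun k => (u k + v k)%C) rho.
Proof.
  intros H0 Hu Hv r Hr; destruct (Hu r Hr) as [K HK]; destruct (Hv r Hr) as [L HL].
  exists (K + L); intros n; apply Rle_trans with (1 := Cmod_triangle _ _).
  specialize (HK n); specialize (HL n); lra.
Qed.

(** The hypergeometric equation. The derivatives are carried as functions [y1] and [y2] because they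
    are again explicit series. *)
Definition solves (a b c : C) (y y1 y2 : R -> C) (z : R) : Prop :=
  dRC y z (y1 z) /\ dRC y1 z (y2 z) /\
  (RtoC (z * (1 - z)) * y2 z)%C =
  (a * b * y z -
    (c - (a + b + 1) * RtoC z) * y1 z)%C.

(** Coefficientwise the equation is (k+1)(c+k) g_(k+1) = (a+k)(b+k) g_k. *)
Lemma gauss_solves a b c z : ~ nonpos_int c -> -1 < z < 1 ->
  solves a b c (fun t => hC (gauss_coef a b c) (RtoC t))
    (fun t => hC (dS (gauss_coef a b c)) (RtoC t))
    (fun t => hC (dS (dS (gauss_coef a b c))) (RtoC t)) z.
Proof.
  intros Hc Hz; set (g := gauss_coef a b c).
  assert (Hg : rate g 1) by now apply rate_gauss_coef.
  assert (H1 : 0 <= 1) by lra.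
  assert (Hg1 := rate_dS g 1 H1 Hg); assert (Hg2 := rate_dS _ 1 H1 Hg1).
  assert (Hz1 : 1 * Rabs z < 1) by (rewrite Rmult_1_l; apply Rabs_def1; lra).
  assert (HzC : 1 * Cmod (RtoC z) < 1) by now rewrite Cmod_R.
  split; [now apply dRC_hC with 1|split; [now apply dRC_hC with 1|]].
  cbv beta.
  assert (E1 : hC (fun k => (INR k * g k)%C) (RtoC z) = (RtoC z * hC (dS g) (RtoC z))%C)
    by (apply hC_theta with 1; auto).
  assert (E2 : hC (fun k => (INR k * dS g k)%C) (RtoC z) =
    (RtoC z * hC (dS (dS g)) (RtoC z))%C) by (apply hC_theta with 1; auto).
  (* The coefficients of z^2 F''. *)
  set (e := fun k => ((INR k - 1) * (INR k * g k))%C).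
  assert (He : rate e 1).
  { apply rate_ext with (fun k => ((- RtoC 1 + INR k) * (INR k * g k))%C).
    - intros k; unfold e; ring.
    - apply rate_affine_mult, rate_INR_mult; auto. }
  assert (E3 : hC e (RtoC z) = (RtoC z * RtoC z * hC (dS (dS g)) (RtoC z))%C).
  { rewrite (hC_step e 1) by auto.
    rewrite (hC_ext (fun k => e (S k)) (fun k => (INR k * dS g k)%C)).
    - rewrite E2; unfold e; change (INR 0) with 0; ring.
    - intros k; unfold e, dS; rewrite RtoC_INR_S; ring. }
  set (F := hC g (RtoC z)) in *; set (F1 := hC (dS g) (RtoC z)) in *;
    set (F2 := hC (dS (dS g)) (RtoC z)) in *.
  assert (EL : hC (fun k => (INR k * dS g k + c * dS g k)%C) (RtoC z) =
    (RtoC z * F2 + c * F1)%C).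
  { rewrite (hC_plus _ _ 1), E2, (hC_scal c _ 1); auto using rate_INR_mult, rate_scal. }
  assert (ER : hC (fun k => (e k + ((a + b + 1) * (INR k * g k) +
      a * b * g k))%C) (RtoC z) =
    (RtoC z * RtoC z * F2 +
      ((a + b + 1) * (RtoC z * F1) + a * b * F))%C).
  { rewrite (hC_plus _ _ 1), E3, (hC_plus _ _ 1), !(hC_scal _ _ 1), E1;
      auto using rate_INR_mult, rate_scal, rate_plus. }
  assert (E : (RtoC z * F2 + c * F1)%C =
    (RtoC z * RtoC z * F2 +
      ((a + b + 1) * (RtoC z * F1) + a * b * F))%C).
  { rewrite <- EL, <- ER; apply hC_ext; intros k; unfold dS, e, g, gauss_coef.
    rewrite Cfact_S; simpl poch; rewrite RtoC_INR_S; field.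
    rewrite <- RtoC_INR_S; auto using Cfact_neq_0, INR_S_neq_0, poch_neq_0, Cplus_INR_neq_0. }
  rewrite RtoC_mult, RtoC_minus.
  transitivity (RtoC z * F2 + c * F1 -
    (RtoC z * RtoC z * F2 +
      ((a + b + 1) * (RtoC z * F1) + a * b * F)) +
    (a * b * F -
    (c - (a + b + 1) * RtoC z) * F1))%C; [ring|].
  rewrite E; ring.
Qed.

(** Differentiating (p-z)^(-(a+k)) gives (a+k)(p-z)^(-(a+1+k)): the derivative of [VF a d] is
    [VF (a + 1) (expo a d)], without a shift of the index. *)
Definition expo (a : C) (d : nat -> C) (k : nat) : C := ((a + INR k) * d k)%C.

Lemma VF_one_real a d z : z < 0 ->
  VF a d (RtoC 1) (RtoC z) =
  (Cpower (RtoC (1 - z)) (- a)%C * hC d (RtoC (/ (1 - z))))%C.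
Proof. intros Hz; unfold VF; rewrite <- RtoC_minus, <- RtoC_inv by lra; reflexivity. Qed.

Lemma one_plus_range z : z < 0 -> 0 < / (1 - z) < 1.
Proof.
  intros Hz; split; [apply Rinv_0_lt_compat; lra|].
  rewrite <- Rinv_1; apply Rinv_lt_contravar; lra.
Qed.

Lemma dRC_VF_one a d z : rate d 1 -> z < 0 ->
  dRC (fun t => VF a d (RtoC 1) (RtoC t)) z (VF (a + 1)%C (expo a d) (RtoC 1) (RtoC z)).
Proof.
  intros Hd Hz.
  assert (Hs := one_plus_range z Hz).
  apply dRC_ext_loc with (fun t => (Cpower (RtoC (1 - t)) (- a)%C * hC d (RtoC (/ (1 - t))))%C).
  { assert (Hloc : locally z (fun t => t < 0)) by (apply (open_lt 0), Hz).
    apply filter_imp with (2 := Hloc); intros t Ht; now rewrite VF_one_real. }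
  rewrite VF_one_real by auto.
  assert (Hv : dRC (fun t => RtoC (1 - t)) z (- RtoC 1)%C).
  { apply dRC_ext with (fun t => (1 - RtoC t)%C); [intros; now rewrite RtoC_minus|].
    eapply dRC_eq; [apply dRC_minus; [apply dRC_const|apply dRC_id]|ring]. }
  assert (Hi : is_derive (fun t => / (1 - t)) z (/ (1 - z) * / (1 - z))).
  { auto_derive; [lra|field; lra]. }
  assert (Hsm : 1 * Rabs (/ (1 - z)) < 1) by (rewrite Rabs_pos_eq; lra).
  assert (Hsc : 1 * Cmod (RtoC (/ (1 - z))) < 1) by now rewrite Cmod_R.
  assert (Hn : RtoC (1 - z) <> 0) by (apply RtoC_neq_0; lra).
  eapply dRC_eq.
  - apply dRC_mult.
    + apply dRC_Cpower; [exact Hv|apply offcut_pos; lra].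
    + apply (dRC_comp (fun s => hC d (RtoC s)) (fun t => / (1 - t)) z); [|exact Hi].
      apply dRC_hC with 1; auto; lra.
  - cbv beta.
    assert (E : hC (expo a d) (RtoC (/ (1 - z))) =
      (a * hC d (RtoC (/ (1 - z))) +
        RtoC (/ (1 - z)) * hC (dS d) (RtoC (/ (1 - z))))%C).
    { rewrite <- (hC_theta d 1), <- (hC_scal a d 1) by (auto; lra).
      rewrite <- (hC_plus _ _ 1) by (auto using rate_scal, rate_INR_mult, Rle_0_1).
      apply hC_ext; intros k; unfold expo; ring. }
    rewrite E.
    replace (- (a + 1))%C with (- (a + INR 1))%C by (simpl; ring).
    rewrite Cpower_opp_plus_INR, Cpow_1_r by auto.
    rewrite RtoC_mult, RtoC_inv by lra; field; auto.
Qed.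

Lemma rate_expo a d rho : 0 <= rho -> rate d rho -> rate (expo a d) rho.
Proof. apply rate_affine_mult. Qed.

Lemma hC_lift d e rho z : 0 <= rho -> rate d rho -> rate e rho -> rho * Cmod z < 1 ->
  d O = 0 -> (forall k, d (S k) = e k) -> hC d z = (z * hC e z)%C.
Proof.
  intros H0 Hd He Hz Hd0 HdS; rewrite (hC_step d rho), Hd0, (hC_ext _ _ z HdS) by auto; ring.
Qed.

Lemma VF_one_solves a b c z : ~ is_int (a - b) -> z < 0 ->
  solves a b c (fun t => VF a (one_coef a b c) (RtoC 1) (RtoC t))
    (fun t => VF (a + 1)%C (expo a (one_coef a b c)) (RtoC 1) (RtoC t))
    (fun t => VF (a + 1 + 1)%C
       (expo (a + 1)%C (expo a (one_coef a b c))) (RtoC 1) (RtoC t)) z.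
Proof.
  intros Hab Hz; set (d := one_coef a b c).
  assert (Hd : rate d 1) by now apply rate_one_coef.
  assert (H1 : 0 <= 1) by lra.
  assert (Hd1 := rate_expo a d 1 H1 Hd).
  assert (Hd2 := rate_expo (a + 1)%C _ 1 H1 Hd1).
  split; [now apply dRC_VF_one|split; [now apply dRC_VF_one|]].
  cbv beta; rewrite !VF_one_real by auto.
  assert (Hs := one_plus_range z Hz); set (s := / (1 - z)) in *.
  (* In the variable s = 1/(1-z) the equation becomes an identity between power series in s. *)
  assert (Ez : z = 1 - / s) by (unfold s; field; lra).
  clearbody s; subst z; replace (1 - (1 - / s)) with (/ s) by ring.
  assert (Hn : RtoC (/ s) <> 0) by (apply RtoC_neq_0, Rinv_neq_0_compat; lra).
  replace (- (a + 1 + 1))%C with (- (a + INR 2))%C.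
  2:{ simpl; rewrite RtoC_plus; ring. }
  replace (- (a + 1))%C with (- (a + INR 1))%C by (simpl; ring).
  rewrite !Cpower_opp_plus_INR by auto.
  set (P := Cpower _ _).
  assert (Hsc : 1 * Cmod (RtoC s) < 1) by (rewrite Cmod_R, Rabs_pos_eq; lra).
  set (H0 := hC d (RtoC s)); set (HH1 := hC (expo a d) (RtoC s));
    set (HH2 := hC (expo (a + 1)%C (expo a d)) (RtoC s)).
  assert (Hs0 : RtoC s <> 0) by (apply RtoC_neq_0; lra).
  assert (Hg := not_is_int_exponent a b Hab).
  (* Coefficientwise this is the two-term recurrence for [d]. *)
  assert (E : (HH2 + a * b * H0 - (a + b + 1) * HH1)%C =
    (RtoC s * (HH2 + (c - a - b - 1) * HH1))%C).
  { transitivity (hC (fun k => (expo (a + 1)%C (expo a d) k +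
        a * b * d k + - (a + b + 1) * expo a d k)%C) (RtoC s)).
    { rewrite !(hC_plus _ _ 1), (hC_scal _ d 1), (hC_scal _ (expo a d) 1);
        auto using rate_scal, rate_plus; unfold H0, HH1, HH2; ring. }
    transitivity (RtoC s * hC (fun k => (expo (a + 1)%C (expo a d) k +
        (c - a - b - 1) * expo a d k)%C) (RtoC s))%C.
    - apply hC_lift with 1; auto using rate_scal, rate_plus.
      + unfold expo, d, one_coef; change (INR 0) with 0; simpl poch; rewrite rf_0; field; exact
        C1_nz.
      + intros k; unfold expo, d, one_coef, rf; rewrite Cfact_S; simpl poch; rewrite RtoC_INR_S.
        field; rewrite <- RtoC_INR_S; repeat split;
          auto using Cfact_neq_0, INR_S_neq_0, poch_neq_0, Cplus_INR_neq_0.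
    - rewrite (hC_plus _ _ 1), (hC_scal _ (expo a d) 1); auto using rate_scal, rate_plus. }
  rewrite !RtoC_mult, !RtoC_minus, !RtoC_inv by (auto; lra).
  simpl Cpow; rewrite !Cmult_1_r, <- RtoC_inv by lra.
  rewrite !RtoC_inv by lra.
  assert (E' : HH2 = (RtoC s * (HH2 + (c - a - b - 1) * HH1) +
    (a + b + 1) * HH1 + - (a * b * H0))%C) by (rewrite <- E; ring).
  transitivity (P * (RtoC s * HH2 - HH2))%C; [field; auto|].
  rewrite E' at 2; field; auto.
Qed.

(** * The connection formula on the negative axis *)

(** The weight is the reciprocal of the factor in Abel's formula for the hypergeometric equation, so
    the weighted Wronskian of two solutions has derivative 0. On the negative axis both bases are
    positive. *)
Definition wronskian (a b c : C) (y1 y1' y2 y2' : R -> C) (z : R) : C :=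
  (Cpower (RtoC (- z)) c *
               Cpower (RtoC (1 - z)) (a + b + 1 - c)%C *
        (y1 z * y2' z - y1' z * y2 z))%C.

Lemma dRC_RtoC_affine p q t : dRC (fun s => RtoC (p + q * s)) t (RtoC q).
Proof.
  split; [|apply (is_derive_const (V := R_NormedModule) 0)].
  simpl; auto_derive; auto; ring.
Qed.

Lemma wronskian_derivative a b c y1 y1' y1'' y2 y2' y2'' z : z < 0 ->
  solves a b c y1 y1' y1'' z -> solves a b c y2 y2' y2'' z ->
  dRC (wronskian a b c y1 y1' y2 y2') z (RtoC 0).
Proof.
  intros Hz [D1 [D1' O1]] [D2 [D2' O2]].
  assert (Hn1 : RtoC (- z) <> 0) by (apply RtoC_neq_0; lra).
  assert (Hn2 : RtoC (1 - z) <> 0) by (apply RtoC_neq_0; lra).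
  assert (Hd1 : dRC (fun s => RtoC (- s)) z (- RtoC 1)%C).
  { rewrite <- RtoC_opp; apply dRC_ext with (fun s => RtoC (0 + - (1) * s)); [intros; f_equal;
    ring|].
    apply dRC_RtoC_affine. }
  assert (Hd2 : dRC (fun s => RtoC (1 - s)) z (- RtoC 1)%C).
  { rewrite <- RtoC_opp; apply dRC_ext with (fun s => RtoC (1 + - (1) * s)); [intros; f_equal;
    ring|].
    apply dRC_RtoC_affine. }
  unfold wronskian; eapply dRC_eq.
  - apply dRC_mult.
    + apply dRC_mult; apply dRC_Cpower; [exact Hd1|apply offcut_pos; lra|exact Hd2|apply
      offcut_pos; lra].
    + apply dRC_minus; apply dRC_mult; [exact D1|exact D2'|exact D1'|exact D2].
  - cbv beta.
    set (e := (a + b + 1 - c)%C).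
    set (P := Cpower (RtoC (- z)) c); set (Q := Cpower (RtoC (1 - z)) e).
    rewrite RtoC_mult in O1, O2.
    assert (En : RtoC z = (- RtoC (- z))%C) by (rewrite RtoC_opp; ring).
    assert (E2 : RtoC (1 - z) = (1 + RtoC (- z))%C) by (rewrite RtoC_minus, RtoC_opp; ring).
    rewrite En in O1, O2; rewrite E2 in *.
    set (u := RtoC (- z)) in *.
    assert (Eq : forall k X Y : C, k <> 0 -> (k * X)%C = Y -> X = (Y / k)%C).
    { intros k X Y Hk <-; field; auto. }
    assert (Hk : (- u * (1 + u))%C <> 0).
    { apply Cmult_neq_0; auto; intros E; apply Hn1.
      replace u with (- (- u))%C by ring; rewrite E; ring. }
    apply Eq in O1; auto; apply Eq in O2; auto; rewrite O1, O2.
    unfold e; field; auto.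
Qed.

Lemma wronskian_constant a b c y1 y1' y1'' y2 y2' y2'' l :
  (forall z, l < z < 0 -> solves a b c y1 y1' y1'' z) ->
  (forall z, l < z < 0 -> solves a b c y2 y2' y2'' z) ->
  forall z1 z2, l < z1 < 0 -> l < z2 < 0 ->
  wronskian a b c y1 y1' y2 y2' z1 = wronskian a b c y1 y1' y2 y2' z2.
Proof.
  intros H1 H2.
  assert (H : forall z1 z2, l < z1 -> z1 < z2 -> z2 < 0 ->
    wronskian a b c y1 y1' y2 y2' z1 = wronskian a b c y1 y1' y2 y2' z2).
  { intros z1 z2 Hl Hlt Hu; apply dRC_zero_const; auto; intros t Ht.
    apply wronskian_derivative with y1'' y2''; [lra|apply H1; lra|apply H2; lra]. }
  intros z1 z2 Hz1 Hz2; destruct (Rtotal_order z1 z2) as [h|[->|h]]; auto.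
  - apply H; lra.
  - symmetry; apply H; lra.
Qed.

Lemma Clim_dRC f t l (s : nat -> R) : dRC f t l -> is_lim_seq s t -> Clim (fun n => f (s n)) (f t).
Proof.
  intros [H1 H2] Hs eps Heps.
  destruct (path_continuous_Cmod f t eps Heps) as [d [Hd Hd']].
  - apply (ex_derive_continuous (V := R_NormedModule)); eexists; exact H1.
  - apply (ex_derive_continuous (V := R_NormedModule)); eexists; exact H2.
  - apply is_lim_seq_spec in Hs; destruct (Hs (mkposreal d Hd)) as [N HN].
    exists N; intros n Hn; apply Hd', HN, Hn.
Qed.

Lemma Clim_eq u l l' : Clim u l -> l = l' -> Clim u l'.
Proof. now intros H <-. Qed.

Lemma Clim_minus u v l m : Clim u l -> Clim v m -> Clim (fun n => (u n - v n)%C) (l - m)%C.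
Proof.
  intros Hu Hv.
  apply Clim_ext_loc with (fun n => (u n + - RtoC 1 * v n)%C) O; [intros; ring|].
  eapply Clim_eq; [apply Clim_plus; [exact Hu|apply Clim_scal, Hv]|ring].
Qed.

Lemma is_lim_seq_inv_INR : is_lim_seq (fun n => / (INR n + 2)) 0.
Proof.
  apply (is_lim_seq_spec _ (Finite 0)); intros eps.
  destruct (nfloor_ex (/ eps)) as [N [_ HN]]; [apply Rlt_le, Rinv_0_lt_compat, cond_pos|].
  exists N; intros n Hn; apply le_INR in Hn; rewrite Rminus_0_r.
  assert (0 < / eps) by apply Rinv_0_lt_compat, cond_pos.
  assert (Hp := cond_pos eps).
  rewrite Rabs_pos_eq by (apply Rlt_le, Rinv_0_lt_compat; lra).
  rewrite <- (Rinv_inv eps); apply Rinv_lt_contravar; nra.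
Qed.

Lemma hC_0 d : rate d 1 -> hC d (RtoC 0) = d O.
Proof.
  intros H; rewrite (hC_step d 1); auto; [ring|lra|rewrite Cmod_0; lra].
Qed.

Lemma Cpower_1_l w : Cpower (RtoC 1) w = RtoC 1.
Proof.
  unfold Cpower; rewrite Clog_pos, ln_1 by lra.
  replace (w * 0)%C with (RtoC 0) by ring; apply Cexp_0.
Qed.

(** In the variable [s = 1 / (1 - z)] the weighted Wronskian is continuous up to [s = 0],
    that is [z = -oo]. *)
Lemma wronskian_VF a b c z : ~ is_int (a - b) -> z < 0 ->
  wronskian a b c
    (fun t => VF a (one_coef a b c) (RtoC 1) (RtoC t))
    (fun t => VF (a + 1)%C (expo a (one_coef a b c)) (RtoC 1) (RtoC t))
    (fun t => VF b (one_coef b a c) (RtoC 1) (RtoC t))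
    (fun t => VF (b + 1)%C (expo b (one_coef b a c)) (RtoC 1) (RtoC t)) z =
  (b - a)%C.
Proof.
  intros Hab Hz0; assert (Hba := is_int_opp a b Hab).
  assert (Hr1 : rate (one_coef a b c) 1) by now apply rate_one_coef.
  assert (Hr2 : rate (one_coef b a c) 1) by now apply rate_one_coef.
  set (da := one_coef a b c) in *; set (db := one_coef b a c) in *.
  (* Substituting -z = (1-s)/s and 1-z = 1/s, the powers of 1/s have total exponent c + (a+b+1-c) -
     a - (b+1) = 0; only (1-s)^c remains, which is regular at s = 0. *)
  set (Phi := fun s => (Cpower (RtoC (1 + - (1) * s)) c *
    (hC da (RtoC s) * hC (expo b db) (RtoC s) -
            hC (expo a da) (RtoC s) * hC db (RtoC s)))%C).
  set (W := wronskian _ _ _ _ _ _ _).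
  assert (HW : forall z, z < 0 -> W z = Phi (/ (1 - z))).
  { intros t Ht; unfold W, wronskian, Phi; rewrite !VF_one_real by auto.
    assert (Hs := one_plus_range t Ht); set (s := / (1 - t)) in *.
    assert (Et : t = 1 - / s) by (unfold s; field; lra).
    clearbody s; subst t; replace (1 - (1 - / s)) with (/ s) by ring.
    replace (- (1 - / s)) with (/ s * (1 + - (1) * s)) by (field; lra).
    assert (Hi : 0 < / s) by (apply Rinv_0_lt_compat; lra).
    rewrite Cpower_pos_mult by (auto; lra).
    assert (Hn : RtoC (/ s) <> 0) by (apply RtoC_neq_0; lra).
    assert (Hp := Cpower_1 _ Hn).
    set (Y := RtoC (/ s)) in *.
    replace (- (a + 1))%C with (- a + - RtoC 1)%C by ring.
    replace (- (b + 1))%C with (- b + - RtoC 1)%C by ring.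
    replace (a + b + 1 - c)%C with
      (a + b + 1 + - c)%C by ring.
    rewrite !Cpower_plus, !Cpower_opp, Hp.
    field; repeat split; auto using Cpower_neq_0. }
  assert (Hc : forall z1 z2, z1 < 0 -> z2 < 0 -> W z1 = W z2).
  { intros z1 z2 h1 h2.
    assert (Hl : Rmin z1 z2 - 1 < z1 /\ Rmin z1 z2 - 1 < z2).
    { assert (t1 := Rmin_l z1 z2); assert (t2 := Rmin_r z1 z2); lra. }
    eapply (wronskian_constant a b c _ _ _ _ _ _ (Rmin z1 z2 - 1)); try lra.
    - intros t Ht; apply VF_one_solves; auto; lra.
    - intros t Ht.
      assert (Hs := VF_one_solves b a c t Hba ltac:(lra)).
      destruct Hs as [h3 [h4 h5]]; split; [exact h3|split; [exact h4|]].
      cbv beta in h5 |- *; rewrite h5; fold db; ring. }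
  assert (HPhi : exists l, dRC Phi 0 l).
  { eexists; unfold Phi.
    assert (Hz : 1 * Rabs 0 < 1) by (rewrite Rabs_R0; lra).
    assert (Hra := rate_expo a da 1 Rle_0_1 Hr1).
    assert (Hrb := rate_expo b db 1 Rle_0_1 Hr2).
    apply dRC_mult; [apply dRC_Cpower; [apply dRC_RtoC_affine|apply offcut_pos; lra]|].
    apply dRC_minus; apply dRC_mult; apply dRC_hC with 1; auto using Rle_0_1. }
  destruct HPhi as [l Hl].
  assert (HL := Clim_dRC Phi 0 l _ Hl is_lim_seq_inv_INR).
  assert (E0 : Phi 0 = (b - a)%C).
  { unfold Phi; rewrite !hC_0 by (auto using rate_expo, Rle_0_1).
    replace (1 + - (1) * 0) with 1 by ring; rewrite Cpower_1_l.
    unfold expo, da, db, one_coef; simpl poch; change (INR 0) with 0; rewrite !rf_0.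
    field; exact C1_nz. }
  rewrite <- E0; apply Clim_unique with (2 := HL).
  apply Clim_ext_loc with (fun _ => W z) O; [|apply Clim_const].
  intros n _; assert (hn := pos_INR n).
  (* The point z = -(n+1) corresponds to s = 1/(n+2). *)
  rewrite (Hc z (- (INR n + 1))) by (auto; lra).
  rewrite HW by lra; f_equal; f_equal; ring.
Qed.

(** The Gauss products of c and of Re c have a bounded quotient, and their powers of n have equal
    modulus. A complex binomial series is thereby dominated by one with positive terms. *)
Lemma rf_le_Re c : 0 < Re c ->
  exists K, 0 <= K /\ forall n, Cmod (rf c n) <= K * Cmod (rf (RtoC (Re c)) n).
Proof.
  intros Hc; set (s := RtoC (Re c)).
  assert (Hs : ~ nonpos_int s).
  { intros [n Hn]; apply RtoC_inj in Hn; assert (h := pos_INR n); lra. }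
  assert (Hlim := Clim_mult _ _ _ _ (rGamma_lim c) (Clim_inv _ _ (rGamma_neq_0 s Hs) (rGamma_lim
    s))).
  destruct (Clim_bounded _ _ Hlim) as [M [HM0 HM]].
  assert (Hpoch : exists K, 0 <= K /\ forall n, Cmod (poch c n) <= K * Cmod (poch s n)).
  { exists (M + 1 + Cmod c / Re c).
    assert (Hq : 0 <= Cmod c / Re c).
    { apply Rmult_le_pos; [apply Cmod_ge_0|apply Rlt_le, Rinv_0_lt_compat; auto]. }
    split; [lra|]; intros [|[|n]].
    - simpl; rewrite Cmod_1; lra.
    - simpl; rewrite !Cmult_1_l, !Cplus_0_r; unfold s at 1; rewrite Cmod_R, Rabs_pos_eq by lra.
      assert (Cmod c / Re c * Re c = Cmod c) by (field; lra).
      assert (h := Cmod_ge_0 c); nra.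
    - specialize (HM (S n)); unfold gauss_prod in HM.
      assert (Hp : 0 < INR (S n)) by (apply lt_0_INR; lia).
      assert (Hn1 : (Cfact (S n) * Cpower (RtoC (INR (S n))) c)%C <> 0)
        by (apply Cmult_neq_0; [apply Cfact_neq_0|apply Cpower_neq_0]).
      assert (Hn2 : (Cfact (S n) * Cpower (RtoC (INR (S n))) s)%C <> 0)
        by (apply Cmult_neq_0; [apply Cfact_neq_0|apply Cpower_neq_0]).
      assert (Hps : poch s (S (S n)) <> 0) by now apply poch_neq_0.
      replace (poch c (S (S n)) / (Cfact (S n) * Cpower (RtoC (INR (S n))) c) *
        / (poch s (S (S n)) / (Cfact (S n) * Cpower (RtoC (INR (S n))) s)))%C
        with (poch c (S (S n)) / poch s (S (S n)) *
           (Cpower (RtoC (INR (S n))) s / Cpower (RtoC (INR (S n))) c))%C in HM.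
      2:{ field; repeat split; auto using Cfact_neq_0, Cpower_neq_0. }
      rewrite Cmod_mult, !Cmod_div in HM by auto using Cpower_neq_0.
      rewrite !Cmod_Cpower_pos in HM by auto.
      unfold s in HM at 2; rewrite re_RtoC in HM.
      assert (Hpow : 0 < Rpower (INR (S n)) (Re c)) by apply exp_pos.
      unfold Rdiv at 2 in HM; rewrite Rinv_r, Rmult_1_r in HM by lra.
      assert (Hps0 : 0 < Cmod (poch s (S (S n)))) by now apply Cmod_gt_0.
      apply (Rmult_le_compat_r (Cmod (poch s (S (S n))))) in HM; [|lra].
      unfold Rdiv in HM; rewrite Rmult_assoc, Rinv_l, Rmult_1_r in HM by lra.
      nra. }
  destruct Hpoch as [K [HK0 HK]]; exists K; split; auto; intros n.
  unfold rf; rewrite !Cmod_div by apply Cfact_neq_0.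
  unfold Rdiv; rewrite <- Rmult_assoc; apply Rmult_le_compat_r; auto.
  apply Rlt_le, Rinv_0_lt_compat, Cmod_gt_0, Cfact_neq_0.
Qed.

(** An Abelian theorem: comparison with the binomial series of [(1 - s)^(-c)]. *)
Lemma abel_comparison c (x : nat -> C) (r : nat -> C) L : 0 < Re c ->
  (forall n, x n = (r n * rf c n)%C) -> Clim r L -> rate x 1 ->
  forall s : nat -> R, (forall n, 0 < s n < 1) -> is_lim_seq s 1 ->
  Clim (fun n => (Cpower (RtoC (1 - s n)) c * hC x (RtoC (s n)))%C) L.
Proof.
  intros Hc Hx Hr Hrate s Hs Hslim eps Heps.
  destruct (rf_le_Re c Hc) as [K [HK0 HK]].
  set (sig := Re c) in *.
  set (y := fun n => ((r n - L) * rf c n)%C).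
  assert (Hy : rate y 1).
  { apply rate_ext with (fun n => (x n + - L * rf c n)%C).
    - intros n; unfold y; rewrite Hx; ring.
    - apply rate_plus; [lra|auto|apply rate_scal; [lra|apply rate_rf]]. }
  (* From the index [N] on the ratio is within e of L, so the tail is at most e K (1-t)^(-Re c),
     with e K <= eps/2. *)
  set (e := eps / 2 / (K + 1)).
  assert (He : 0 < e) by (apply Rdiv_lt_0_compat; lra).
  destruct (Hr e He) as [N HN].
  set (H := sum_n (fun n => Cmod (y n)) N).
  assert (HH : 0 <= H) by (apply sum_n_nonneg; intros; apply Cmod_ge_0).
  assert (Hb : forall t, 0 < t < 1 -> Cmod (hC y (RtoC t)) <= H + e * K * Rpower (1 - t) (- sig)).
  { intros t Ht.
    assert (Hsum : csummable (fun k => (y k * RtoC t ^ k)%C)).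
    { apply rate_summable with 1; auto; [lra|rewrite Cmod_R, Rabs_pos_eq; lra]. }
    replace (hC y (RtoC t)) with (hC y (RtoC t) - 0)%C by ring.
    apply Cmod_limit_le with (1 := csum_correct _ Hsum) (K := O); intros P _.
    replace (sum_n (fun k => (y k * RtoC t ^ k)%C) P - 0)%C
      with (sum_n (fun k => (y k * RtoC t ^ k)%C) P) by cring.
    apply Rle_trans with (1 := sum_n_Cmod_le _ P).
    set (h1 := fun n => if (n <=? N)%nat then Cmod (y n) else 0).
    set (h2 := fun n => e * K * (Cmod (rf (RtoC sig) n) * t ^ n)).
    apply Rle_trans with (sum_n (fun n => h1 n + h2 n) P).
    { apply sum_n_le; intros n _; rewrite Cmod_mult, Cmod_pow, Cmod_R, (Rabs_pos_eq t) by lra.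
      assert (Ht0 : 0 <= t ^ n) by (apply pow_le; lra).
      assert (Ht1 : t ^ n <= 1) by (rewrite <- (pow1 n); apply pow_incr; lra).
      assert (h2p : 0 <= h2 n).
      { unfold h2; apply Rmult_le_pos; [nra|apply Rmult_le_pos; auto; apply Cmod_ge_0]. }
      unfold h1; destruct (Nat.leb_spec n N) as [Hn|Hn].
      - assert (h := Cmod_ge_0 (y n)); nra.
      - rewrite Rplus_0_l; unfold y, h2; rewrite Cmod_mult, <- Rmult_assoc.
        apply Rmult_le_compat_r; auto.
        apply Rle_trans with (e * (K * Cmod (rf (RtoC sig) n))); [|lra].
        apply Rmult_le_compat; try apply Cmod_ge_0; auto.
        apply Rlt_le, HN; lia. }
    replace (sum_n (fun n => h1 n + h2 n) P) with (sum_n h1 P + sum_n h2 P)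
      by (symmetry; apply (sum_n_plus (G := R_AbelianMonoid))).
    apply Rplus_le_compat.
    - apply Rle_trans with (sum_n h1 (Nat.max N P)).
      + apply sum_n_mono; [lia|]; intros n; unfold h1; destruct (Nat.leb n N); [apply
        Cmod_ge_0|lra].
      + assert (Eh : forall M, (N <= M)%nat -> sum_n h1 M = H).
        { intros M HM; induction HM as [|M HM IH].
          - unfold H; apply sum_n_ext_loc; intros n Hn; unfold h1.
            destruct (Nat.leb_spec n N); [auto|lia].
          - rewrite sum_n_R_S, IH; unfold h1; destruct (Nat.leb_spec (S M) N); [lia|].
            apply Rplus_0_r. }
        rewrite Eh by lia; lra.
    - replace (sum_n h2 P) with (e * K * sum_n (fun n => Cmod (rf (RtoC sig) n) * t ^ n) P)
        by (symmetry; apply (sum_n_mult_l (K := R_Ring))).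
      apply Rmult_le_compat_l; [nra|].
      apply rf_sum_bound; [rewrite Cmod_R, Rabs_pos_eq; lra|lra]. }
  (* The head is at most [H] and gets multiplied by (1-t)^(Re c), which is below eps/2/(H+1) once
     1-t < d; this uses Re c > 0. *)
  set (d := Rpower (eps / 2 / (H + 1)) (/ sig)).
  assert (Hd : 0 < d) by apply exp_pos.
  apply is_lim_seq_spec in Hslim; destruct (Hslim (mkposreal d Hd)) as [N1 HN1]; simpl in HN1.
  exists N1; intros n Hn; specialize (HN1 n Hn); specialize (Hs n).
  set (t := s n) in *.
  assert (Hdt : 1 - t < d) by (apply Rabs_def2 in HN1; lra).
  assert (Hpw : Rpower (1 - t) sig < eps / 2 / (H + 1)).
  { replace (eps / 2 / (H + 1)) with (Rpower d sig).
    - apply Rlt_Rpower_l; lra.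
    - unfold d; rewrite Rpower_mult, Rinv_l by lra; apply Rpower_1.
      apply Rdiv_lt_0_compat; lra. }
  assert (Hp0 : 0 < Rpower (1 - t) sig) by apply exp_pos.
  assert (Bin : (Cpower (RtoC (1 - t)) c * hC (rf c) (RtoC t))%C = 1).
  { assert (B := binomial_series c (RtoC 1) (RtoC t)).
    rewrite <- RtoC_minus, Cpower_1_l, Cmult_1_l in B.
    replace (RtoC t / 1)%C with (RtoC t) in B by (field; exact C1_nz).
    rewrite <- B, Cpower_opp; [apply Cinv_r, Cpower_neq_0| |].
    - intros u Hu; rewrite <- RtoC_mult, <- RtoC_minus; apply offcut_pos; nra.
    - rewrite Cmod_R, Cmod_1, Rabs_pos_eq; lra. }
  assert (Ht1 : 1 * Cmod (RtoC t) < 1) by (rewrite Cmod_R, Rabs_pos_eq; lra).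
  assert (Ey : hC y (RtoC t) = (hC x (RtoC t) - L * hC (rf c) (RtoC t))%C).
  { transitivity (hC x (RtoC t) + - L * hC (rf c) (RtoC t))%C; [|ring].
    rewrite <- (hC_scal _ (rf c) 1), <- (hC_plus _ _ 1) by (auto using rate_rf, rate_scal, Rle_0_1).
    apply hC_ext; intros k; unfold y; rewrite Hx; ring. }
  replace (Cpower (RtoC (1 - t)) c * hC x (RtoC t) - L)%C with
    (Cpower (RtoC (1 - t)) c * hC y (RtoC t))%C.
  2:{ rewrite Ey.
      transitivity (Cpower (RtoC (1 - t)) c * hC x (RtoC t) -
        L * (Cpower (RtoC (1 - t)) c * hC (rf c) (RtoC t)))%C; [ring|].
      rewrite Bin; ring. }
  rewrite Cmod_mult, Cmod_Cpower_pos by lra; fold sig.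
  assert (Hb' := Hb t Hs).
  apply Rle_lt_trans with (Rpower (1 - t) sig * (H + e * K * Rpower (1 - t) (- sig))).
  { apply Rmult_le_compat_l; lra. }
  rewrite Rmult_plus_distr_l.
  replace (Rpower (1 - t) sig * (e * K * Rpower (1 - t) (- sig))) with (e * K).
  2:{ rewrite Rpower_Ropp; field; lra. }
  assert (e * K <= eps / 2).
  { unfold e; apply Rle_trans with (eps / 2 / (K + 1) * (K + 1)); [|right; field; lra].
    apply Rmult_le_compat_l; [|lra]; apply Rlt_le, Rdiv_lt_0_compat; lra. }
  assert (Rpower (1 - t) sig * (H + 1) < eps / 2).
  { apply (Rmult_lt_compat_r (H + 1)) in Hpw; [|lra].
    replace (eps / 2 / (H + 1) * (H + 1)) with (eps / 2) in Hpw by (field; lra); lra. }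
  nra.
Qed.

(** This is (b-a) times [ff c b a], the factor b-a having been absorbed by Gamma(1-a+b) = (b-a)
    Gamma(b-a). *)
Definition conn_limit (a b c : C) : C :=
  (rGamma b * rGamma (c - a) /
       (rGamma (1 - a + b) * rGamma c))%C.

Lemma Clim_affine_ratio x : Clim (fun n => (1 + x * / RtoC (INR n))%C) (RtoC 1).
Proof.
  eapply Clim_eq; [apply Clim_plus; [apply Clim_const|apply Clim_scal, Clim_inv_INR]|ring].
Qed.

(** A quotient of four Gauss products. The powers of n almost cancel, since (1-a+b) + c = b + (c-a)
    + 1; the additional factor b+n in the numerator makes up for the missing one. *)
Lemma poch_ratio_limit a b c :
  ~ nonpos_int (1 - a + b) -> ~ nonpos_int c ->
  Clim (fun n => (poch b (S n) * poch (c - a) n /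
                      (poch (1 - a + b) n * poch c n))%C)
       (conn_limit a b c).
Proof.
  intros HG Hc; set (G := (1 - a + b)%C) in *; set (A := (c - a)%C).
  (* c-a may be a nonpositive integer, so c-a+n is known to be nonzero only for large n. *)
  destruct (nfloor_ex (Cmod A)) as [N0 [_ HN0]]; [apply Cmod_ge_0|].
  assert (HA : forall n, (S N0 <= n)%nat -> (A + INR n)%C <> 0).
  { intros n Hn; apply Cmod_gt_0; apply Rlt_le_trans with (2 := Cmod_plus_INR_ge A n).
    apply le_INR in Hn; rewrite S_INR in Hn; lra. }
  assert (HrG := rGamma_neq_0 G HG); assert (Hrc := rGamma_neq_0 c Hc).
  set (f := fun x n => (1 + x * / RtoC (INR n))%C).
  assert (HL : Clim (fun n => (gauss_prod b n * gauss_prod A n *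
             / (gauss_prod G n * gauss_prod c n) *
      (f G n * f c n * / f A n))%C) (conn_limit a b c)).
  { eapply Clim_eq.
    - apply Clim_mult.
      + apply Clim_mult; [apply Clim_mult; apply rGamma_lim|].
        apply Clim_inv; [|apply Clim_mult; apply rGamma_lim]; now apply Cmult_neq_0.
      + apply Clim_mult; [apply Clim_mult; apply Clim_affine_ratio|].
        apply Clim_inv; [|apply Clim_affine_ratio]; exact C1_nz.
    - unfold conn_limit; fold G A; field; auto. }
  apply Clim_ext_loc with (2 := HL) (N0 := S N0).
  intros n Hn.
  assert (Hn0 : RtoC (INR n) <> 0).
  { apply RtoC_neq_0, not_0_INR; lia. }
  specialize (HA n Hn).
  assert (HGn := Cplus_INR_neq_0 G n HG); assert (Hcn := Cplus_INR_neq_0 c n Hc).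
  assert (Hpw : (Cpower (RtoC (INR n)) G * Cpower (RtoC (INR n)) c)%C =
    (Cpower (RtoC (INR n)) b * Cpower (RtoC (INR n)) A * INR n)%C).
  { rewrite <- (Cpower_1 (RtoC (INR n))) at 5 by auto.
    rewrite <- !Cpower_plus; f_equal; unfold G, A; ring. }
  assert (Hf : forall x, f x n = ((x + INR n) / INR n)%C).
  { intros x; unfold f; field; auto. }
  rewrite !Hf; unfold gauss_prod; simpl poch.
  set (XG := Cpower _ G) in *; set (Xc := Cpower _ c) in *;
    set (Xb := Cpower _ b) in *; set (XA := Cpower _ A) in *.
  assert (h1 : XG <> 0) by apply Cpower_neq_0; assert (h2 : Xc <> 0) by apply Cpower_neq_0.
  assert (h3 : Xb <> 0) by apply Cpower_neq_0; assert (h4 : XA <> 0) by apply Cpower_neq_0.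
  transitivity (poch b n * (b + INR n) * poch A n /
    (poch G n * poch c n) * (XG * Xc / (Xb * XA * INR n)))%C.
  - field; repeat split; auto using Cfact_neq_0, poch_neq_0.
  - rewrite Hpw; field; repeat split; auto using poch_neq_0.
Qed.

(** One factor b+n less than in [poch_ratio_limit], hence the limit 0. *)
Lemma poch_ratio_limit_0 a b c :
  ~ nonpos_int (1 - a + b) -> ~ nonpos_int c ->
  Clim (fun n => (poch b n * poch (c - a) n /
                      (poch (1 - a + b) n * poch c n))%C)
       (RtoC 0).
Proof.
  intros HG Hc.
  destruct (nfloor_ex (Cmod b)) as [N0 [_ HN0]]; [apply Cmod_ge_0|].
  assert (Hb : forall n, (S N0 <= n)%nat -> (b + INR n)%C <> 0).
  { intros n Hn; apply Cmod_gt_0; apply Rlt_le_trans with (2 := Cmod_plus_INR_ge b n).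
    apply le_INR in Hn; rewrite S_INR in Hn; lra. }
  set (f := fun n => (1 + b * / RtoC (INR n))%C).
  assert (HL : Clim (fun n => (poch b (S n) * poch (c - a) n /
                      (poch (1 - a + b) n * poch c n) *
      (/ RtoC (INR n) * / f n))%C) (RtoC 0)).
  { eapply Clim_eq.
    - apply Clim_mult; [now apply poch_ratio_limit|].
      apply Clim_mult; [apply Clim_inv_INR|].
      apply Clim_inv; [|apply Clim_affine_ratio]; exact C1_nz.
    - ring. }
  apply Clim_ext_loc with (2 := HL) (N0 := S N0).
  intros n Hn; specialize (Hb n Hn).
  assert (Hn0 : RtoC (INR n) <> 0) by (apply RtoC_neq_0, not_0_INR; lia).
  assert (Hf : f n = ((b + INR n) / INR n)%C) by (unfold f; field; auto).
  rewrite Hf; simpl poch; field; repeat split; auto using poch_neq_0.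
Qed.

Lemma is_lim_seq_near_1 : is_lim_seq (fun n => / (1 + / (INR n + 2))) 1.
Proof.
  assert (H : is_lim_seq (fun n => / (1 + / (INR n + 2))) (Rbar_inv (Finite (1 + 0)))).
  { apply (is_lim_seq_inv (fun n => 1 + / (INR n + 2)) (Finite (1 + 0))).
    - apply is_lim_seq_plus'; [apply is_lim_seq_const|apply is_lim_seq_inv_INR].
    - intros E; apply Rbar_finite_eq in E; lra. }
  simpl in H; now replace (/ (1 + 0)) with 1 in H by field.
Qed.

(** The value of the constant is read off at [z -> 0-]. *)
Lemma wronskian_gauss_VF a b c z : ~ is_int (a - b) -> ~ nonpos_int c -> 0 < Re c ->
  -1 < z < 0 ->
  wronskian a b c
    (fun t => hC (gauss_coef a b c) (RtoC t))
    (fun t => hC (dS (gauss_coef a b c)) (RtoC t))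
    (fun t => VF b (one_coef b a c) (RtoC 1) (RtoC t))
    (fun t => VF (b + 1)%C (expo b (one_coef b a c)) (RtoC 1) (RtoC t)) z =
  conn_limit a b c.
Proof.
  intros Hab Hc Hre Hz; assert (Hba := is_int_opp a b Hab).
  assert (HG := not_is_int_exponent b a Hba).
  assert (Hg : rate (gauss_coef a b c) 1) by now apply rate_gauss_coef.
  assert (Hd : rate (one_coef b a c) 1) by now apply rate_one_coef.
  assert (Hd1 := rate_expo b _ 1 Rle_0_1 Hd).
  assert (Hg1 := rate_dS _ 1 Rle_0_1 Hg).
  set (g := gauss_coef a b c) in *; set (d := one_coef b a c) in *.
  set (W := wronskian _ _ _ _ _ _ _).
  assert (Hcst : forall z', -1 < z' < 0 -> W z' = W z).
  { intros z' Hz'; eapply (wronskian_constant a b c _ _ _ _ _ _ (-1)); auto.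
    - intros t Ht; apply gauss_solves; auto; lra.
    - intros t Ht; destruct (VF_one_solves b a c t Hba ltac:(lra)) as [h3 [h4 h5]].
      split; [exact h3|split; [exact h4|]].
      cbv beta in h5 |- *; rewrite h5; fold d; ring. }
  (* z = -tn tends to 0 from the left and sn = 1/(1-z) tends to 1. As tn = (1+tn)(1-sn), the weight
     (-z)^c supplies the factor (1-sn)^c of the Abelian theorem. *)
  set (tn := fun n => / (INR n + 2)).
  assert (Htn : forall n, 0 < tn n < 1).
  { intros n; unfold tn; assert (h := pos_INR n); split; [apply Rinv_0_lt_compat; lra|].
    rewrite <- Rinv_1; apply Rinv_lt_contravar; lra. }
  set (sn := fun n => / (1 + tn n)).
  assert (Hsn : forall n, 0 < sn n < 1).
  { intros n; unfold sn; specialize (Htn n); split; [apply Rinv_0_lt_compat; lra|].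
    rewrite <- Rinv_1; apply Rinv_lt_contravar; lra. }
  assert (Hsn1 : is_lim_seq sn 1) by exact is_lim_seq_near_1.
  assert (Htn0 : is_lim_seq tn 0) by exact is_lim_seq_inv_INR.
  (* The derivative of the solution at infinity carries the limit. The solution itself, whose
     coefficients have one factor b+n less, is o((1-s)^(-c)) and contributes 0. *)
  assert (HX : Clim (fun n => (Cpower (RtoC (1 - sn n)) c * hC (expo b d) (RtoC (sn n)))%C)
    (conn_limit a b c)).
  { apply (abel_comparison c _ _ _ Hre) with (2 := poch_ratio_limit a b c HG Hc); auto.
    intros n; unfold expo, d, one_coef, rf; simpl poch; field; auto using poch_neq_0, Cfact_neq_0. }
  assert (HZ : Clim (fun n => (Cpower (RtoC (1 - sn n)) c * hC d (RtoC (sn n)))%C) (RtoC 0)).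
  { apply (abel_comparison c _ _ _ Hre) with (2 := poch_ratio_limit_0 a b c HG Hc); auto.
    intros n; unfold d, one_coef, rf; field; auto using poch_neq_0, Cfact_neq_0. }
  assert (HW : forall n, W (- tn n) =
    (Cpower (RtoC (1 + 1 * tn n)) a * hC g (RtoC (- tn n)) *
             (Cpower (RtoC (1 - sn n)) c * hC (expo b d) (RtoC (sn n))) -
           Cpower (RtoC (1 + 1 * tn n)) (a + 1)%C * hC (dS g) (RtoC (- tn n)) *
             (Cpower (RtoC (1 - sn n)) c * hC d (RtoC (sn n))))%C).
  { intros n; unfold W, wronskian; specialize (Htn n); rewrite !VF_one_real by lra.
    replace (1 - - tn n) with (1 + 1 * tn n) by ring.
    replace (/ (1 + 1 * tn n)) with (sn n) by (unfold sn; f_equal; ring).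
    replace (- - tn n) with ((1 + 1 * tn n) * (1 - sn n)) by (unfold sn; field; lra).
    rewrite Cpower_pos_mult by (try (specialize (Hsn n)); lra).
    assert (Hn : RtoC (1 + 1 * tn n) <> 0) by (apply RtoC_neq_0; lra).
    assert (Hp := Cpower_1 _ Hn).
    set (Y := RtoC (1 + 1 * tn n)) in *.
    replace (- (b + 1))%C with (- b + - RtoC 1)%C by ring.
    replace (a + b + 1 - c)%C with
      (a + b + 1 + - c)%C by ring.
    rewrite !Cpower_plus, !Cpower_opp, Hp.
    field; repeat split; auto using Cpower_neq_0. }
  assert (HY : forall w, Clim (fun n => Cpower (RtoC (1 + 1 * tn n)) w) (RtoC 1)).
  { intros w.
    assert (D : dRC (fun t => Cpower (RtoC (1 + 1 * t)) w) 0
      (w * (1 / RtoC (1 + 1 * 0)) * Cpower (RtoC (1 + 1 * 0)) w)%C).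
    { apply (dRC_Cpower (fun t => RtoC (1 + 1 * t)) w 0 (RtoC 1)); [apply dRC_RtoC_affine|apply
      offcut_pos; lra]. }
    eapply Clim_eq; [exact (Clim_dRC (fun t => Cpower (RtoC (1 + 1 * t)) w) 0 _ tn D Htn0)|].
    cbv beta; replace (1 + 1 * 0) with 1 by ring; apply Cpower_1_l. }
  assert (Hneg : is_lim_seq (fun n => - tn n) 0).
  { replace (Finite 0) with (Rbar_opp 0) by (simpl; f_equal; ring).
    now apply -> is_lim_seq_opp. }
  assert (Hh : forall e, rate e 1 -> Clim (fun n => hC e (RtoC (- tn n))) (e O)).
  { intros e He; rewrite <- (hC_0 e He).
    apply (Clim_dRC (fun t => hC e (RtoC t)) 0 (hC (dS e) (RtoC 0))); auto.
    apply dRC_hC with 1; auto; [lra|rewrite Rabs_R0; lra]. }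
  apply Clim_unique with (fun _ : nat => W z); [apply Clim_const|].
  apply Clim_ext_loc with (fun n => W (- tn n)) O.
  { intros n _; apply Hcst; specialize (Htn n); lra. }
  eapply Clim_ext_loc with (N0 := O); [intros n _; symmetry; apply HW|].
  eapply Clim_eq.
  - apply Clim_minus; (apply Clim_mult; [apply Clim_mult; [apply HY|apply Hh; auto]|]); [exact
    HX|exact HZ].
  - unfold g, gauss_coef; simpl poch.
    replace (Cfact 0) with (RtoC 1) by reflexivity; field; exact C1_nz.
Qed.

Lemma gauss_coef_comm a b c n : gauss_coef a b c n = gauss_coef b a c n.
Proof. unfold gauss_coef; rewrite (Cmult_comm (poch a n)); reflexivity. Qed.

Lemma ff_conn_limit a b c : ~ is_int (a - b) -> ~ nonpos_int c ->
  ff c b a = (conn_limit a b c / (b - a))%C.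
Proof.
  intros Hab Hc.
  assert (HG := not_is_int_exponent b a (is_int_opp a b Hab)).
  assert (Hr := rGamma_neq_0 _ HG); assert (Hrc := rGamma_neq_0 _ Hc).
  assert (Hne := not_is_int_neq a b Hab).
  unfold ff, Gamma, conn_limit; rewrite (rGamma_shift (b - a)%C).
  replace (b - a + 1)%C with (1 - a + b)%C by ring.
  field; auto.
Qed.

Definition connection (a b c : C) (z : R) : Prop :=
  hC (gauss_coef a b c) (RtoC z) =
  (ff c b a * VF a (one_coef a b c) (RtoC 1) (RtoC z) +
        ff c a b * VF b (one_coef b a c) (RtoC 1) (RtoC z))%C.

(** Cramer's rule for F = A x + B y: identically F W(A,B) = A W(F,B) - B W(F,A), and the weighted
    Wronskians on both sides are known constants. *)
Lemma connection_Re_pos a b c z : ~ is_int (a - b) -> ~ nonpos_int c -> 0 < Re c ->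
  -1 < z < 0 -> connection a b c z.
Proof.
  intros Hab Hc Hre Hz; assert (Hba := is_int_opp a b Hab).
  assert (W1 := wronskian_VF a b c z Hab ltac:(lra)).
  assert (W2 := wronskian_gauss_VF a b c z Hab Hc Hre Hz).
  assert (W3 := wronskian_gauss_VF b a c z Hba Hc Hre Hz).
  unfold connection; rewrite (ff_conn_limit a b c), (ff_conn_limit b a c), <- W2, <- W3 by auto.
  unfold wronskian in *.
  rewrite !(hC_ext (gauss_coef b a c) (gauss_coef a b c)) by (intros; apply gauss_coef_comm).
  rewrite !(hC_ext (dS (gauss_coef b a c)) (dS (gauss_coef a b c)))
    by (intros; unfold dS; now rewrite gauss_coef_comm).
  replace (b + a + 1 - c)%C with (a + b + 1 - c)%C by ring.
  assert (Hne := not_is_int_neq a b Hab).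
  set (w := (Cpower _ _ * Cpower _ _)%C) in *.
  set (F := hC (gauss_coef a b c) _); set (F1 := hC (dS _) _).
  set (A0 := VF a _ _ _) in *; set (A1 := VF (a + 1)%C _ _ _) in *.
  set (B0 := VF b _ _ _) in *; set (B1 := VF (b + 1)%C _ _ _) in *.
  assert (Hne' : (a - b)%C <> 0).
  { intros E; apply Hne; replace (b - a)%C with (- (a - b))%C by ring; rewrite E; ring. }
  (* Multiplying and dividing by W(A,B) = b-a replaces the unknown values by Wronskians. *)
  transitivity (F * (w * (A0 * B1 - A1 * B0)) / (b - a))%C.
  - rewrite W1; field; auto.
  - field; auto.
Qed.

Lemma dRC_unique f t l l' : dRC f t l -> dRC f t l' -> l = l'.
Proof.
  intros [H1 H2] [H3 H4].
  destruct l as [x y], l' as [x' y']; unfold Re, Im in *; simpl in *.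
  apply is_derive_unique in H1, H2, H3, H4; rewrite H1 in H3; rewrite H2 in H4; now subst.
Qed.

(** [z d/dz + c] maps the solution space for [c + 1] to the one for [c]. *)
Lemma VF_lower_c a b c z : ~ is_int (a - b) -> z < 0 ->
  (RtoC z * VF (a + 1)%C (expo a (one_coef a b (c + 1)%C)) (RtoC 1) (RtoC z) +
        c * VF a (one_coef a b (c + 1)%C) (RtoC 1) (RtoC z))%C =
  ((c - a) * VF a (one_coef a b c) (RtoC 1) (RtoC z))%C.
Proof.
  intros Hab Hz; rewrite !VF_one_real by auto.
  assert (Hs := one_plus_range z Hz); set (s := / (1 - z)) in *.
  assert (Ez : z = 1 - / s) by (unfold s; field; lra).
  clearbody s; subst z; replace (1 - (1 - / s)) with (/ s) by ring.
  assert (Hn : RtoC (/ s) <> 0) by (apply RtoC_neq_0, Rinv_neq_0_compat; lra).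
  replace (- (a + 1))%C with (- (a + INR 1))%C by (simpl; ring).
  rewrite Cpower_opp_plus_INR, Cpow_1_r by auto.
  set (P := Cpower _ _).
  set (d' := one_coef a b (c + 1)%C); set (d := one_coef a b c).
  assert (Hd : rate d 1) by now apply rate_one_coef.
  assert (Hd' : rate d' 1) by now apply rate_one_coef.
  assert (He := rate_expo a d' 1 Rle_0_1 Hd').
  assert (Hsc : 1 * Cmod (RtoC s) < 1) by (rewrite Cmod_R, Rabs_pos_eq; lra).
  assert (Hs0 : RtoC s <> 0) by (apply RtoC_neq_0; lra).
  assert (Hg := not_is_int_exponent a b Hab).
  assert (E : ((c - a) * hC d (RtoC s) +
      (hC (expo a d') (RtoC s) + - c * hC d' (RtoC s)))%C =
    (RtoC s * hC (expo a d') (RtoC s))%C).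
  { transitivity (hC (fun k => ((c - a) * d k +
      (expo a d' k + - c * d' k))%C) (RtoC s)).
    - rewrite !(hC_plus _ _ 1), !(hC_scal _ _ 1); auto using rate_scal, rate_plus, Rle_0_1.
    - apply hC_lift with 1; auto using rate_scal, rate_plus, Rle_0_1.
      + unfold expo, d, d', one_coef; change (INR 0) with 0; simpl poch; rewrite !rf_0; field;
        exact C1_nz.
      + intros k; unfold expo, d, d', one_coef.
        replace (rf (c + 1 - b) (S k)) with
          ((c + 1 - b + INR k) * rf (c + 1 - b) k /
             INR (S k))%C by (rewrite <- rf_S; field; apply INR_S_neq_0).
        unfold rf; rewrite (poch_S_l (c - b)%C).
        replace (c - b + 1)%C with (c + 1 - b)%C by ring.
        rewrite Cfact_S; simpl poch; rewrite RtoC_INR_S.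
        field; rewrite <- RtoC_INR_S; repeat split;
          auto using Cfact_neq_0, INR_S_neq_0, poch_neq_0, Cplus_INR_neq_0. }
  rewrite RtoC_minus, RtoC_inv by lra.
  transitivity (P * (RtoC s * hC (expo a d') (RtoC s) -
    (hC (expo a d') (RtoC s) + - c * hC d' (RtoC s))))%C; [field; auto|].
  rewrite <- E; ring.
Qed.

Lemma gauss_lower_c a b c z : ~ nonpos_int c -> -1 < z < 1 ->
  (RtoC z * hC (dS (gauss_coef a b (c + 1)%C)) (RtoC z) +
        c * hC (gauss_coef a b (c + 1)%C) (RtoC z))%C =
  (c * hC (gauss_coef a b c) (RtoC z))%C.
Proof.
  intros Hc Hz.
  assert (Hc' := nonpos_int_succ c Hc).
  assert (Hg : rate (gauss_coef a b c) 1) by now apply rate_gauss_coef.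
  assert (Hg' : rate (gauss_coef a b (c + 1)%C) 1) by now apply rate_gauss_coef.
  assert (Hzc : 1 * Cmod (RtoC z) < 1).
  { rewrite Cmod_R, Rmult_1_l; apply Rabs_def1; lra. }
  rewrite <- (hC_theta _ 1), <- (hC_scal _ _ 1), <- (hC_plus _ _ 1), <- (hC_scal _ _ 1)
    by auto using rate_scal, rate_INR_mult, Rle_0_1.
  apply hC_ext; intros k; unfold gauss_coef.
  assert (Hk : (c * poch (c + 1) k)%C = (poch c k * (c + INR k))%C).
  { rewrite <- poch_S_l; reflexivity. }
  assert (Hp1 := poch_neq_0 c k Hc); assert (Hp2 := poch_neq_0 _ k Hc').
  transitivity (poch a k * poch b k * / Cfact k *
    ((c + INR k) / poch (c + 1) k))%C.
  - field; auto using Cfact_neq_0.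
  - replace (c + INR k)%C with (c * poch (c + 1) k / poch c k)%C
      by (rewrite Hk; field; auto).
    field; auto using Cfact_neq_0.
Qed.

Lemma ff_lower_c a b c : ~ nonpos_int c ->
  (c * ff c b a)%C = ((c - a) * ff (c + 1)%C b a)%C.
Proof.
  intros Hc; assert (Hc' := nonpos_int_succ c Hc).
  assert (Hr := rGamma_neq_0 _ Hc'); assert (Hr0 := rGamma_neq_0 _ Hc).
  unfold ff, Gamma.
  replace (c + 1 - a)%C with (c - a + 1)%C by ring.
  rewrite (rGamma_shift (c - a)%C), (rGamma_shift c).
  assert (Hcn : c <> 0).
  { intros E; apply Hc; exists O; rewrite E; simpl; f_equal; ring. }
  set (X := (/ rGamma (b - a))%C); field; auto.
Qed.

(** The formula for c+1 holds on an interval and may be differentiated there. Applying z d/dz + c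
    multiplies the three functions by c, c-a and c-b, and the coefficients [ff] change by the same
    factors. *)
Lemma connection_lower_c a b c : ~ is_int (a - b) -> ~ nonpos_int c ->
  (forall z, -1 < z < 0 -> connection a b (c + 1)%C z) ->
  forall z, -1 < z < 0 -> connection a b c z.
Proof.
  intros Hab Hc H z Hz; assert (Hba := is_int_opp a b Hab).
  assert (Hc' := nonpos_int_succ c Hc).
  assert (Hcn : c <> 0).
  { intros E; apply Hc; exists O; rewrite E; simpl; f_equal; ring. }
  set (c1 := (c + 1)%C) in *.
  assert (Hg : rate (gauss_coef a b c1) 1) by now apply rate_gauss_coef.
  assert (Hda : rate (one_coef a b c1) 1) by now apply rate_one_coef.
  assert (Hdb : rate (one_coef b a c1) 1) by now apply rate_one_coef.
  assert (D : hC (dS (gauss_coef a b c1)) (RtoC z) =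
    (ff c1 b a * VF (a + 1)%C (expo a (one_coef a b c1)) (RtoC 1) (RtoC z) +
          ff c1 a b * VF (b + 1)%C (expo b (one_coef b a c1)) (RtoC 1) (RtoC z))%C).
  { apply dRC_unique with (fun t => hC (gauss_coef a b c1) (RtoC t)) z.
    - apply dRC_hC with 1; auto; [lra|rewrite Rmult_1_l; apply Rabs_def1; lra].
    - eapply dRC_ext_loc with (fun t => _).
      2: apply dRC_plus; apply dRC_scal; apply dRC_VF_one; auto; lra.
      assert (Hloc : locally z (fun t => -1 < t < 0)).
      { apply (open_and (fun t => -1 < t) (fun t => t < 0)); [apply open_gt|apply open_lt|auto]. }
      apply filter_imp with (2 := Hloc); intros t Ht; symmetry; now apply H. }
  specialize (H z Hz); unfold connection in *.
  assert (G := gauss_lower_c a b c z Hc ltac:(lra)); fold c1 in G.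
  assert (VA := VF_lower_c a b c z Hab ltac:(lra)); fold c1 in VA.
  assert (VB := VF_lower_c b a c z Hba ltac:(lra)); fold c1 in VB.
  assert (FA := ff_lower_c a b c Hc); fold c1 in FA.
  assert (FB := ff_lower_c b a c Hc); fold c1 in FB.
  rewrite D, H in G.
  assert (E : (c * hC (gauss_coef a b c) (RtoC z))%C =
    (c * (ff c b a * VF a (one_coef a b c) (RtoC 1) (RtoC z) +
        ff c a b * VF b (one_coef b a c) (RtoC 1) (RtoC z)))%C).
  { transitivity (c * ff c b a * VF a (one_coef a b c) (RtoC 1) (RtoC z) +
        c * ff c a b * VF b (one_coef b a c) (RtoC 1) (RtoC z))%C; [|ring].
    rewrite FA, FB, <- G.
    transitivity (ff c1 b a * ((c - a) * VF a (one_coef a b c) (RtoC 1) (RtoC z)) +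
      ff c1 a b * ((c - b) * VF b (one_coef b a c) (RtoC 1) (RtoC z)))%C; [|ring].
    rewrite <- VA, <- VB; ring. }
  transitivity (/ c * (c * hC (gauss_coef a b c) (RtoC z)))%C; [field; auto|].
  rewrite E; field; auto.
Qed.

Theorem connection_real a b c z : ~ is_int (a - b) -> ~ nonpos_int c ->
  -1 < z < 0 -> connection a b c z.
Proof.
  (* Enough unit steps to bring Re c into the right half plane, undone one at a time by
     [connection_lower_c]. *)
  intros Hab; destruct (nfloor_ex (Rabs (Re c))) as [N [_ HN]]; [apply Rabs_pos|].
  assert (HN' : 0 < Re c + INR (S N)).
  { rewrite S_INR; assert (h := Rle_abs (- Re c)); rewrite Rabs_Ropp in h; lra. }
  clear HN; revert z; generalize (S N) HN'; clear HN' N; intros N; revert c.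
  induction N as [|N IH]; intros c HN z Hc Hz.
  - apply connection_Re_pos; auto; simpl in HN; lra.
  - apply connection_lower_c; auto; intros t Ht; apply IH; auto.
    + rewrite re_plus, re_RtoC; rewrite S_INR in HN; lra.
    + now apply nonpos_int_succ.
Qed.

(** * The connection formula in the complex plane *)

(** In this form the effect of the centre q is visible: the two factors of the convolution grow like
    |q|^i and |q-1|^i, the distances from q to the singularities 0 and 1. *)
Lemma shift_inf_coef a b c q k : ~ is_int (a - b) ->
  shift_coef a (inf_coef a b c) q k =
  (poch a k / poch (1 - b + a) k *
    sum_n (fun i => (rf (c - b) i * q ^ i *
      (rf (1 - c + a) (k - i) * (q - 1) ^ (k - i)))%C) k)%C.
Proof.
  intros Hab; assert (Hg := not_is_int_exponent a b Hab).
  rewrite rf_convolution_expand, <- sum_n_C_scal; apply sum_n_C_ext; intros n Hn.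
  replace (c - b + (1 - c + a))%C with (1 - b + a)%C by ring.
  set (G := (1 - b + a)%C) in *.
  rewrite <- (rf_poch_sub a n k Hn), <- (rf_poch_sub G n k Hn).
  unfold inf_coef, rf; fold G.
  assert (H2 : poch (G + INR n) (k - n) <> 0).
  { apply poch_neq_0; intros [m Hm]; apply Hg; exists (n + m)%nat.
    replace G with (G + INR n - INR n)%C by ring.
    rewrite Hm, <- RtoC_minus, plus_INR; f_equal; ring. }
  field; repeat split; auto using Cfact_neq_0, poch_neq_0.
Qed.

(** At q = 1 the powers of q-1 leave only the summand i = k. *)
Lemma shift_inf_coef_one a b c k : ~ is_int (a - b) ->
  shift_coef a (inf_coef a b c) (RtoC 1) k = one_coef a b c k.
Proof.
  intros Hab; rewrite shift_inf_coef by auto; unfold one_coef; f_equal.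
  replace (1 - 1)%C with (RtoC 0) by ring.
  rewrite <- sum_n_C_rev; destruct k as [|k].
  - rewrite sum_O; simpl; rewrite !rf_0; cring.
  - rewrite sum_n_C_first, Nat.sub_0_r, Nat.sub_diag, rf_0, Cpow_1_l.
    rewrite (sum_n_C_ext _ (fun _ => (0 * 0)%C)).
    + rewrite sum_n_C_scal; simpl Cpow; cring.
    + intros n Hn; replace (S k - (S k - S n))%nat with (S n) by lia; rewrite Cpow_S; ring.
Qed.

Lemma rate_inf_coef a b c : ~ is_int (a - b) -> rate (inf_coef a b c) 1.
Proof.
  intros H; apply rate_mult1; [lra|now apply rate_poch_ratio, not_is_int_exponent|].
  apply rate_mult1; [lra| |apply rate_rf].
  apply rate_weaken with (Cmod (- RtoC 1)); [rewrite Cmod_opp, Cmod_1; lra|apply rate_Cpow].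
Qed.

(** With [p = 1/2] the expansion converges as soon as [|z - 1/2| > 1/2]. *)
Definition mid_coef (a b c : C) : nat -> C := shift_coef a (inf_coef a b c) (RtoC (1 / 2)).

(** Both factors of the convolution have rate 1/2, as |q| = |q-1| = 1/2. *)
Lemma rate_mid_coef a b c : ~ is_int (a - b) -> rate (mid_coef a b c) (1 / 2).
Proof.
  intros H; eapply rate_ext; [intros n; symmetry; now apply shift_inf_coef|].
  apply rate_ext with (fun n => (sum_n (fun i => (rf (c - b) i * RtoC (1 / 2) ^ i *
      (rf (1 - c + a) (n - i) * (RtoC (1 / 2) - 1) ^ (n - i)))%C) n *
    (poch a n / poch (1 - b + a) n))%C).
  { intros n; apply Cmult_comm. }
  apply rate_mult1; [lra| |now apply rate_poch_ratio, not_is_int_exponent].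
  assert (Hp : forall x y, Cmod y = 1 / 2 -> rate (fun i => (rf x i * y ^ i)%C) (1 / 2)).
  { intros x y Hy; apply rate_ext with (fun i => (y ^ i * rf x i)%C); [intros; ring|].
    apply rate_mult1; [lra|rewrite <- Hy; apply rate_Cpow|apply rate_rf]. }
  apply (rate_conv (fun i => (rf (c - b) i * RtoC (1 / 2) ^ i)%C)
    (fun i => (rf (1 - c + a) i * (RtoC (1 / 2) - 1) ^ i)%C));
    [lra|apply Hp|apply Hp].
  - rewrite Cmod_R, Rabs_pos_eq; lra.
  - rewrite <- RtoC_minus, Cmod_R, Rabs_left; lra.
Qed.

Definition VF_inf (a b c : C) : C -> C := VF a (inf_coef a b c) (RtoC 0).
Definition VF_mid (a b c : C) : C -> C := VF a (mid_coef a b c) (RtoC (1 / 2)).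
Definition VF_one (a b c : C) : C -> C := VF a (one_coef a b c) (RtoC 1).

Lemma VF_inf_mid_real a b c z : ~ is_int (a - b) -> z < -1 ->
  VF_inf a b c (RtoC z) = VF_mid a b c (RtoC z).
Proof.
  intros H Hz; apply VF_recenter with 1; try lra; now apply rate_inf_coef.
Qed.

(** Left of -1 the expansion about 0 converges too, and recentring it gives both of the others. *)
Lemma VF_one_mid_real a b c z : ~ is_int (a - b) -> z < -1 ->
  VF_one a b c (RtoC z) = VF_mid a b c (RtoC z).
Proof.
  intros H Hz; rewrite <- VF_inf_mid_real by auto; symmetry; unfold VF_inf, VF_one.
  rewrite (VF_recenter a _ 1 1 z) by (auto using rate_inf_coef; lra).
  unfold VF; f_equal; apply hC_ext; intros k; now apply shift_inf_coef_one.
Qed.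

Lemma analytic_VF_mid a b c z : ~ is_int (a - b) -> 1 / 2 < Cmod (RtoC (1 / 2) - z) ->
  offcut (RtoC (1 / 2) - z) -> analytic_at (VF_mid a b c) z.
Proof. intros H H1 H2; apply analytic_VF with (1 / 2); auto; [lra|now apply rate_mid_coef]. Qed.

Lemma VF_one_mid a b c z : ~ is_int (a - b) -> -1 < z < 0 ->
  VF_one a b c (RtoC z) = VF_mid a b c (RtoC z).
Proof.
  intros Hab Hz; apply Ceq_minus.
  (* The segment starts at -2, and since z < 0 its first half stays left of -1, where the two
     expansions are known to agree. *)
  apply (identity_along_segment (fun w => (VF_one a b c w - VF_mid a b c w)%C)
    (RtoC (-2)) (RtoC z) (1 / 2)); [|intros t Ht|lra|intros s Hs].
  - intros E; apply RtoC_inj in E; lra.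
  - rewrite <- RtoC_minus, <- RtoC_mult, <- RtoC_plus; set (x := -2 + t * (z - -2)).
    assert (Hx : x < 0) by (unfold x; nra).
    apply analytic_at_minus.
    + apply analytic_VF with 1; [lra|now apply rate_one_coef| |]; rewrite <- RtoC_minus.
      * rewrite Cmod_R, Rabs_pos_eq; lra.
      * apply offcut_pos; lra.
    + apply analytic_VF_mid; auto; rewrite <- RtoC_minus.
      * rewrite Cmod_R, Rabs_pos_eq; lra.
      * apply offcut_pos; lra.
  - rewrite <- RtoC_minus, <- RtoC_mult, <- RtoC_plus; set (x := -2 + s * (z - -2)).
    assert (Hx : x < -1) by (unfold x; nra).
    rewrite VF_one_mid_real by auto; ring.
Qed.

Lemma offcut_shift q z : 0 <= q -> offcut (- z) -> offcut (RtoC q - z).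
Proof.
  intros Hq [H|H].
  - left; rewrite re_opp in H; unfold Cminus; rewrite re_plus, re_opp, re_RtoC; lra.
  - right; rewrite im_opp in H; unfold Cminus; rewrite im_plus, im_opp, im_RtoC; lra.
Qed.

(** A circle around 0 meets the cut [0, +oo) only at its rightmost point, which an arc ending at [z]
    reaches only if [z] is that point. *)
Lemma offcut_opp_arc w z : z <> RtoC 0 -> Cmod w = Cmod z -> Re w <= Re z ->
  offcut (- z) -> offcut (- w).
Proof.
  intros Hz Hm Hr Ho; destruct (Req_dec (Im w) 0) as [Hi|Hi].
  2:{ right; rewrite im_opp; lra. }
  left; rewrite re_opp.
  assert (Hp : 0 < Cmod z) by now apply Cmod_gt_0.
  assert (Hw := Cmod_sqr w); assert (Hz2 := Cmod_sqr z); rewrite Hi, Hm in Hw.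
  destruct (Rlt_or_le (Re w) 0) as [h|h]; [lra|exfalso].
  assert (Re w = Cmod z) by nra.
  assert (hz := re_le_Cmod z); apply Rabs_le_between in hz.
  assert (Re z = Cmod z) by lra.
  assert (Im z = 0) by nra.
  destruct Ho as [Ho|Ho]; [rewrite re_opp in Ho|rewrite im_opp in Ho]; lra.
Qed.

(** For |z| > 1 the circle through [z] lies outside both excluded disks and meets the real axis at
    -|z| < -1, where the expansions agree. *)
Lemma VF_inf_mid a b c z : ~ is_int (a - b) -> 1 < Cmod z -> offcut (- z) ->
  VF_inf a b c z = VF_mid a b c z.
Proof.
  intros Hab Hz Ho; apply Ceq_minus.
  assert (Hz0 : z <> 0) by (apply Cmod_gt_0; lra).
  apply (identity_along_arc (fun w => (VF_inf a b c w - VF_mid a b c w)%C)); auto.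
  - intros w Hw Hr; assert (Hwo := offcut_opp_arc w z Hz0 Hw Hr Ho).
    assert (Ht := Cmod_triangle (RtoC (1 / 2) - w)%C (- RtoC (1 / 2))%C).
    replace (RtoC (1 / 2) - w + - RtoC (1 / 2))%C with (- w)%C in Ht by ring.
    rewrite !Cmod_opp, Cmod_R, Rabs_pos_eq in Ht by lra.
    apply analytic_at_minus.
    + apply analytic_VF with 1; [lra|now apply rate_inf_coef| |apply offcut_shift; auto; lra].
      replace (0 - w)%C with (- w)%C by ring; rewrite Cmod_opp; lra.
    + apply analytic_VF_mid; auto; [lra|apply offcut_shift; auto; lra].
  - exists (Cmod z - 1); split; [lra|]; intros t Ht; apply Rabs_def2 in Ht.
    rewrite VF_inf_mid_real by (auto; lra); ring.
Qed.

(** Hence |w - 1/2| > 1/2 means |w|^2 > Re w, a condition that moving left on a circle around 0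
    preserves. *)
Lemma Cmod_half_sqr w :
  Cmod (RtoC (1 / 2) - w) * Cmod (RtoC (1 / 2) - w) = Cmod w * Cmod w - Re w + 1 / 4.
Proof.
  rewrite !Cmod_sqr; unfold Cminus; rewrite re_plus, im_plus, re_opp, im_opp, re_RtoC, im_RtoC;
    field.
Qed.

Lemma Cmod_half_gt w : 0 < Cmod w * Cmod w - Re w -> 1 / 2 < Cmod (RtoC (1 / 2) - w).
Proof.
  intros H; assert (Hs := Cmod_half_sqr w); assert (h := Cmod_ge_0 (RtoC (1 / 2) - w)%C).
  nra.
Qed.

Definition VF_mid_sum (a b c z : C) : C :=
  (ff c b a * VF_mid a b c z + ff c a b * VF_mid b a c z)%C.

Lemma analytic_VF_mid_sum a b c z : ~ is_int (a - b) ->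
  1 / 2 < Cmod (RtoC (1 / 2) - z) -> offcut (RtoC (1 / 2) - z) ->
  analytic_at (VF_mid_sum a b c) z.
Proof.
  intros Hab H1 H2; assert (Hba := is_int_opp a b Hab).
  apply analytic_at_plus; apply analytic_at_scal; now apply analytic_VF_mid.
Qed.

(** The region is a crescent, which the circles around 0 meet in arcs. *)
Lemma connection_crescent a b c z : ~ is_int (a - b) -> ~ nonpos_int c ->
  Cmod z < 1 -> 1 / 2 < Cmod (RtoC (1 / 2) - z) ->
  hC (gauss_coef a b c) z = VF_mid_sum a b c z.
Proof.
  intros Hab Hc Hz1 Hz2; assert (Hba := is_int_opp a b Hab).
  assert (Hs : 0 < Cmod z * Cmod z - Re z) by (assert (h := Cmod_half_sqr z); nra).
  assert (Hz0 : z <> 0).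
  { intros ->; rewrite Cmod_0, re_RtoC in Hs; lra. }
  assert (Hp : 0 < Cmod z) by now apply Cmod_gt_0.
  apply Ceq_minus.
  apply (identity_along_arc (fun w => (hC (gauss_coef a b c) w - VF_mid_sum a b c w)%C)); auto.
  - intros w Hw Hr; apply analytic_at_minus.
    + apply analytic_hC with 1; [lra|now apply rate_gauss_coef|lra].
    + assert (Hsw : 0 < Cmod w * Cmod w - Re w) by (rewrite Hw; lra).
      apply analytic_VF_mid_sum; auto; [now apply Cmod_half_gt|].
      apply offcut_shift; [lra|].
      destruct (Req_dec (Im w) 0) as [Hi|Hi]; [left; rewrite re_opp|right; rewrite im_opp; lra].
      assert (hw := Cmod_sqr w); rewrite Hi in hw.
      assert (hr := re_le_Cmod w); apply Rabs_le_between in hr.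
      assert (Re w < 1) by lra; nra.
  - exists (Rmin (Cmod z) (1 - Cmod z)); split; [apply Rmin_glb_lt; lra|].
    intros t Ht; assert (h1 := Rlt_le_trans _ _ _ Ht (Rmin_l _ _)).
    assert (h2 := Rlt_le_trans _ _ _ Ht (Rmin_r _ _)).
    apply Rabs_def2 in h1, h2.
    assert (Ht' : -1 < t < 0) by lra.
    rewrite (connection_real a b c t Hab Hc Ht').
    unfold VF_mid_sum; rewrite <- !VF_one_mid by auto; unfold VF_one; ring.
Qed.

(** * The principal branch of the Gauss function *)

Definition gauss_continued (a b c z : C) : C :=
  if Rlt_dec (Cmod z) 1 then hC (gauss_coef a b c) z else VF_mid_sum a b c z.

Lemma cut_plane_offcut z : cut_plane z <-> offcut (1 - z).
Proof.
  split.
  - intros [H1 H2]; apply offcut_Carg; auto.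
    intros E; apply H1; symmetry; now apply Ceq_minus.
  - intros H; split; [|now apply Carg_bound].
    intros ->; apply (offcut_neq_0 _ H); ring.
Qed.

Lemma gauss_term_csum a b c z : ~ nonpos_int c -> Cmod z < 1 ->
  is_csum (gauss_term a b c z) (hC (gauss_coef a b c) z).
Proof.
  intros Hc Hz; apply csum_ext with (fun n => (gauss_coef a b c n * z ^ n)%C).
  - intros n; unfold gauss_term, gauss_coef; field; auto using Cfact_neq_0, poch_neq_0.
  - apply csum_correct, rate_summable with 1; [lra|now apply rate_gauss_coef|lra].
Qed.

(** Only a point with |z0| >= 1 is delicate, since its neighbourhoods may enter the unit disk. In
    the ball of radius |1/2 - z0| - 1/2 the value is [VF_mid_sum] throughout, inside the unit disk
    by [connection_crescent]. *)
Lemma gauss_continued_principal a b c : ~ is_int (a - b) -> ~ nonpos_int c ->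
  principal_2F1 a b c (gauss_continued a b c).
Proof.
  intros Hab Hc; split.
  - intros z0 Hz0; apply cut_plane_offcut in Hz0.
    destruct (Rlt_or_le (Cmod z0) 1) as [Hlt|Hge].
    + apply (analytic_at_ext_ball (hC (gauss_coef a b c)) _ z0 (1 - Cmod z0)); [lra| |].
      * intros z Hz; unfold gauss_continued; destruct (Rlt_dec (Cmod z) 1) as [h|h]; auto.
        exfalso; apply h.
        assert (t := Cmod_triangle (z - z0)%C z0).
        replace (z - z0 + z0)%C with z in t by ring; lra.
      * apply analytic_hC with 1; [lra|now apply rate_gauss_coef|lra].
    + assert (hz := re_le_Cmod z0); apply Rabs_le_between in hz.
      assert (hsq := Cmod_sqr z0).
      assert (Hoff : Im z0 = 0 -> Re z0 < 0).
      { intros Hi; rewrite Hi in hsq; destruct Hz0 as [h|h]; unfold Cminus in h.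
        - rewrite re_plus, re_opp, re_RtoC in h; nra.
        - rewrite im_plus, im_opp, im_RtoC in h; lra. }
      assert (Hhalf : 1 / 2 < Cmod (RtoC (1 / 2) - z0)).
      { apply Cmod_half_gt; destruct (Req_dec (Im z0) 0) as [Hi|Hi].
        - specialize (Hoff Hi); nra.
        - assert (0 < Im z0 * Im z0) by nra; nra. }
      apply (analytic_at_ext_ball (VF_mid_sum a b c) _ z0 (Cmod (RtoC (1 / 2) - z0) - 1 / 2));
        [lra| |].
      * intros z Hz; unfold gauss_continued; destruct (Rlt_dec (Cmod z) 1) as [h|h]; auto.
        symmetry; apply connection_crescent; auto.
        assert (t := Cmod_triangle (RtoC (1 / 2) - z)%C (z - z0)%C).
        replace (RtoC (1 / 2) - z + (z - z0))%C with (RtoC (1 / 2) - z0)%C in t by ring.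
        lra.
      * apply analytic_VF_mid_sum; auto; apply offcut_shift; [lra|].
        destruct (Req_dec (Im z0) 0) as [Hi|Hi]; [left; rewrite re_opp; specialize (Hoff Hi); lra|].
        right; rewrite im_opp; lra.
  - intros z Hz; unfold gauss_continued; destruct (Rlt_dec (Cmod z) 1); [|lra].
    now apply gauss_term_csum.
Qed.

(** The cut plane is star-shaped about 0, so the identity theorem applies along the segment from 0
    to [z]. *)
Lemma principal_2F1_unique a b c F G z : principal_2F1 a b c F -> principal_2F1 a b c G ->
  cut_plane z -> F z = G z.
Proof.
  intros [HF1 HF2] [HG1 HG2] Hz.
  assert (Hsmall : forall w, Cmod w < 1 -> F w = G w).
  { intros w Hw; rewrite <- (CSeries_unique _ _ (HF2 w Hw)); now apply CSeries_unique, HG2. }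
  destruct (Ceq_dec z (RtoC 0)) as [->|Hz0].
  { apply Hsmall; rewrite Cmod_0; lra. }
  apply Ceq_minus.
  apply cut_plane_offcut in Hz; unfold Cminus in Hz.
  assert (Hp := Cmod_ge_0 z).
  assert (Eg : forall s, (0 + RtoC s * (z - 0))%C = (RtoC s * z)%C)
    by (intros; ring).
  (* For s <= 1/(|z|+1) the point s z lies in the unit disk, where the Gauss series fixes the
     value. *)
  apply (identity_along_segment (fun w => (F w - G w)%C) (RtoC 0) z (/ (Cmod z + 1)));
    [now apply not_eq_sym|intros t Ht|apply Rinv_0_lt_compat; lra|intros s Hs].
  - rewrite Eg.
    assert (Hcut : cut_plane (RtoC t * z)%C).
    { apply cut_plane_offcut; unfold offcut, Cminus in *.
      rewrite re_plus, im_plus, re_opp, im_opp, re_RtoC, im_RtoC in *.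
      rewrite re_scal_l, im_scal_l.
      destruct (Req_dec t 0) as [->|Ht0]; [left; lra|].
      destruct (Req_dec (Im z) 0) as [Hi|Hi].
      - left; destruct Hz as [h|h]; [nra|lra].
      - right; assert (t * Im z <> 0) by now apply Rmult_integral_contrapositive_currified.
        lra. }
    apply analytic_at_minus; auto.
  - rewrite Eg, Hsmall; [ring|].
    rewrite Cmod_mult, Cmod_R, Rabs_pos_eq by lra.
    apply Rle_lt_trans with (/ (Cmod z + 1) * Cmod z).
    + apply Rmult_le_compat_r; lra.
    + apply (Rmult_lt_reg_l (Cmod z + 1)); [lra|].
      rewrite <- Rmult_assoc, Rinv_r by lra; lra.
Qed.

Lemma sector_offcut x : sector x -> offcut (- x).
Proof.
  intros [H1 H2]; apply offcut_Carg; auto.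
  intros E; apply H1; replace x with (- (- x))%C by ring; rewrite E; ring.
Qed.

(** Existence of a continuation makes the choice in [hyp2F1] satisfy its specification, and
    uniqueness on the cut plane identifies it with [gauss_continued]. *)
Theorem hyp2F1_connection a b c x : ~ is_int (a - b) -> ~ nonpos_int c ->
  1 < Cmod x -> sector x ->
  hyp2F1 a b c x =
  (ff c b a * VF_inf a b c x + ff c a b * VF_inf b a c x)%C.
Proof.
  intros Hab Hc Hx Hs; assert (Hba := is_int_opp a b Hab).
  assert (Ho := sector_offcut x Hs).
  assert (Hg := gauss_continued_principal a b c Hab Hc).
  assert (Hh : principal_2F1 a b c (hyp2F1 a b c)).
  { unfold hyp2F1; apply epsilon_spec; eexists; exact Hg. }
  rewrite (principal_2F1_unique a b c _ _ x Hh Hg).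
  2:{ apply cut_plane_offcut, offcut_shift; auto; lra. }
  unfold gauss_continued; destruct (Rlt_dec (Cmod x) 1); [lra|].
  unfold VF_mid_sum; rewrite !VF_inf_mid by auto; reflexivity.
Qed.

(** * Rearrangement of the series for [Psi1] *)

Definition kummer_term (al e y : C) (n : nat) : C :=
  (poch al n / poch e n * (y ^ n / Cfact n))%C.

(** y^n/(e)_n decays faster than q^n for every q > 0, so one constant serves all [al]. The price
    (1-q)^(-|al|) grows as slowly as desired when q is small. *)
Lemma kummer_sum_bound e y q : ~ nonpos_int e -> 0 < q < 1 ->
  exists K, 0 <= K /\ forall al X M, Cmod al <= X ->
    sum_n (fun n => Cmod (kummer_term al e y n)) M <= K * Rpower (1 - q) (- X).
Proof.
  intros He Hq.
  assert (Hr : rate (fun n => (y ^ n * / poch e n)%C) 0).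
  { rewrite <- (Rmult_0_r (Cmod y)).
    apply rate_mult; [apply Cmod_ge_0|lra|apply rate_Cpow|now apply rate_poch_inv]. }
  destruct (Hr q (proj1 Hq)) as [K HK]; assert (HK0 := rate_nonneg_const _ _ _ HK).
  exists K; split; auto; intros al X M HX.
  apply Rle_trans with (K * sum_n (fun n => Cmod (rf al n) * q ^ n) M).
  - rewrite <- (sum_n_mult_l (K := R_Ring)); apply sum_n_le; intros n _.
    replace (kummer_term al e y n) with (rf al n * (y ^ n * / poch e n))%C.
    + rewrite Cmod_mult; specialize (HK n); assert (h := Cmod_ge_0 (rf al n)).
      change (Cmod (rf al n) * Cmod (y ^ n * / poch e n) <= K * (Cmod (rf al n) * q ^ n)).
      nra.
    + unfold kummer_term, rf; field; auto using poch_neq_0, Cfact_neq_0.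
  - apply Rmult_le_compat_l; auto; apply rf_sum_bound; auto; lra.
Qed.

Lemma kummer_summable al e y : ~ nonpos_int e -> csummable (kummer_term al e y).
Proof.
  intros He; destruct (kummer_sum_bound e y (1 / 2) He) as [K [_ HK]]; [lra|].
  apply ex_series_pos_bounded with (K * Rpower (1 - 1 / 2) (- Cmod al)).
  - intros; apply Cmod_ge_0.
  - intros M; apply HK; lra.
Qed.

(** With q = 1 - 1/r the bound (1-q)^(-X-k) is a constant times r^k. *)
Lemma rate_hyp1F1 (al : nat -> C) e y X : ~ nonpos_int e -> (forall k, Cmod (al k) <= X + INR k) ->
  rate (fun k => hyp1F1 (al k) e y) 1.
Proof.
  intros He Hal r Hr.
  assert (Hr' : 0 < / r < 1).
  { split; [apply Rinv_0_lt_compat; lra|rewrite <- Rinv_1; apply Rinv_lt_contravar; lra]. }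
  destruct (kummer_sum_bound e y (1 - / r) He) as [K [HK0 HK]]; [lra|].
  exists (K * Rpower (/ r) (- X)); intros k.
  replace (hyp1F1 (al k) e y) with (CSeries (kummer_term (al k) e y) - 0)%C.
  2:{ unfold hyp1F1; fold (kummer_term (al k) e y); ring. }
  apply Cmod_limit_le with (1 := csum_correct _ (kummer_summable (al k) e y He)) (K := O).
  intros N _; replace (sum_n (kummer_term (al k) e y) N - 0)%C
    with (sum_n (kummer_term (al k) e y) N) by cring.
  apply Rle_trans with (1 := sum_n_Cmod_le _ N).
  apply Rle_trans with (1 := HK _ _ N (Hal k)).
  replace (1 - (1 - / r)) with (/ r) by ring.
  rewrite Rpower_opp_plus_INR, Rinv_inv by lra; lra.
Qed.

Section Rearrangement.

Variables (al u : nat -> C) (e x y : C) (X : R).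
Hypotheses (He : ~ nonpos_int e) (Hal : forall k, Cmod (al k) <= X + INR k).
Hypotheses (Hu : rate u 1) (Hx : 1 < Cmod x).

Let w n k := (u k * / x ^ k * kummer_term (al k) e y n)%C.

Lemma kummer_double_bound : exists B, forall N M,
  sum_n (fun n => sum_n (fun k => Cmod (w n k)) M) N <= B.
Proof.
  (* With this q one has 1-q > 1/|x|, so the growth (1-q)^(-k) of the Kummer sums against |x|^(-k)
     leaves a ratio rho < 1. There is still room for r between 1 and 1/rho, which bounds the growth
     of [u]. *)
  set (q := (1 - / Cmod x) / 2).
  assert (Hix : 0 < / Cmod x < 1).
  { split; [apply Rinv_0_lt_compat; lra|rewrite <- Rinv_1; apply Rinv_lt_contravar; lra]. }
  assert (Hq : 0 < q < 1) by (unfold q; lra).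
  destruct (kummer_sum_bound e y q He Hq) as [K [HK0 HK]].
  set (rho := / Cmod x / (1 - q)).
  assert (Hrho : 0 < rho < 1).
  { unfold rho; split; [apply Rdiv_lt_0_compat; lra|].
    apply (Rmult_lt_reg_r (1 - q)); [lra|]; unfold Rdiv; rewrite Rmult_assoc, Rinv_l by lra.
    unfold q; lra. }
  set (r := (1 + / rho) / 2).
  assert (Hirho : 1 < / rho) by (rewrite <- Rinv_1; apply Rinv_lt_contravar; lra).
  destruct (Hu r) as [L HL]; [unfold r; lra|].
  assert (HL0 := rate_nonneg_const _ _ _ HL).
  set (z := r * rho).
  assert (Hz : 0 <= z < 1).
  { unfold z; assert (rho * / rho = 1) by (apply Rinv_r; lra).
    split; [apply Rmult_le_pos; unfold r; lra|unfold r; nra]. }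
  set (P := Rpower (1 - q) (- X)); assert (HP : 0 < P) by apply exp_pos.
  exists (L * K * P * / (1 - z)); intros N M.
  rewrite (sum_n_switch (fun n k => Cmod (w n k))).
  apply sum_n_geom_bound; auto; [repeat apply Rmult_le_pos; auto; lra|].
  intros k.
  apply Rle_trans with (Cmod (u k * / x ^ k) *
    sum_n (fun n => Cmod (kummer_term (al k) e y n)) N).
  - right; rewrite <- (sum_n_mult_l (K := R_Ring)); apply sum_n_ext; intros n.
    unfold w; apply Cmod_mult.
  - assert (Hx0 : x <> 0) by (apply Cmod_gt_0; lra).
    rewrite Cmod_mult, Cmod_inv, Cmod_pow by now apply Cpow_nz.
    replace (L * K * P * z ^ k) with
      (L * r ^ k * / Cmod x ^ k * (K * (P * (/ (1 - q)) ^ k))).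
    2:{ unfold z, rho, Rdiv; rewrite !Rpow_mult_distr, (pow_inv (Cmod x)); ring. }
    assert (Hxk : 0 <= / Cmod x ^ k) by (apply Rlt_le, Rinv_0_lt_compat, pow_lt; lra).
    apply Rmult_le_compat.
    + apply Rmult_le_pos; auto; apply Cmod_ge_0.
    + apply sum_n_nonneg; intros; apply Cmod_ge_0.
    + apply Rmult_le_compat_r; auto.
    + unfold P; rewrite <- Rpower_opp_plus_INR by lra; apply HK, Hal.
Qed.

Lemma kummer_expansion_summable :
  csummable (fun k => (hyp1F1 (al k) e y * u k * / x ^ k)%C).
Proof.
  assert (Hx0 : x <> 0) by (apply Cmod_gt_0; lra).
  apply ex_series_ext with (fun k => Cmod (u k * hyp1F1 (al k) e y * (/ x) ^ k)).
  { intros k; rewrite Cpow_inv by auto; f_equal; ring. }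
  apply rate_summable with 1; [lra| |].
  - apply rate_mult1; auto; [lra|now apply rate_hyp1F1 with X].
  - apply (rate_hC_inv_summable u); auto; lra.
Qed.

Lemma kummer_rows_summable : csummable (fun n => CSeries (w n)).
Proof. destruct kummer_double_bound as [B HB]; exact (double_rows_summable w B HB). Qed.

Lemma kummer_exchange : CSeries (fun n => CSeries (w n)) =
  CSeries (fun k => (hyp1F1 (al k) e y * u k * / x ^ k)%C).
Proof.
  destruct kummer_double_bound as [B HB]; rewrite (CSeries_fubini w B HB).
  apply CSeries_ext; intros k; unfold w.
  rewrite CSeries_scal by now apply kummer_summable.
  unfold hyp1F1; fold (kummer_term (al k) e y); ring.
Qed.

End Rearrangement.

(** * Shifting the first parameter by integers *)

Lemma poch_reflect z n :
  poch (z - INR n) n = ((- RtoC 1) ^ n * poch (1 - z) n)%C.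
Proof.
  induction n as [|n IH]; [simpl; ring|].
  rewrite poch_S_l.
  replace (z - INR (S n) + 1)%C with (z - INR n)%C
    by (rewrite RtoC_INR_S; ring).
  rewrite IH, Cpow_S, RtoC_INR_S; simpl poch; ring.
Qed.

Lemma poch_opp_INR n m :
  poch (RtoC (- INR (n + m))) n = ((- RtoC 1) ^ n * Cfact (n + m) / Cfact m)%C.
Proof.
  replace (RtoC (- INR (n + m))) with (RtoC (- INR m) - INR n)%C.
  2:{ rewrite <- RtoC_minus, plus_INR; f_equal; ring. }
  rewrite poch_reflect, RtoC_opp.
  replace (1 - - RtoC (INR m))%C with (1 + INR m)%C by ring.
  rewrite <- (poch_1 (n + m)), (Nat.add_comm n m), poch_add, poch_1.
  field; apply Cfact_neq_0.
Qed.

Lemma poch_opp_INR_0 n k : (k < n)%nat -> poch (RtoC (- INR k)) n = RtoC 0.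
Proof.
  intros H; replace n with (S k + (n - S k))%nat by lia; rewrite poch_add; simpl poch at 1.
  rewrite RtoC_opp; ring.
Qed.

Lemma Cpow_opp_1_sqr n : ((- RtoC 1) ^ n * (- RtoC 1) ^ n)%C = RtoC 1.
Proof.
  rewrite <- Cpow_mult_l; replace (- RtoC 1 * - RtoC 1)%C with (RtoC 1) by ring.
  apply Cpow_1_l.
Qed.

Lemma Cpow_opp_1_neq_0 n : ((- RtoC 1) ^ n)%C <> RtoC 0.
Proof. intros E; apply C1_nz; rewrite <- (Cpow_opp_1_sqr n), E; ring. Qed.

Lemma Cpow_opp x n : ((- x) ^ n)%C = ((- RtoC 1) ^ n * x ^ n)%C.
Proof. rewrite <- Cpow_mult_l; f_equal; ring. Qed.

(** The two 1/Gamma factors with arguments lowered by n each produce a sign (-1)^n, and these cancel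
    in the quotient. *)
Lemma ff_shift_first a b c n : ~ is_int (a - b) ->
  ff c b (a + INR n)%C =
  (ff c b a * (poch (1 - c + a) n / poch (1 - b + a) n))%C.
Proof.
  intros Hab; assert (Hg := not_is_int_exponent a b Hab).
  assert (Hba : ~ nonpos_int (b - a)).
  { intros [m Hm]; apply (is_int_opp a b Hab); exists (- Z.of_nat m)%Z.
    now rewrite opp_IZR, <- INR_IZR_INZ. }
  assert (Hr := rGamma_neq_0 _ Hba).
  assert (Hp := poch_neq_0 _ n Hg).
  assert (E : forall z, rGamma (z - (a + INR n)) =
    ((- RtoC 1) ^ n * poch (1 - z + a) n * rGamma (z - a))%C).
  { intros z; rewrite (rGamma_poch (z - (a + INR n))%C n).
    replace (z - (a + INR n))%C with (z - a - INR n)%C by ring.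
    rewrite poch_reflect; f_equal; [f_equal; f_equal; ring|f_equal; ring]. }
  unfold ff, Gamma; rewrite !E.
  set (Y := (/ rGamma c)%C).
  assert (Hs := Cpow_opp_1_neq_0 n); field; auto.
Qed.

Lemma not_is_int_shift a b n : ~ is_int (a - b) -> ~ is_int (a + INR n - b).
Proof.
  intros H [k Hk]; apply H; exists (k - Z.of_nat n)%Z.
  rewrite minus_IZR, RtoC_minus, <- Hk, <- INR_IZR_INZ; ring.
Qed.

Lemma not_is_int_nonpos a b : ~ is_int (a - b) -> ~ nonpos_int (a - b).
Proof.
  intros H [m Hm]; apply H; exists (- Z.of_nat m)%Z; now rewrite opp_IZR, <- INR_IZR_INZ.
Qed.

Lemma ff_shift_second a b c n : ~ is_int (a - b) ->
  (poch a n * ff c (a + INR n)%C b)%C = (poch (a - b) n * ff c a b)%C.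
Proof.
  intros Hab.
  assert (Hr := rGamma_neq_0 _ (not_is_int_nonpos _ _ (not_is_int_shift a b n Hab))).
  assert (Hp := poch_neq_0 _ n (not_is_int_nonpos _ _ Hab)).
  unfold ff, Gamma; rewrite (rGamma_poch a n), (rGamma_poch (a - b)%C n).
  replace (a - b + INR n)%C with (a + INR n - b)%C by ring.
  set (Y := (/ rGamma c)%C); field; auto.
Qed.

(** (D-l)_(n+l) is split in two ways and then reflected. With D = a-b this trades the denominator
    (1-a-n+b)_l, which depends on n, for (1-a+b)_l and the numerator (a-b-l)_n of the Kummer
    series. *)
Lemma poch_exchange D n l :
  (poch D n * poch (1 - D) l)%C =
  (poch (D - INR l) n * poch (1 - (D + INR n)) l)%C.
Proof.
  assert (E1 := poch_reflect D l); assert (E2 := poch_reflect (D + INR n)%C l).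
  assert (Hs := Cpow_opp_1_neq_0 l).
  set (sg := (_ ^ l)%C) in *.
  assert (E : (poch (D - INR l) l * poch D n)%C =
    (poch (D - INR l) n * poch (D + INR n - INR l) l)%C).
  { replace D with (D - INR l + INR l)%C at 2 by ring.
    replace (D + INR n - INR l)%C with
      (D - INR l + INR n)%C by ring.
    rewrite <- !poch_add; f_equal; lia. }
  rewrite E1, E2 in E.
  transitivity (sg * poch (1 - D) l * poch D n / sg)%C; [field; auto|].
  rewrite E; field; auto.
Qed.

Definition U1_coef (a b c : C) (k : nat) : C :=
  (poch a k * poch (1 - c + a) k /
       (poch (1 - b + a) k * Cfact k))%C.

Definition U2_coef (a b c : C) (l : nat) : C :=
  (poch (1 - c + b) l * poch b l /
       (poch (1 - a + b) l * Cfact l))%C.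

Lemma rate_U1_coef a b c : ~ is_int (a - b) -> rate (U1_coef a b c) 1.
Proof.
  intros H; assert (Hg := not_is_int_exponent a b H).
  apply rate_ext with (fun k => (poch a k / poch (1 - b + a) k *
    rf (1 - c + a) k)%C).
  - intros k; unfold U1_coef, rf; field; auto using poch_neq_0, Cfact_neq_0.
  - apply rate_mult1; [lra|now apply rate_poch_ratio|apply rate_rf].
Qed.

Lemma U2_coef_U1_coef a b c l : U2_coef a b c l = U1_coef b a c l.
Proof. unfold U2_coef, U1_coef; f_equal; apply Cmult_comm. Qed.

Lemma rate_U2_coef a b c : ~ is_int (a - b) -> rate (U2_coef a b c) 1.
Proof.
  intros H; apply rate_ext with (U1_coef b a c); [intros; symmetry; apply U2_coef_U1_coef|].
  now apply rate_U1_coef, is_int_opp.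
Qed.

Lemma VF_inf_series a b c x : ~ is_int (a - b) -> 1 < Cmod x ->
  csummable (fun m => (inf_coef a b c m * (/ (- x)) ^ m)%C) /\
  VF_inf a b c x = (Cpower (- x) (- a)%C *
    CSeries (fun m => (inf_coef a b c m * (/ (- x)) ^ m)%C))%C.
Proof.
  intros Hab Hx; split.
  - apply rate_summable with 1; [lra|now apply rate_inf_coef|].
    apply (rate_hC_inv_summable (inf_coef a b c)); [lra|now apply rate_inf_coef|].
    rewrite Cmod_opp; lra.
  - unfold VF_inf, VF, hC; replace (0 - x)%C with (- x)%C by ring; reflexivity.
Qed.

Lemma Cmod_opp_INR_bound k : Cmod (RtoC (- INR k)) <= 0 + INR k.
Proof. rewrite Cmod_R, Rabs_Ropp, Rabs_pos_eq by apply pos_INR; lra. Qed.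

Lemma Cmod_minus_INR_bound D k : Cmod (D - INR k) <= Cmod D + INR k.
Proof.
  unfold Cminus; apply Rle_trans with (1 := Cmod_triangle _ _).
  rewrite Cmod_opp, Cmod_R, Rabs_pos_eq by apply pos_INR; lra.
Qed.

(** * The rows of the double series and the complete expansion *)

Section Expansion.

Variables (a b c c' x y : C).
Hypotheses (hc : ~ nonpos_int c) (hc' : ~ nonpos_int c') (hab : ~ is_int (a - b)).
Hypothesis (hx : 1 < Cmod x).

Let w1 n k := (U1_coef a b c k * / x ^ k * kummer_term (RtoC (- INR k)) c' y n)%C.
Let w2 n l := (U2_coef a b c l * / x ^ l *
  kummer_term (a - b - INR l)%C c' y n)%C.

Lemma U1_terms_summable : csummable (U1_term a b c c' x y).
Proof.
  exact (kummer_expansion_summable (fun k => RtoC (- INR k)) (U1_coef a b c) c' x y 0 hc'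
    Cmod_opp_INR_bound (rate_U1_coef a b c hab) hx).
Qed.

Lemma U2_terms_summable : csummable (U2_term a b c c' x y).
Proof.
  exact (kummer_expansion_summable (fun k => (a - b - INR k)%C) (U2_coef a b c)
    c' x y _ hc' (Cmod_minus_INR_bound _) (rate_U2_coef a b c hab) hx).
Qed.

(** (-k)_n vanishes for k < n, so row n starts at k = n. After this shift it is the expansion at
    infinity with a+n in place of a, up to the common factor [k0]; the missing x^(-n) comes from
    (-x)^(-(a+n)). *)
Lemma w1_row n :
  (lead1 a b c x * CSeries (w1 n))%C =
  (poch a n / poch c' n *
    (ff c b (a + INR n)%C * VF_inf (a + INR n)%C b c x) *
    (y ^ n / Cfact n))%C.
Proof.
  set (an := (a + INR n)%C).
  assert (Han : ~ is_int (an - b)) by now apply not_is_int_shift.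
  destruct (VF_inf_series an b c x Han hx) as [Hs Hv].
  rewrite Hv; unfold an at 1; rewrite ff_shift_first by auto.
  assert (Hx0 : x <> 0) by (apply Cmod_gt_0; lra).
  assert (Hx1 : (- x)%C <> 0) by (apply Cmod_gt_0; rewrite Cmod_opp; lra).
  unfold an at 1; rewrite Cpower_opp_plus_INR by auto.
  assert (Hg := not_is_int_exponent a b hab).
  set (S := fun m => (inf_coef an b c m * (/ (- x)) ^ m)%C) in *.
  set (k0 := (poch a n * poch (1 - c + a) n /
    (poch (1 - b + a) n * poch c' n) *
    (/ (- x) ^ n * (y ^ n / Cfact n)))%C).
  assert (E : CSeries (w1 n) = (k0 * CSeries S)%C).
  { rewrite <- CSeries_scal by auto; apply CSeries_unique, csum_skip with n.
    - intros k Hk; unfold w1, kummer_term; rewrite poch_opp_INR_0 by auto; unfold Cdiv; ring.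
    - apply csum_ext with (fun m => (k0 * S m)%C).
      2:{ assert (Hk := csum_correct _ (csummable_scal k0 S Hs)); exact Hk. }
      intros m; unfold w1, k0, S, kummer_term, U1_coef, inf_coef, rf.
      rewrite poch_opp_INR, !(poch_add _ n m).
      replace (1 - b + a + INR n)%C with
        (1 - b + an)%C by (unfold an; ring).
      replace (1 - c + a + INR n)%C with
        (1 - c + an)%C by (unfold an; ring).
      fold an.
      rewrite Cpow_inv, !(Cpow_opp x), Cpow_add_r by auto.
      assert (Hg' := not_is_int_exponent an b Han).
      assert (Hsn := Cpow_opp_1_sqr n); assert (Hsn0 := Cpow_opp_1_neq_0 n).
      assert (Hsm0 := Cpow_opp_1_neq_0 m).
      set (sn := ((- RtoC 1) ^ n)%C) in *; set (sm := ((- RtoC 1) ^ m)%C) in *.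
      (* One occurrence of the sign is traded for its inverse, so that [field] cancels the signs
         without knowing their square. *)
      assert (Hsn' : (/ sn)%C = sn) by (rewrite <- (Cmult_1_r (/ sn)%C), <- Hsn; field; auto).
      rewrite <- Hsn' at 1.
      field; repeat split; auto using poch_neq_0, Cfact_neq_0, Cpow_nz. }
  rewrite E; unfold lead1, k0; field; repeat split; auto using poch_neq_0, Cfact_neq_0, Cpow_nz.
Qed.

(** Here the exponent [b] is not shifted and every l contributes. The dependence on n moves from the
    coefficients into the Kummer factor by [poch_exchange], and from [ff] by [ff_shift_second]. *)
Lemma w2_row n :
  (lead2 a b c x * CSeries (w2 n))%C =
  (poch a n / poch c' n *
    (ff c (a + INR n)%C b * VF_inf b (a + INR n)%C c x) *
    (y ^ n / Cfact n))%C.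
Proof.
  set (an := (a + INR n)%C).
  assert (Han : ~ is_int (an - b)) by now apply not_is_int_shift.
  assert (Hban := is_int_opp _ _ Han); assert (hba := is_int_opp _ _ hab).
  destruct (VF_inf_series b an c x Hban hx) as [Hs Hv].
  assert (Hx0 : x <> 0) by (apply Cmod_gt_0; lra).
  assert (Hx1 : (- x)%C <> 0) by (apply Cmod_gt_0; rewrite Cmod_opp; lra).
  set (S := fun m => (inf_coef b an c m * (/ (- x)) ^ m)%C) in *.
  assert (Hg := not_is_int_exponent b a hba); assert (Hg' := not_is_int_exponent b an Hban).
  set (k0 := (poch (a - b) n / poch c' n * (y ^ n / Cfact n))%C).
  assert (E : CSeries (w2 n) = (k0 * CSeries S)%C).
  { rewrite <- CSeries_scal by auto; apply CSeries_ext; intros l.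
    assert (Ex := poch_exchange (a - b)%C n l).
    replace (1 - (a - b))%C with (1 - a + b)%C in Ex by ring.
    replace (1 - (a - b + INR n))%C with
      (1 - an + b)%C in Ex by (unfold an; ring).
    unfold w2, k0, S, kummer_term, U2_coef, inf_coef, rf.
    rewrite Cpow_inv, (Cpow_opp x) by auto.
    assert (Hsl := Cpow_opp_1_neq_0 l); set (sl := ((- RtoC 1) ^ l)%C) in *.
    assert (Hp1 := poch_neq_0 _ l Hg); assert (Hp2 := poch_neq_0 _ l Hg').
    set (G := poch (1 - a + b) l) in *.
    set (Gn := poch (1 - an + b) l) in *.
    assert (E1 : poch (a - b - INR l) n = (poch (a - b) n * G / Gn)%C).
    { rewrite Ex; field; auto. }
    rewrite E1; field; repeat split; auto using poch_neq_0, Cfact_neq_0, Cpow_nz. }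
  assert (Hff := ff_shift_second a b c n hab); fold an in Hff.
  rewrite E, Hv; unfold lead2, k0.
  transitivity (poch a n * ff c an b / poch c' n *
    (Cpower (- x) (- b)%C * CSeries S) * (y ^ n / Cfact n))%C.
  - rewrite Hff; field; auto using poch_neq_0, Cfact_neq_0.
  - field; auto using poch_neq_0, Cfact_neq_0.
Qed.

Lemma Psi1_term_rows n : sector x ->
  Psi1_term a b c c' x y n =
  (lead1 a b c x * CSeries (w1 n) + lead2 a b c x * CSeries (w2 n))%C.
Proof.
  intros Hsx; rewrite w1_row, w2_row; unfold Psi1_term.
  rewrite hyp2F1_connection by (auto using not_is_int_shift); ring.
Qed.

Lemma w1_rows_summable : csummable (fun n => CSeries (w1 n)).
Proof.
  exact (kummer_rows_summable (fun k => RtoC (- INR k)) (U1_coef a b c) c' x y 0 hc'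
    Cmod_opp_INR_bound (rate_U1_coef a b c hab) hx).
Qed.

Lemma w2_rows_summable : csummable (fun n => CSeries (w2 n)).
Proof.
  exact (kummer_rows_summable (fun k => (a - b - INR k)%C) (U2_coef a b c)
    c' x y _ hc' (Cmod_minus_INR_bound _) (rate_U2_coef a b c hab) hx).
Qed.

Lemma Psi1_terms_summable : sector x -> csummable (Psi1_term a b c c' x y).
Proof.
  intros Hsx; eapply ex_series_ext.
  - intros n; symmetry; exact (f_equal Cmod (Psi1_term_rows n Hsx)).
  - exact (csummable_plus _ _ (csummable_scal _ _ w1_rows_summable)
      (csummable_scal _ _ w2_rows_summable)).
Qed.

Theorem Psi1_expansion : sector x ->
  Psi1 a b c c' x y =
  (lead1 a b c x * U1 a b c c' x y + lead2 a b c x * U2 a b c c' x y)%C.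
Proof.
  intros Hsx; unfold Psi1; destruct (Rlt_dec (Cmod x) 1); [lra|].
  rewrite (CSeries_ext _ _ (fun n => Psi1_term_rows n Hsx)).
  rewrite CSeries_plus, !CSeries_scal
    by (try apply csummable_scal; auto using w1_rows_summable, w2_rows_summable).
  f_equal; f_equal.
  - exact (kummer_exchange (fun k => RtoC (- INR k)) (U1_coef a b c) c' x y 0 hc'
      Cmod_opp_INR_bound (rate_U1_coef a b c hab) hx).
  - exact (kummer_exchange (fun k => (a - b - INR k)%C) (U2_coef a b c)
      c' x y _ hc' (Cmod_minus_INR_bound _) (rate_U2_coef a b c hab) hx).
Qed.

End Expansion.

(** * Leading asymptotics *)

Lemma kummer_series_asymp (al u : nat -> C) e y X : ~ nonpos_int e ->
  (forall k, Cmod (al k) <= X + INR k) -> rate u 1 -> u O = 1 ->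
  exists K, 0 <= K /\ forall x, 2 <= Cmod x ->
    Cmod (CSeries (fun k => (hyp1F1 (al k) e y * u k * / x ^ k)%C) -
      hyp1F1 (al O) e y) <= K * / Cmod x.
Proof.
  intros He Hal Hu Hu0.
  set (d := fun k => (hyp1F1 (al k) e y * u k)%C).
  assert (Hd : rate d 1).
  { apply rate_mult1; [lra|now apply rate_hyp1F1 with X|auto]. }
  (* What follows the first term is 1/x times a power series in 1/x of rate 1, bounded for |1/x| <=
     1/2. *)
  destruct (hC_bound (fun k => d (S k)) 1 (1 / 2)) as [K [HK0 HK]]; try lra.
  { apply rate_shift; auto; lra. }
  exists K; split; auto; intros x Hx.
  assert (Hx0 : x <> 0) by (apply Cmod_gt_0; lra).
  assert (Hi : Cmod (/ x) <= 1 / 2).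
  { rewrite Cmod_inv by auto; unfold Rdiv; rewrite Rmult_1_l; apply Rinv_le_contravar; lra. }
  assert (E : CSeries (fun k => (hyp1F1 (al k) e y * u k * / x ^ k)%C) = hC d (/ x)%C).
  { unfold hC; apply CSeries_ext; intros k; now rewrite Cpow_inv. }
  rewrite E, (hC_step d 1) by (auto; lra).
  unfold d at 1; rewrite Hu0.
  replace (hyp1F1 (al O) e y * 1 + / x * hC (fun k => d (S k)) (/ x)%C -
    hyp1F1 (al O) e y)%C with (/ x * hC (fun k => d (S k)) (/ x)%C)%C by ring.
  rewrite Cmod_mult, (Cmod_inv x) by auto; rewrite Rmult_comm.
  apply Rmult_le_compat_r; [apply Rlt_le, Rinv_0_lt_compat; lra|now apply HK].
Qed.

Lemma hyp1F1_0 e y : hyp1F1 (RtoC (- INR 0)) e y = RtoC 1.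
Proof.
  unfold hyp1F1; apply CSeries_unique, csum_ext with (single (RtoC 1)); [|apply csum_singleton].
  intros [|n].
  - unfold single, Cfact; simpl; field; exact C1_nz.
  - rewrite poch_opp_INR_0 by lia; unfold single, Cdiv; ring.
Qed.

(** [U1] and [U2] differ from their first terms by O(1/|x|), uniformly in the direction of x, so the
    error is O(1/|x|) times |lead1| + |lead2|. *)
Theorem Psi1_asymp a b c c' y : ~ nonpos_int c -> ~ nonpos_int c' -> ~ is_int (a - b) ->
  asymp_o sector (fun x => Psi1 a b c c' x y) (fun x => Psi1_leading a b c c' x y) (lead_scale a
    b c).
Proof.
  intros hc hc' hab eps Heps.
  destruct (kummer_series_asymp (fun k => RtoC (- INR k)) (U1_coef a b c) c' y 0 hc'
    Cmod_opp_INR_bound (rate_U1_coef a b c hab)) as [K1 [HK1 H1]].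
  { unfold U1_coef; simpl; replace (Cfact 0) with (RtoC 1) by reflexivity; field; exact C1_nz. }
  destruct (kummer_series_asymp (fun k => (a - b - INR k)%C) (U2_coef a b c) c' y _ hc'
    (Cmod_minus_INR_bound _) (rate_U2_coef a b c hab)) as [K2 [HK2 H2]].
  { unfold U2_coef; simpl; replace (Cfact 0) with (RtoC 1) by reflexivity; field; exact C1_nz. }
  (* The summand 2 gives |1/x| <= 1/2, the other one (K1+K2)/|x| <= eps. *)
  exists (2 + (K1 + K2) / eps); intros x Hsx Hx.
  assert (HM : 0 <= (K1 + K2) / eps).
  { apply Rmult_le_pos; [lra|apply Rlt_le, Rinv_0_lt_compat; auto]. }
  rewrite Psi1_expansion by (auto; lra).
  specialize (H1 x ltac:(lra)); specialize (H2 x ltac:(lra)).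
  rewrite hyp1F1_0 in H1.
  replace (a - b - INR 0)%C with (a - b)%C in H2 by (simpl; ring).
  change (Cmod (U1 a b c c' x y - 1) <= K1 * / Cmod x) in H1.
  change (Cmod (U2 a b c c' x y - hyp1F1 (a - b)%C c' y) <= K2 * / Cmod x) in H2.
  assert (HKx : (K1 + K2) * / Cmod x <= eps).
  { apply (Rmult_le_reg_r (Cmod x)); [lra|]; rewrite Rmult_assoc, Rinv_l, Rmult_1_r by lra.
    replace (K1 + K2) with (eps * ((K1 + K2) / eps)) by (field; lra).
    apply Rmult_le_compat_l; lra. }
  assert (Hix : 0 < / Cmod x) by (apply Rinv_0_lt_compat; lra).
  unfold Psi1_leading, lead_scale.
  set (l1 := lead1 a b c x); set (l2 := lead2 a b c x).
  set (u1 := U1 a b c c' x y) in *; set (u2 := U2 a b c c' x y) in *; set (F := hyp1F1 _ _ _) in *.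
  replace (l1 * u1 + l2 * u2 - (l1 + l2 * F))%C with
    (l1 * (u1 - 1) + l2 * (u2 - F))%C by ring.
  apply Rle_trans with (1 := Cmod_triangle _ _); rewrite !Cmod_mult.
  assert (g1 := Cmod_ge_0 l1); assert (g2 := Cmod_ge_0 l2).
  assert (Cmod (u1 - 1) <= eps) by nra.
  assert (Cmod (u2 - F) <= eps) by nra.
  nra.
Qed.

Theorem theorem3p8 (a b c c' : C)
  (hc : ~ nonpos_int c) (hc' : ~ nonpos_int c') (hab : ~ is_int (Cminus a b)) :
  (* leading behaviour *)
  (forall y : C,
     asymp_o sector
       (fun x => Psi1 a b c c' x y)
       (fun x => Psi1_leading a b c c' x y)
       (lead_scale a b c)
     /\
     forall D : C -> Prop,
       (forall x, D x -> sector x) ->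
       nondegenerate_on D a b c c' y ->
       asymp_equiv D
         (fun x => Psi1 a b c c' x y)
         (fun x => Psi1_leading a b c c' x y))
  /\
  (* complete expansion *)
  (forall x y : C, 1 < Cmod x ->
     ex_series (K := C_AbsRing) (V := C_NormedModule) (U1_term a b c c' x y) /\
     ex_series (K := C_AbsRing) (V := C_NormedModule) (U2_term a b c c' x y) /\
     (sector x ->
        ex_series (K := C_AbsRing) (V := C_NormedModule)
          (Psi1_term a b c c' x y) /\
        Psi1 a b c c' x y =
          Cplus
            (Cmult (Cmult (ff c b a) (Cpower (Copp x) (Copp a)))
                   (U1 a b c c' x y))
            (Cmult (Cmult (ff c a b) (Cpower (Copp x) (Copp b)))
                   (U2 a b c c' x y)))).
Proof.
  split.
  - intros y; assert (H := Psi1_asymp a b c c' y hc hc' hab); split; auto.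
    intros D HD [delta [M0 [Hdelta Hnd]]] eps Heps.
    (* The factor delta is used up by the lower bound that nondegeneracy gives for the modulus of
       the leading sum. *)
    destruct (H (eps * delta) ltac:(nra)) as [M HM].
    exists (Rmax M M0); intros x Hx Hxm.
    apply Rle_trans with (1 := HM x (HD x Hx) (Rle_lt_trans _ _ _ (Rmax_l _ _) Hxm)).
    rewrite Rmult_assoc; apply Rmult_le_compat_l; [lra|].
    exact (Hnd x Hx (Rle_lt_trans _ _ _ (Rmax_r _ _) Hxm)).
  - intros x y Hx; split; [|split].
    + eexists; now apply csum_correct, U1_terms_summable.
    + eexists; now apply csum_correct, U2_terms_summable.
    + intros Hsx; split; [|now apply Psi1_expansion].
      eexists; now apply csum_correct, Psi1_terms_summable.
Qed.
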